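(* Let $\Omega\subset\mathbb{R}^d$ be a smooth bounded domain with $0\in\Omega$, $(D,N)$ a D-N configuration, and assume $\Lambda_N<\Lambda$. Let $\bar u$ be a minimizer of $\Lambda_N$. Then $\Lambda_N$ is a simple and isolated eigenvalue of the problem $$(-\Delta)^s u=\lambda\frac{u}{|x|^{2s}}\ \text{in }\Omega,\quad u\in\mathbb{E}^s(\Omega,D),\quad \mathcal{B}_s u=0\ \text{in }\mathbb{R}^d\setminus\Omega \qquad (\ast)$$ in the following sense: (1) if $v$ is any weak solution of $(\ast)$ with $\lambda=\Lambda_N$, then $v=C\bar u$ for some $C\in\mathbb{R}$; (2) there exists $\varepsilon>0$ such that for every $\lambda\in(\Lambda_N,\Lambda_N+\varepsilon)$ problem $(\ast)$ has no nontrivial weak solution.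
   Context: $0<s<1$, $d>2s$. A D-N configuration is a pair $(D,N)$ of open subsets of $\mathbb{R}^d\setminus\Omega$ with $N\cap D=\emptyset$, $\overline N\cup\overline D=\mathbb{R}^d\setminus\Omega$. $d\nu=\frac{dx\,dy}{|x-y|^{d+2s}}$, $\mathcal{D}_\Omega=(\mathbb{R}^d\times\mathbb{R}^d)\setminus(\Omega^c\times\Omega^c)$, $a_{d,s}$ the fractional Laplacian normalization constant. $\mathbb{E}^s(\Omega,D)=\{u\in H^s(\mathbb{R}^d):u=0\text{ in }D\}$. $\mathcal{N}_s u(x)=a_{d,s}\int_\Omega\frac{u(x)-u(y)}{|x-y|^{d+2s}}dy$ for $x\notin\overline\Omega$, $\mathcal{B}_s u=u\chi_D+\mathcal{N}_s u\chi_N$. A weak solution of $(-\Delta)^s u=f$ in $\Omega$, $\mathcal{B}_su=0$ outside, is $u\in\mathbb{E}^s(\Omega,D)$ with $\frac{a_{d,s}}{2}\iint_{\mathcal{D}_\Omega}(u(x)-u(y))(\varphi(x)-\varphi(y))d\nu=\int_\Omega f\varphi$ for all $\varphi\in\mathbb{E}^s(\Omega,D)$. $\Lambda_N=\inf_{\phi\in\mathbb{E}^s(\Omega,D)\setminus\{0\}}\frac{\frac{a_{d,s}}{2}\iint_{\mathcal{D}_\Omega}|\phi(x)-\phi(y)|^2d\nu}{\int_\Omega\phi^2|x|^{-2s}dx}$ and $\Lambda=2^{2s}\Gamma^2(\frac{d+2s}{4})/\Gamma^2(\frac{d-2s}{4})$. *)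

(* Defs.v *)
From HB Require Import structures.
From mathcomp Require Import all_boot all_order all_algebra.
From mathcomp Require Import all_classical all_reals all_analysis.
Set Implicit Arguments. Unset Strict Implicit. Unset Printing Implicit Defensive.
Import Order.TTheory GRing.Theory Num.Theory.
Import numFieldNormedType.Exports.
Local Open Scope classical_set_scope.
Local Open Scope ring_scope.

Section FracHardy.
Variable R : realType.

Definition enorm (d : nat) (x : 'rV[R]_d) : R := Num.sqrt (\sum_i (x ord0 i) ^+ 2).

Definition borel_fun (d : nat) (f : 'rV[R]_d -> R) : Prop :=
  forall B : set R, measurable B ->
    <<s [set A : set 'rV[R]_d | open A] >> (f @^-1` B).

(* Lebesgue integral on R^d of a nonnegative (Borel) function, computed as the
   iterated one-dimensional Lebesgue integral (equal to it by Tonelli). *)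
Fixpoint iint (n : nat) : ('rV[R]_n -> \bar R) -> \bar R :=
  match n with
  | 0 => fun f => f 0
  | n'.+1 => fun f =>
      (\int[@lebesgue_measure R]_t iint (fun v : 'rV[R]_n' => f (row_mx (\row_(_ < 1) t) v)))%E
  end.

Definition iint2 (d : nat) (F : 'rV[R]_d -> 'rV[R]_d -> \bar R) : \bar R :=
  iint (fun x => iint (fun y => F x y)).

Definition sint (d : nat) (f : 'rV[R]_d -> R) : R :=
  fine (iint (fun x => (Num.max (f x) 0)%:E)) - fine (iint (fun x => (Num.max (- f x) 0)%:E)).
Definition sint2 (d : nat) (F : 'rV[R]_d -> 'rV[R]_d -> R) : R :=
  fine (iint2 (fun x y => (Num.max (F x y) 0)%:E))
  - fine (iint2 (fun x y => (Num.max (- F x y) 0)%:E)).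

Definition ae_zero_on (d : nat) (A : set 'rV[R]_d) (f : 'rV[R]_d -> R) : Prop :=
  iint (fun x => (\1_[set y | A y /\ f y <> 0] x)%:E) = 0%E.

Definition kern (d : nat) (s : R) (x y : 'rV[R]_d) : R :=
  enorm (x - y) `^ (- (d%:R + 2 * s)).

Definition Hs (d : nat) (s : R) (u : 'rV[R]_d -> R) : Prop :=
  [/\ borel_fun u,
      (iint (fun x => (u x ^+ 2)%:E) < +oo)%E &
      (iint2 (fun x y => ((u x - u y) ^+ 2 * kern s x y)%:E) < +oo)%E].

Definition Es (d : nat) (s : R) (D : set 'rV[R]_d) (u : 'rV[R]_d -> R) : Prop :=
  Hs s u /\ ae_zero_on D u.

Definition DOm (d : nat) (Om : set 'rV[R]_d) (x y : 'rV[R]_d) : R :=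
  \1_[set p : 'rV[R]_d * 'rV[R]_d | Om p.1 \/ Om p.2] (x, y).

Definition Gamma (x : R) : R :=
  fine (\int[@lebesgue_measure R]_(t in [set t : R | (0 < t)%R])
          (((t `^ (x - 1)) * expR (- t))%R)%:E)%E.

(* fractional Laplacian normalization constant a_{d,s}
   = s 2^{2s} Gamma((d+2s)/2) / (pi^{d/2} Gamma(1-s))
   = 2^{2s} Gamma((d+2s)/2) / (pi^{d/2} |Gamma(-s)|) *)
Definition ads (d : nat) (s : R) : R :=
  s * 2 `^ (2 * s) * Gamma ((d%:R + 2 * s) / 2) / (pi `^ (d%:R / 2) * Gamma (1 - s)).

Definition energy (d : nat) (s : R) (Om : set 'rV[R]_d) (u phi : 'rV[R]_d -> R) : R :=
  ads d s / 2 * sint2 (fun x y => DOm Om x y * ((u x - u y) * (phi x - phi y)) * kern s x y).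

Definition hardy_form (d : nat) (s : R) (Om : set 'rV[R]_d) (u phi : 'rV[R]_d -> R) : R :=
  sint (fun x => \1_Om x * (u x * phi x) * enorm x `^ (- (2 * s))).

Definition Qnum (d : nat) (s : R) (Om : set 'rV[R]_d) (phi : 'rV[R]_d -> R) : \bar R :=
  ((ads d s / 2)%:E *
    iint2 (fun x y => (DOm Om x y * (phi x - phi y) ^+ 2 * kern s x y)%:E))%E.
Definition Qden (d : nat) (s : R) (Om : set 'rV[R]_d) (phi : 'rV[R]_d -> R) : \bar R :=
  iint (fun x => (\1_Om x * phi x ^+ 2 * enorm x `^ (- (2 * s)))%:E).

Definition admissible (d : nat) (s : R) (Om D : set 'rV[R]_d) (phi : 'rV[R]_d -> R) : Prop :=
  [/\ Es s D phi, ~ ae_zero_on setT phi & (0 < Qden s Om phi < +oo)%E].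

Definition rayleigh (d : nat) (s : R) (Om : set 'rV[R]_d) (phi : 'rV[R]_d -> R) : R :=
  fine (Qnum s Om phi) / fine (Qden s Om phi).

Definition LambdaN (d : nat) (s : R) (Om D : set 'rV[R]_d) : R :=
  inf [set rayleigh s Om phi | phi in admissible s Om D].

(* sharp fractional Hardy constant Lambda *)
Definition LambdaH (d : nat) (s : R) : R :=
  2 `^ (2 * s) * Gamma ((d%:R + 2 * s) / 4) ^+ 2 / Gamma ((d%:R - 2 * s) / 4) ^+ 2.

Fixpoint Ck (d : nat) (k : nat) (f : 'rV[R]_d -> R) : Prop :=
  match k with
  | 0 => continuous f
  | k'.+1 => continuous f /\
      forall v : 'rV[R]_d, (forall x, derivable f x v) /\ Ck k' (fun x => 'D_v f x)
  end.
Definition smooth_fun (d : nat) (f : 'rV[R]_d -> R) : Prop := forall k, Ck k f.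

Definition smooth_bounded_domain (d : nat) (Om : set 'rV[R]_d) : Prop :=
  [/\ open Om, connected Om, Om !=set0,
      (exists M : R, forall x, Om x -> enorm x <= M) &
      exists rho : 'rV[R]_d -> R,
        [/\ smooth_fun rho, Om = [set x | rho x < 0] &
            forall x, rho x = 0 -> exists v : 'rV[R]_d, 'D_v rho x <> 0]].

Definition DN_config (d : nat) (Om D N : set 'rV[R]_d) : Prop :=
  [/\ open D /\ open N, D `<=` ~` Om, N `<=` ~` Om,
      D `&` N = set0 & closure N `|` closure D = ~` Om].

Definition weak_eig_sol (d : nat) (s : R) (Om D : set 'rV[R]_d) (lam : R)
  (u : 'rV[R]_d -> R) : Prop :=
  Es s D u /\
  forall phi, Es s D phi -> energy s Om u phi = lam * hardy_form s Om u phi.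

End FracHardy.

(* Main.v *)
(** Let [a] be the energy, [b] the Hardy form, [mu = Lambda_N] and [q = a - mu b], which is
    nonnegative on [E^s].  No compact embedding is used; everything follows from a gap inequality:
    [q(u) >= c b(u)] whenever [u] in [E^s] has [\int_Om u = 0].

    The gap has two sources.  Passing from [u] to [|u|] lowers the energy by at least
    [c1 ((\int_Om |u|)^2 - (\int_Om u)^2)], since the kernel is bounded below on the bounded
    set [Om * Om]; as [q(|u|) >= 0], a function of zero mean satisfies
    [q(u) >= c1 (\int_Om |u|)^2].  On the other hand [mu < Lambda]: for [mu < nu < Lambda] the
    sharp Hardy inequality on [R^d], localized near the origin, gives
    [nu b(u) <= a(u) + C \int_Om u^2], and a Nash type inequality on [Om] gives
    [\int_Om u^2 <= eps a(u) + C_eps (\int_Om |u|)^2].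

    By the Euler-Lagrange equation [q(ubar, .) = 0], so the gap forces [\int_Om ubar <> 0], and
    [w = v - C ubar] has zero mean for a suitable [C].  If [v] is a solution for [mu] then
    [q(w) = 0], so [w = 0].  If [v] is a solution for [lam <> mu] then [b(v, ubar) = 0],
    so [q(w) = q(v) = (lam - mu) b(v)] while [b(w) >= b(v)], whence [lam - mu >= c] or [v = 0].

    The sharp Hardy inequality is the ground state substitution with the weight
    [|x|^(-(d-2s)/2)].  Both this weight and the kernel [|x|^(-d-2s)] are integrals in time of the
    heat kernel against powers of time; cutting these integrals off near time zero makes
    every integral converge, and reduces the fact that the weight is a supersolution to a
    one-dimensional inequality between powers on the time axis. *)
Require Import Defs.
From HB Require Import structures.
From mathcomp Require Import all_boot all_order all_algebra.
From mathcomp Require Import all_classical all_reals all_analysis.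
From mathcomp Require Import measurable_realfun normal_distribution ring lra.
Set Implicit Arguments. Unset Strict Implicit. Unset Printing Implicit Defensive.
Import Order.TTheory GRing.Theory Num.Theory.
Import numFieldNormedType.Exports.
Local Open Scope classical_set_scope.
Local Open Scope ring_scope.

(** * Lebesgue measure on R^d as an iterated product *)

(** The forms are built from [fine] of iterated integrals, so they are bilinear only where these
    integrals converge. The Hardy inequality therefore serves twice: at one constant below [LambdaH]
    it makes the Hardy form finite on [Es], and at a constant between [LambdaN] and [LambdaH] it
    yields the gap.

    The zero-mean part of the gap is an effect of nonlocality: the positive and negative parts of a
    function interact through the kernel at every distance, which takes the place of a sign or a
    maximum principle for the minimizer.

    The kernel [|x|^(-d-2s)] has infinite mass, so [(f x - f y)^2] cannot be expanded under the
    integral. Cut off at time [eps], it has mass [eps^(-s)/s], and the expansion is legitimate for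
    [f] in [L^2]. By homogeneity the time inequality depends on [eps / t] alone. Its best constant
    [Gamma beta * Gamma (1 - s) / (s * Gamma (beta - s))] is minus the analytically continued beta
    function at [(-s, beta)]; it is reached by contradiction, by testing against [exp (-t)]. The
    exponent [beta = (d + 2s)/4] comes from [2 beta - d = -(d - 2s)/2], the power of the ground
    state. *)

Section EuclideanMeasure.
Variable R : realType.

(** The generating family is the one in [borel_fun], so that measurability on [rVb n] and
    [borel_fun] agree ([borel_funP]). *)
Definition rVb (n : nat) := g_sigma_algebraType (@open 'rV[R]_n).

Lemma measurable_rVb n (A : set 'rV[R]_n) : open A -> measurable (A : set (rVb n)).
Proof. by move=> oA; apply: sub_gen_smallest. Qed.

Lemma ball_rV n (x y : 'rV[R]_n) (e : R) :
  ball x e y <-> 0 < e /\ forall i, `|x ord0 i - y ord0 i| < e.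
Proof.
split=> [[e0 H]|[e0 H]]; first by split => // i; apply: H.
split=> // i j; rewrite (ord1 i); exact: H.
Qed.

(** Second countability, with rational centres and radii [1/(k+1)]. The inclusion of the ball in [U]
    is a condition inside the indexed set, so that the union runs over a plain countable type. *)
Lemma open_rV_bigcup n (U : set 'rV[R]_n) : open U ->
  U = \bigcup_(p in [set: {ffun 'I_n -> rat} * nat])
    [set x | (ball (\row_i ratr (p.1 i) : 'rV[R]_n) (p.2.+1%:R^-1) `<=` U) /\
       ball (\row_i ratr (p.1 i) : 'rV[R]_n) (p.2.+1%:R^-1) x].
Proof.
move=> oU; apply/seteqP; split => [x Ux|x [p _ [sU]]]; last exact: sU.
have /nbhs_ballP[e /= e0 xeU] : nbhs x U by exact: open_nbhs_nbhs.
have [k ke] : exists k : nat, (k.+1%:R^-1 : R) < e / 2.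
  have e20 : 0 < e / 2 by rewrite divr_gt0.
  exists (Num.truncn (e / 2)^-1).
  by rewrite invf_plt ?posrE// truncnS_gt.
have H (i : 'I_n) : exists q : rat, `|ratr q - x ord0 i| < (k.+1%:R^-1 : R).
  have [||y [/= yx [q _ qy]]] :=
      @dense_rat R [set y : R | `|y - x ord0 i| < k.+1%:R^-1].
  - by exists (x ord0 i) => /=; rewrite subrr normr0 invr_gt0.
  - rewrite (_ : [set _ | _] = ball (x ord0 i) (k.+1%:R^-1)); first exact: ball_open.
    by apply/seteqP; split => y /=; rewrite /ball/= distrC.
  by exists q; rewrite qy.
have [f fP] := choice H.
have kinv : 0 < (k.+1%:R^-1 : R) by rewrite invr_gt0.
have bx : ball (\row_i ratr ([ffun i => f i] i) : 'rV[R]_n) (k.+1%:R^-1) x.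
  by apply/ball_rV; split => // i; rewrite mxE ffunE.
exists ([ffun i => f i], k) => //=; split => //.
apply: subset_trans xeU => y by_.
rewrite (splitr e); apply: ball_triangle.
  by apply: le_ball (ball_sym bx); exact: ltW.
by apply: le_ball by_; exact: ltW.
Qed.

(** It is enough to pull back open sets. Each is a countable union of sup-norm balls, and such a
    ball is a finite intersection of conditions on single coordinates. *)
Lemma measurable_fun_rVb d (X : measurableType d) n (g : X -> rVb n) :
  (forall i, measurable_fun setT (fun x => (g x : 'rV[R]_n) ord0 i)) ->
  measurable_fun setT g.
Proof.
move=> mg; apply: (@measurability _ _ X (rVb n) setT g (@open 'rV[R]_n)) => //.
move=> _ [U oU <-]; rewrite setTI (open_rV_bigcup oU) preimage_bigcup.
apply: countable_bigcupT_measurable; first exact: countableP.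
move=> -[q k] /=; rewrite /preimage/=.
have [sU|nsU] := pselect (ball (\row_i ratr (q i) : 'rV[R]_n) (k.+1%:R^-1) `<=` U);
  last first.
  rewrite (_ : mkset _ = set0)//; apply/seteqP; split => // x [/= ? _].
  exact: nsU.
rewrite (_ : mkset _ =
    \bigcap_(i in [set: 'I_n]) [set x | `|(ratr (q i) : R) - (g x : 'rV[R]_n) ord0 i| < k.+1%:R^-1]).
  apply: fin_bigcap_measurable => // i _.
  have mf : measurable_fun setT (fun x => `|(ratr (q i) : R) - (g x : 'rV[R]_n) ord0 i|).
    by apply: measurableT_comp => //; exact: measurable_funB.
  rewrite -[X in measurable X]setTI (_ : [set _ | _] =
    (fun x => `|(ratr (q i) : R) - (g x : 'rV[R]_n) ord0 i|) @^-1` `]-oo, k.+1%:R^-1[).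
    exact: mf.
  by apply/seteqP; split => x /=; rewrite in_itv.
apply/seteqP; split => x /=.
  by move=> [_ /ball_rV[_ H]] i _ /=; have := H i; rewrite mxE.
by move=> H; split => //; apply/ball_rV; split => // i; rewrite mxE; exact: H.
Qed.

Lemma measurable_fun_open d (X : measurableType d) (f : X -> R) :
  (forall U : set R, open U -> measurable (f @^-1` U)) -> measurable_fun setT f.
Proof.
move=> mf; apply: (@measurability _ _ X R setT f (@RGenOpens.G R)).
  exact: RGenOpens.measurableE.
move=> _ [U [a [b ->]] <-]; rewrite setTI; apply: mf; exact: interval_open.
Qed.

Lemma measurable_EFinT (f : R -> R) :
  measurable_fun setT f -> measurable_fun [set: measurableTypeR R] (EFin \o f).
Proof.
move=> mf; have mf' : measurable_fun [set: measurableTypeR R] f by exact: mf.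
exact/measurable_EFinP.
Qed.

Lemma continuous_measurable_rVb n (f : 'rV[R]_n -> R) :
  continuous f -> measurable_fun [set: rVb n] f.
Proof.
move=> cf; apply: measurable_fun_open => U oU; apply: measurable_rVb.
by move/continuousP : cf; apply.
Qed.

Lemma measurable_coord n (i : 'I_n) :
  measurable_fun [set: rVb n] (fun x : 'rV[R]_n => x ord0 i).
Proof. by apply: continuous_measurable_rVb; exact: coord_continuous. Qed.

(** The same [row_mx] as in the recursion of [iint]: pushing a product measure forward along it
    reproduces one step of [iint]. *)
Definition rcons1 n (p : measurableTypeR R * rVb n) : rVb n.+1 :=
  row_mx (\row_(_ < 1) (p.1 : R)) (p.2 : 'rV[R]_n).
Definition runcons1 n (x : rVb n.+1) : measurableTypeR R * rVb n :=
  ((x : 'rV[R]_n.+1) ord0 ord0, rsubmx (x : 'rV[R]_(1 + n))).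

Lemma measurable_rcons1 n : measurable_fun setT (@rcons1 n).
Proof.
apply: measurable_fun_rVb => i.
have [[j ->]|[j ->]] : (exists j : 'I_1, i = lshift n j :> 'I_(1 + n)) \/
    (exists j : 'I_n, i = rshift 1 j :> 'I_(1 + n)).
  by case: (@split_ordP 1 n i) => j ->; [left|right]; exists j.
  rewrite [X in measurable_fun _ X](_ : _ = fst); first exact: measurable_fst.
  by apply/funext => p; rewrite [LHS]row_mxEl mxE.
rewrite [X in measurable_fun _ X](_ : _ = (fun v : rVb n => (v : 'rV[R]_n) ord0 j) \o snd).
  by apply: measurableT_comp; [exact: measurable_coord|exact: measurable_snd].
by apply/funext => p; rewrite [LHS]row_mxEr.
Qed.

Lemma measurable_runcons1 n : measurable_fun setT (@runcons1 n).
Proof.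
apply: measurable_fun_pair; first exact: measurable_coord.
apply: measurable_fun_rVb => i; under eq_fun do rewrite mxE.
exact: measurable_coord.
Qed.

Lemma rcons1K n : cancel (@rcons1 n) (@runcons1 n).
Proof.
move=> [t v]; rewrite /runcons1 /rcons1/= row_mxKr; congr pair.
have E : @ord0 n = lshift n (@ord0 0) :> 'I_(1 + n) by exact: val_inj.
by rewrite E [LHS]row_mxEl mxE.
Qed.


(** The left inverse supplies the exhaustion: the preimages of the [F k] under [g] pull back along
    [f] to the [F k] themselves. *)
Lemma sigma_finite_pushforward d1 d2 (X : measurableType d1) (Y : measurableType d2)
  (m : set X -> \bar R) (f : X -> Y) (g : Y -> X) :
  measurable_fun setT f -> measurable_fun setT g -> cancel f g ->
  sigma_finite setT m -> sigma_finite setT (pushforward m f).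
Proof.
move=> mf mg fg [F FT Foo].
exists (fun k => g @^-1` F k).
  by rewrite -preimage_bigcup -FT.
move=> k; have [mFk Fkoo] := Foo k; split; first by rewrite -[X in measurable X]setTI; exact: mg.
rewrite /pushforward -comp_preimage (_ : g \o f = id)//.
by apply/funext => x /=; rewrite fg.
Qed.

(* The library instance for [m1 \x m2] is only found when [m1] and [m2] are finite. *)
Lemma sigma_finite_prod d1 d2 (T1 : measurableType d1) (T2 : measurableType d2)
  (m1 : {sigma_finite_measure set T1 -> \bar R})
  (m2 : {sigma_finite_measure set T2 -> \bar R}) :
  sigma_finite setT (m1 \x m2)%E.
Proof.
have /sigma_finiteP[F [TF ndF Foo]] := sigma_finiteT m1.
have /sigma_finiteP[G [TG ndG Goo]] := sigma_finiteT m2.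
exists (fun n => F n `*` G n).
  rewrite -setXTT TF TG; apply/seteqP; split => -[x y].
    move=> [/= [n _ Fnx] [k _ Gky]]; exists (maxn n k) => //; split.
      by move: x Fnx; apply/subsetPset/ndF/leq_maxl.
    by move: y Gky; apply/subsetPset/ndG/leq_maxr.
  by move=> [n _ []/= ? ?]; split; exists n.
move=> k; have [? ?] := Foo k; have [? ?] := Goo k.
split; first exact: measurableX.
by rewrite product_measure1E// lte_mul_pinfty// ge0_fin_numE.
Qed.

Section rcons_measure.
Variables (n : nat) (m : {sigma_finite_measure set (rVb n) -> \bar R}).

Definition rcons_measure := pushforward (@lebesgue_measure R \x m)%E (@rcons1 n).

Let mr := @measurable_rcons1 n.
Let rcons_measure0 : rcons_measure set0 = 0%E.
Proof. by rewrite /rcons_measure /pushforward preimage_set0 measure0. Qed.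

Let rcons_measure_ge0 A : (0 <= rcons_measure A)%E.
Proof. exact: measure_ge0. Qed.

Let rcons_measure_sigma_additive : semi_sigma_additive rcons_measure.
Proof.
move=> F mF tF mUF; rewrite /rcons_measure /pushforward preimage_bigcup.
apply: measure_semi_sigma_additive.
- by move=> k; rewrite -[X in measurable X]setTI; exact: mr.
- apply/trivIsetP => /= i j _ _ ij; rewrite -preimage_setI.
  by move/trivIsetP : tF => /(_ _ _ _ _ ij) ->//; rewrite preimage_set0.
- by rewrite -preimage_bigcup -[X in measurable X]setTI; exact: mr.
Qed.

HB.instance Definition _ := isMeasure.Build _ _ _ rcons_measure
  rcons_measure0 rcons_measure_ge0 rcons_measure_sigma_additive.

Let rcons_measure_sigma_finite : sigma_finite setT rcons_measure.
Proof.
apply: (@sigma_finite_pushforward _ _ _ _ (@lebesgue_measure R \x m)%E _ (@runcons1 n)).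
- exact: mr.
- exact: measurable_runcons1.
- exact: rcons1K.
- exact: sigma_finite_prod.
Qed.

HB.instance Definition _ := Measure_isSigmaFinite.Build _ _ _ rcons_measure
  rcons_measure_sigma_finite.

End rcons_measure.

Fixpoint leb (n : nat) : {sigma_finite_measure set (rVb n) -> \bar R} :=
  match n with
  | 0 => \d_(0 : rVb 0)
  | n'.+1 => rcons_measure (leb n')
  end.

(** Tonelli, one coordinate at a time. [iint] makes sense for every function, but comparing it with
    a product measure requires joint measurability and a sign. *)
Lemma iintE n (f : rVb n -> \bar R) : measurable_fun setT f -> (forall x, 0 <= f x)%E ->
  iint f = (\int[leb n]_x f x)%E.
Proof.
elim: n f => [|n IH] f mf f0 /=.
  by rewrite integral_dirac// diracT mul1e.
rewrite (ge0_integral_pushforward (@measurable_rcons1 n) (lebesgue_measure \x leb n)%E)//.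
have mfr : measurable_fun setT (f \o @rcons1 n).
  exact: (measurableT_comp mf (@measurable_rcons1 n)).
rewrite preimage_setT fubini_tonelli1//.
apply: eq_integral => t _; rewrite /fubini_F /= -IH//.
  exact: (measurable_fun_pair2 t mfr).
by move=> x; exact: f0.
Qed.

(** Used for the Gaussian, which is a product over coordinates, and for the indicator of a cube,
    which is a sup-norm ball. *)
Lemma leb_prod n (f : 'I_n -> R -> R) :
  (forall i, measurable_fun setT (f i)) -> (forall i t, 0 <= f i t) ->
  (\int[leb n]_x (\prod_(i < n) f i ((x : 'rV[R]_n) ord0 i))%:E =
   \prod_(i < n) \int[@lebesgue_measure R]_t (f i t)%:E)%E.
Proof.
elim: n f => [|n IH] f mf f0.
  rewrite big_ord0 (eq_integral (cst 1%E)) ?integral_cst//=; last first.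
    by move=> x _; rewrite big_ord0.
  by rewrite diracT mule1.
have mprod m (g : 'I_m -> R -> R) : (forall i, measurable_fun setT (g i)) ->
    measurable_fun setT (fun x : rVb m => (\prod_(i < m) g i ((x : 'rV[R]_m) ord0 i))%:E).
  move=> mg; apply/measurable_EFinP; apply: measurable_prod => i _.
  exact: measurableT_comp (mg i) (measurable_coord i).
rewrite -iintE/=; last 2 first.
- exact: mprod.
- by move=> x; rewrite lee_fin; apply: prodr_ge0 => i _; exact: f0.
rewrite big_ord_recl -ge0_integralZr//; last 3 first.
- exact: measurable_EFinT.
- by move=> t _; rewrite lee_fin.
- by apply: prode_ge0 => i _; apply: integral_ge0 => t _; rewrite lee_fin.
apply: eq_integral => t _.
rewrite -IH// -ge0_integralZl//; last 3 first.
- by apply: (mprod n (fun i => f (lift ord0 i))) => i; exact: mf.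
- by move=> x _; rewrite lee_fin; apply: prodr_ge0 => i _; exact: f0.
- by rewrite lee_fin.
rewrite iintE; last 2 first.
- exact: (measurableT_comp (mprod _ _ mf) (measurable_fun_pair2 (t : measurableTypeR R) (@measurable_rcons1 n))).
- by move=> x; rewrite lee_fin; apply: prodr_ge0 => i _; exact: f0.
apply: eq_integral => x _.
rewrite big_ord_recl -EFinM; congr (_ * _)%:E.
  have E : @ord0 n = lshift n (@ord0 0) :> 'I_(1 + n) by exact: val_inj.
  by rewrite E [X in f _ X]row_mxEl mxE.
apply: eq_bigr => i _; congr (f _ _).
have E : lift ord0 i = rshift 1 i :> 'I_(1 + n) by exact: val_inj.
by rewrite E [LHS]row_mxEr.
Qed.

End EuclideanMeasure.

(** * The heat kernel *)

Section HeatKernel.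
Variable R : realType.
Notation mu1 := (@lebesgue_measure R).

Definition sqn d (x : 'rV[R]_d) : R := \sum_i (x ord0 i) ^+ 2.

Lemma sqn_ge0 d (x : 'rV[R]_d) : 0 <= sqn x.
Proof. by apply: sumr_ge0 => i _; exact: sqr_ge0. Qed.

Lemma enorm_powR d (x : 'rV[R]_d) a : enorm x `^ a = sqn x `^ (a / 2).
Proof.
by rewrite /enorm -powR12_sqrt ?sqn_ge0// -powRrM mulrC.
Qed.

Lemma sqn_eq0 d (x : 'rV[R]_d) : sqn x = 0 -> x = 0.
Proof.
move=> /eqP; rewrite psumr_eq0; last by move=> i _; exact: sqr_ge0.
move=> /allP x0; apply/rowP => i; rewrite mxE; apply/eqP.
by rewrite -sqrf_eq0; apply: x0; rewrite mem_index_enum.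
Qed.

Lemma measurable_sqn d : measurable_fun setT (fun x : rVb R d => sqn x).
Proof.
apply: measurable_sum => i; apply: measurable_funX; exact: measurable_coord.
Qed.

Lemma measurable_rVb_sub d :
  measurable_fun setT (fun p : rVb R d * rVb R d => ((p.1 : 'rV[R]_d) - p.2 : rVb R d)).
Proof.
apply: measurable_fun_rVb => i; under eq_fun do rewrite !mxE.
by apply: measurable_funB; apply: (measurableT_comp (measurable_coord i)).
Qed.

Lemma measurable_sqn_sub d :
  measurable_fun setT (fun p : rVb R d * rVb R d => sqn ((p.1 : 'rV[R]_d) - p.2)).
Proof. exact: (measurableT_comp (@measurable_sqn d) (@measurable_rVb_sub d)). Qed.

Definition heat1 (h x y : R) : R := (Num.sqrt (4 * pi * h))^-1 * expR (- (x - y) ^+ 2 / (4 * h)).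

Lemma heat1_ge0 h x y : 0 <= heat1 h x y.
Proof. by rewrite mulr_ge0 ?expR_ge0// invr_ge0 sqrtr_ge0. Qed.

Lemma heat1C h x y : heat1 h x y = heat1 h y x.
Proof. by rewrite /heat1 -sqrrN opprB. Qed.

Lemma heat1_normal h x y : 0 < h -> heat1 h x y = normal_pdf x (Num.sqrt (2 * h)) y.
Proof.
move=> h0; have s0 : Num.sqrt (2 * h) != 0 by rewrite gt_eqF// sqrtr_gt0 mulr_gt0.
rewrite normal_pdfE// /normal_peak /normal_fun sqr_sqrtr; last first.
  by rewrite mulr_ge0// ltW.
rewrite /heat1; congr (_^-1 * expR _).
  by congr Num.sqrt; rewrite mulr2n; ring.
rewrite -[(y - x) ^+ 2]sqrrN opprB; congr (_ / _); rewrite mulr2n; ring.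
Qed.

Lemma integral_heat1 h x : 0 < h -> (\int[mu1]_y (heat1 h x y)%:E = 1)%E.
Proof.
move=> h0; rewrite -(@integral_normal_pdf _ x (Num.sqrt (2 * h))).
by apply: eq_integral => y _; rewrite heat1_normal.
Qed.

(** Completing the square in [y]: the second factor is a Gaussian in [y] alone, of mass one, centred
    at the weighted mean of [x] and [z]. Integrating it out gives the semigroup law. *)
Lemma heat1M h t x z y : 0 < h -> 0 < t ->
  heat1 h x y * heat1 t y z =
  heat1 (h + t) x z * heat1 (h * t / (h + t)) ((x * t + z * h) / (h + t)) y.
Proof.
move=> h0 t0; have ht0 : 0 < h + t by rewrite addr_gt0.
have pi0 := pi_gt0 R.
rewrite /heat1 mulrACA -expRD [RHS]mulrACA -expRD; congr (_ * expR _).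
  rewrite -!invfM -!sqrtrM; last 2 first.
  - by rewrite !mulr_ge0// ltW.
  - by rewrite !mulr_ge0// ltW.
  by congr ((Num.sqrt _)^-1); field; rewrite gt_eqF.
by field; rewrite !gt_eqF.
Qed.

Lemma measurable_heat1r h x : measurable_fun setT (heat1 h x).
Proof.
apply: measurable_funM => //; apply: measurableT_comp => //.
apply: measurable_funM => //; apply: measurableT_comp => //.
by apply: measurable_funX; exact: measurable_funB.
Qed.

Lemma integral_heat1M h t x z : 0 < h -> 0 < t ->
  (\int[mu1]_y (heat1 h x y * heat1 t y z)%:E = (heat1 (h + t) x z)%:E)%E.
Proof.
move=> h0 t0; have ht0 : 0 < h + t by rewrite addr_gt0.
under eq_integral do rewrite heat1M// EFinM.
rewrite ge0_integralZl//.
- rewrite integral_heat1 ?mule1//; by rewrite divr_gt0// mulr_gt0.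
- by apply: measurable_EFinT; exact: measurable_heat1r.
- by move=> y _; rewrite lee_fin heat1_ge0.
- by rewrite lee_fin heat1_ge0.
Qed.

(** A product over coordinates instead of the closed form of [heatE], so that integrals in [y]
    reduce to dimension one by [leb_prod]. *)
Definition heat d (h : R) (x y : 'rV[R]_d) : R := \prod_(i < d) heat1 h (x ord0 i) (y ord0 i).

Lemma heat_ge0 d h (x y : 'rV[R]_d) : 0 <= heat h x y.
Proof. by apply: prodr_ge0 => i _; exact: heat1_ge0. Qed.

Lemma heatE d h (x y : 'rV[R]_d) : 0 < h ->
  heat h x y = (4 * pi * h) `^ (- (d%:R / 2)) * expR (- sqn (x - y) / (4 * h)).
Proof.
move=> h0; rewrite /heat big_split/= -expR_sum; congr (_ * expR _).
  rewrite prodr_const card_ord -powR12_sqrt; last by rewrite !mulr_ge0 ?pi_ge0// ltW.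
  by rewrite -powRN -powR_mulrn ?powR_ge0// -powRrM; congr (_ `^ _); field.
rewrite -mulr_suml -sumrN; congr (_ / _).
by apply: eq_bigr => i _; rewrite !mxE.
Qed.

Lemma heatC d h (x y : 'rV[R]_d) : heat h x y = heat h y x.
Proof. by apply: eq_bigr => i _; exact: heat1C. Qed.

Lemma integral_heat d h (x : 'rV[R]_d) : 0 < h -> (\int[leb R d]_y (heat h x y)%:E = 1)%E.
Proof.
move=> h0; rewrite (leb_prod (f := fun i => heat1 h (x ord0 i))).
- by rewrite big1// => i _; exact: integral_heat1.
- by move=> i; exact: measurable_heat1r.
- by move=> i t; exact: heat1_ge0.
Qed.

Lemma integral_heatM d h t (x z : 'rV[R]_d) : 0 < h -> 0 < t ->
  (\int[leb R d]_y (heat h x y * heat t y z)%:E = (heat (h + t) x z)%:E)%E.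
Proof.
move=> h0 t0; under eq_integral do rewrite /heat -big_split/=.
rewrite (leb_prod (f := fun i y => heat1 h (x ord0 i) y * heat1 t y (z ord0 i))).
- by rewrite /heat -prodEFin; apply: eq_bigr => i _; exact: integral_heat1M.
- move=> i; apply: measurable_funM; first exact: measurable_heat1r.
  under eq_fun do rewrite heat1C; exact: measurable_heat1r.
- by move=> i y; rewrite mulr_ge0// heat1_ge0.
Qed.

End HeatKernel.

(** * Powers of time and the Gamma function *)

Section LineIntegrals.
Variable R : realType.
Notation mu1 := (@lebesgue_measure R).
Implicit Types (a b c p r t : R).

Lemma measurable_affine c b : measurable_fun [set: measurableTypeR R]
  ((fun t => c * t + b) : measurableTypeR R -> measurableTypeR R).
Proof.
have : measurable_fun [set: R] (fun t => c * t + b).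
  by apply: measurable_funD => //; apply: measurable_funM.
exact.
Qed.

Lemma lebesgue_measure_affine c b (A : set R) : 0 < c -> measurable A ->
  mu1 A = (c%:E * mu1 ((fun t => c * t + b)%R @^-1` A))%E.
Proof.
move=> c0 mA.
pose m := mscale (NngNum (ltW c0))
  (measure_function_pushforward__canonical__measure_function_Measure mu1 (measurable_affine c b)).
rewrite (@lebesgue_measure_unique R m)//.
move=> _ [[x y] _ <-]; rewrite /m/= /mscale/= /pushforward.
rewrite (_ : (fun t : measurableTypeR R => c * t + b) @^-1` _ = `](x - b) / c, (y - b) / c]%classic).
  rewrite !lebesgue_measure_itv/= !lte_fin ltr_pM2r ?invr_gt0// ltrD2r.
  case: ifPn => xy; last by rewrite mule0.
  by rewrite -!EFinB -EFinM; congr (_%:E); field; rewrite gt_eqF.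
apply/seteqP; split => t; rewrite /= !in_itv/= ltr_pdivrMr// ler_pdivlMr// ltrBlDr lerBrDr mulrC//.
Qed.

Lemma ge0_integral_affine c b (f : R -> \bar R) : 0 < c ->
  measurable_fun [set: measurableTypeR R] f -> (forall t, 0 <= f t)%E ->
  (\int[mu1]_t f t = c%:E * \int[mu1]_t f (c * t + b)%R)%E.
Proof.
move=> c0 mf f0.
pose m := mscale (NngNum (ltW c0))
  (measure_function_pushforward__canonical__measure_function_Measure mu1 (measurable_affine c b)).
transitivity (\int[m]_t f t)%E.
  by apply: eq_measure_integral => A mA _; first [exact: (lebesgue_measure_affine b c0 mA)|exact: (esym (lebesgue_measure_affine b c0 mA))].
rewrite ge0_integral_mscale//=; congr (_ * _)%E.
by rewrite ge0_integral_pushforward//; exact: measurable_affine.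
Qed.

(* Strict truncation, so that [pwt 0 p] vanishes at [0] where [0 `^ p] may be [1]. *)
Definition pwt a p t : R := if a < t then t `^ p else 0.

Lemma pwt_ge0 a p t : 0 <= pwt a p t.
Proof. by rewrite /pwt; case: ifP => // _; exact: powR_ge0. Qed.

Lemma measurable_pwt a p : measurable_fun setT (pwt a p).
Proof.
apply: measurable_fun_ifT; [exact: measurable_fun_ltr|exact: measurable_powR|by []].
Qed.

Lemma cvg_powRy p : 0 < p -> t `^ (- p) @[t --> +oo] --> 0.
Proof.
move=> p0; have pn0 : p != 0 by rewrite gt_eqF.
apply/cvgrPdist_le => e e0; near=> t.
have t0 : 0 < t by near: t; exact: nbhs_pinfty_gt.
rewrite sub0r normrN ger0_norm ?powR_ge0// powRN.
rewrite -(invrK e) lef_pV2 ?posrE ?invr_gt0 ?powR_gt0//.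
have -> : e^-1 = (e^-1 `^ p^-1) `^ p.
  by rewrite -powRrM mulVf// powRr1// invr_ge0 ltW.
rewrite ge0_ler_powR ?nnegrE ?powR_ge0 ?ltW//.
Unshelve. all: end_near. Qed.

Lemma cont_powR p t : 0 < t -> {for t, continuous (fun u : R => u `^ p)}.
Proof.
move=> t0; apply: differentiable_continuous; apply/derivable1_diffP.
by apply: derivable_powR; rewrite in_itv/= t0.
Qed.

Lemma pwt_indic a p (f : R -> R) (g : R -> R) : (forall t, a < t -> f t = t `^ p * g t) ->
  (\int[mu1]_t (pwt a p t * g t)%:E = \int[mu1]_(t in `]a, +oo[) (f t)%:E)%E.
Proof.
move=> fg; rewrite [RHS]integral_mkcond; apply: eq_integral => t _.
rewrite patchE /pwt; case: ifPn => [at_|nat_].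
  by rewrite mem_set/= ?in_itv/= ?at_// fg.
by rewrite memNset/= ?in_itv/= ?(negbTE nat_)// mul0r.
Qed.

Lemma cvgM_powR c p t : 0 < t -> (c * u `^ p) @[u --> t] --> c * t `^ p.
Proof. by move=> t0; apply: cvgM; [exact: cvg_cst|exact: cont_powR]. Qed.

Lemma integral_pwt a p : 0 < a -> 0 < p ->
  (\int[mu1]_t (pwt a (- p - 1) t)%:E = (a `^ (- p) / p)%:E)%E.
Proof.
move=> a0 p0.
under eq_integral do rewrite -[pwt _ _ _]mulr1.
rewrite (@pwt_indic _ _ (fun u : R => u `^ (- p - 1)) (fun=> 1)); last by move=> t _; rewrite mulr1.
rewrite integral_itv_obnd_cbnd; last by apply/measurable_EFinP; apply: measurable_funTS; exact: measurable_powR.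
have pos x : a <= x -> 0 < x by exact: lt_le_trans.
pose F (t : R) : R^o := (- p^-1) *: (t `^ (- p) : R^o).
have dF (x : R) : 0 < x -> is_derive x 1 F ((- p^-1) *: (- p * x `^ (- p - 1) : R^o)).
  by move=> x0; apply: is_deriveZ; exact: is_derive1_powR.
rewrite (@ge0_continuous_FTC2y _ _ F _ 0).
- by rewrite /F -EFinB sub0r scaleNr opprK /GRing.scale/= mulrC.
- by move=> x _; exact: powR_ge0.
- apply: continuous_in_subspaceT => x; rewrite inE/= in_itv/= andbT => ax.
  by apply: cont_powR; exact: pos.
- rewrite -(scaler0 _ (- p^-1)); apply: cvgZr; exact: cvg_powRy.
- by move=> x ax; have [] := dF _ (lt_trans a0 ax).
- by apply: cvgZr; apply: cvg_at_right_filter; exact: cont_powR.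
- move=> x; rewrite in_itv/= andbT => ax.
  have x0 : 0 < x by exact: lt_trans ax.
  have [_ dFx] := dF _ x0; rewrite derive1E dFx /GRing.scale/= mulrA mulrNN mulVf ?mul1r//.
  by rewrite gt_eqF.
Qed.

Lemma integral_pwt_oc a b p : 0 < a <= b -> p != 0 ->
  (\int[mu1]_t (pwt a (p - 1) t * (t <= b)%R%:R)%:E = ((b `^ p - a `^ p) / p)%:E)%E.
Proof.
move=> /andP[a0]; rewrite le_eqVlt => /predU1P[->|ab] p0.
  rewrite subrr mul0r integral0_eq// => t _; rewrite /pwt.
  by case: ltP => bt; rewrite ?mulr0 ?mul0r.
transitivity (\int[mu1]_(t in `]a, b]) (t `^ (p - 1))%:E)%E.
  rewrite [RHS]integral_mkcond; apply: eq_integral => t _.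
  rewrite patchE /pwt; have [/andP[at_ tb]|] := boolP (a < t <= b).
    by rewrite mem_set/= ?in_itv/= at_ tb ?mulr1.
  move=> atb; rewrite memNset/= ?in_itv/=; last exact/negP.
  by case: ifPn atb => // _; case: ltP; rewrite ?mulr0 ?mul0r.
rewrite integral_itv_obnd_cbnd; last by apply/measurable_EFinP; apply: measurable_funTS; exact: measurable_powR.
pose F (t : R) : R^o := p^-1 *: (t `^ p : R^o).
have dF (x : R) : 0 < x -> is_derive x 1 F (p^-1 *: (p * x `^ (p - 1) : R^o)).
  by move=> x0; apply: is_deriveZ; exact: is_derive1_powR.
have pos x : a <= x -> 0 < x by exact: lt_le_trans.
rewrite (@continuous_FTC2 _ _ F)//.
- by rewrite /F -EFinB -scalerBr /GRing.scale/= mulrC.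
- apply: continuous_in_subspaceT => x; rewrite inE/= in_itv/= => /andP[ax _].
  by apply: cont_powR; exact: pos.
- split.
  + by move=> x; rewrite in_itv/= => /andP[ax _]; have [] := dF _ (lt_trans a0 ax).
  + by apply: cvgZr; apply: cvg_at_right_filter; exact: cont_powR.
  + by apply: cvgZr; apply: cvg_at_left_filter; apply: cont_powR; exact: lt_trans ab.
- move=> x; rewrite in_itv/= => /andP[ax _].
  have x0 : 0 < x by exact: lt_trans ax.
  by have [_ dFx] := dF _ x0; rewrite derive1E dFx /GRing.scale/= mulrA mulVf ?mul1r.
Qed.

Lemma pos_bigcup : [set t : R | 0 < t] = \bigcup_n `](n.+1%:R^-1), +oo[%classic.
Proof.
apply/seteqP; split => t /=.
  move=> t0; exists (Num.truncn t^-1) => //=; rewrite in_itv/= andbT.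
  by rewrite invf_plt ?posrE// truncnS_gt.
by move=> [n _] /=; rewrite in_itv/= andbT; apply: lt_trans; rewrite invr_gt0.
Qed.

Lemma pwt_cvg p t : (pwt (n.+1%:R^-1) p t) @[n --> \oo] --> pwt 0 p t.
Proof.
rewrite /pwt; case: ltP => t0; last first.
  apply: cvg_near_cst; near=> n; case: ltP => // nt.
  by have := lt_le_trans nt t0; rewrite ltNge invr_ge0 ler0n.
apply: cvg_near_cst; near=> n; rewrite ifT// invf_plt ?posrE//.
near: n; exists (Num.truncn t^-1) => //= n nt.
by apply: (lt_le_trans (truncnS_gt _)); rewrite ler_nat ltnS.
Unshelve. all: end_near. Qed.

Lemma pwt_mono a b p t : a <= b -> pwt b p t <= pwt a p t.
Proof.
move=> ab; rewrite /pwt; case: ltP => bt; first by rewrite (le_lt_trans ab bt).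
by case: ifP => // _; exact: powR_ge0.
Qed.

(** Monotone convergence along the cut-offs [1/(n+1)]. It turns bounds that are uniform in the
    cut-off into bounds for integrands singular at time zero. *)
Lemma pwt_monotone_integral p (g : R -> R) (l : \bar R) : measurable_fun setT g ->
  (forall t, 0 <= g t) ->
  (forall n : nat, \int[mu1]_t (pwt (n.+1%:R^-1) p t * g t)%:E <= l)%E ->
  (\int[mu1]_t (pwt 0 p t * g t)%:E <= l)%E.
Proof.
move=> mg g0 H.
have mpw a : measurable_fun [set: measurableTypeR R] (fun t => (pwt a p t * g t)%:E).
  by apply: measurable_EFinT; apply: measurable_funM => //; exact: measurable_pwt.
pose f n t := (pwt (n.+1%:R^-1) p t * g t)%:E.
have fE t : (pwt 0 p t * g t)%:E = limn (f ^~ t).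
  apply/esym/cvg_lim => //; apply: cvg_EFin; first exact: nearW.
  by apply: cvgM; [exact: pwt_cvg|exact: cvg_cst].
under eq_integral do rewrite fE.
rewrite monotone_convergence//; last 2 first.
- by move=> n t _; rewrite lee_fin mulr_ge0// pwt_ge0.
- move=> t _ m n mn; rewrite lee_fin ler_wpM2r// pwt_mono//.
  by rewrite lef_pV2 ?posrE// ler_nat.
apply: lime_le; last by apply: nearW => n; exact: H.
apply: ereal_nondecreasing_is_cvgn => m n mn; apply: ge0_le_integral => //.
- by move=> t _; rewrite lee_fin mulr_ge0// pwt_ge0.
- exact: mpw.
- exact: mpw.
- move=> t _; rewrite lee_fin ler_wpM2r// pwt_mono//.
  by rewrite lef_pV2 ?posrE// ler_nat.
by move=> n; exact: mpw.
Qed.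


Lemma measurable_leb b : measurable_fun setT (fun t => (t <= b)%R%:R : R).
Proof.
rewrite (_ : (fun t => _) = (fun t => if t <= b then 1 else 0)); last first.
  by apply/funext => t; case: ifP.
by apply: measurable_fun_ifT => //; exact: measurable_fun_ler.
Qed.

Lemma integral_pwt0_le b p : 0 < b -> 0 < p ->
  (\int[mu1]_t (pwt 0 (p - 1) t * (t <= b)%R%:R)%:E <= (b `^ p / p)%:E)%E.
Proof.
move=> b0 p0; apply: pwt_monotone_integral => //.
- exact: measurable_leb.
- move=> n; have [nb|bn] := leP (n.+1%:R^-1) b.
    rewrite integral_pwt_oc ?gt_eqF//; last by rewrite invr_gt0 ltr0n nb.
    by rewrite lee_fin ler_pM2r ?invr_gt0// gerBl powR_ge0.
  rewrite integral0_eq ?lee_fin ?divr_ge0 ?powR_ge0 ?(ltW p0)// => t _.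
  rewrite /pwt; case: ltP => nt; rewrite ?mul0r//.
  by rewrite leNgt (lt_trans bn nt) mulr0.
Qed.

Lemma measurable_GammaF p : measurable_fun [set: measurableTypeR R]
  (fun t => (pwt 0 p t * expR (- t))%:E).
Proof.
apply: measurable_EFinT; apply: measurable_funM; first exact: measurable_pwt.
by apply: measurableT_comp.
Qed.

(** [Gamma] is a [fine], so the content is finiteness: the integrand is dominated by [t^(p-1)] on
    [(0, 1]] and by a multiple of [t^(-2)] beyond. *)
Lemma GammaEFin p : 0 < p ->
  (\int[mu1]_t (pwt 0 (p - 1) t * expR (- t))%:E = (Gamma p)%:E)%E.
Proof.
move=> p0; rewrite /Gamma.
have -> : (\int[mu1]_t (pwt 0 (p - 1) t * expR (- t))%:E =
    \int[mu1]_(t in [set t : R | (0 < t)%R]) (t `^ (p - 1) * expR (- t))%:E)%E.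
  rewrite [RHS]integral_mkcond; apply: eq_integral => t _; rewrite patchE /pwt.
  case: ltP => t0; first by rewrite mem_set.
  by rewrite memNset ?mul0r//=; apply/negP; rewrite -leNgt.
rewrite fineK// ge0_fin_numE; last first.
  by apply: integral_ge0 => t _; rewrite lee_fin mulr_ge0 ?expR_ge0 ?powR_ge0.
rewrite (_ : integral _ _ _ = \int[mu1]_t (pwt 0 (p - 1) t * expR (- t))%:E)%E; last first.
  rewrite integral_mkcond; apply: eq_integral => t _; rewrite patchE /pwt.
  case: ltP => t0; first by rewrite mem_set.
  by rewrite memNset ?mul0r//=; apply/negP; rewrite -leNgt.
(* Since [n + 1 > p + 1], for [t > 1] one has [t^(p+1) <= t^(n+1) <= K * expR t], which leaves the
   integrable tail [K * t^(-2)]. *)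
pose n := Num.truncn (p + 1); pose K : R := n.+1`!%:R.
have m1 : measurable_fun [set: measurableTypeR R]
    (fun t => (pwt 0 (p - 1) t * (t <= 1)%R%:R)%:E).
  apply: measurable_EFinT; apply: measurable_funM;
    [exact: measurable_pwt|exact: measurable_leb].
have m2 : measurable_fun [set: measurableTypeR R] (fun t => (K * pwt 1 (- 1 - 1) t)%:E).
  by apply: measurable_EFinT; apply: measurable_funM => //; exact: measurable_pwt.
apply: (@le_lt_trans _ _ (\int[mu1]_t ((pwt 0 (p - 1) t * (t <= 1)%R%:R)%:E
    + (K * pwt 1 (- 1 - 1) t)%:E))%E).
  apply: ge0_le_integral => //.
  - by move=> t _; rewrite lee_fin mulr_ge0 ?pwt_ge0 ?expR_ge0.
  - exact: measurable_GammaF.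
  - exact: emeasurable_funD.
  - move=> t _; rewrite -EFinD lee_fin /pwt; case: (leP t 1) => t1.
      rewrite mulr0 addr0 mulr1; case: ifP => t0; last by rewrite mul0r.
      by rewrite ler_piMr ?powR_ge0// -expR0 ler_expR oppr_le0 ltW.
    rewrite (lt_trans ltr01 t1) mulr0 add0r -opprD powRN -[1 + 1]/(2%:R) powR_mulrn; last first.
      by rewrite ltW// (lt_trans ltr01 t1).
    have t0 : 0 < t by exact: lt_trans t1.
    rewrite ler_pdivlMr ?exprn_gt0// expRN mulrAC ler_pdivrMr ?expR_gt0//.
    have : t ^+ n.+1 / K <= expR t.
      by apply: le_trans (expR_ge1Dxn n (ltW t0)); rewrite lerDr.
    rewrite ler_pdivrMr ?ltr0n ?fact_gt0// mulrC; apply: le_trans.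
    rewrite -[t ^+ 2]powR_mulrn ?(ltW t0)// -powRD; last by rewrite (gt_eqF t0) implybT.
    rewrite -powR_mulrn ?(ltW t0)//; apply: ler_powR; first exact: ltW.
    rewrite (_ : p - 1 + 2 = p + 1); last by ring.
    exact/ltW/truncnS_gt.
rewrite ge0_integralD//; last 2 first.
- by move=> t _; rewrite lee_fin mulr_ge0 ?pwt_ge0.
- by move=> t _; rewrite lee_fin mulr_ge0 ?pwt_ge0.
apply: lte_add_pinfty; first by rewrite (le_lt_trans (integral_pwt0_le _ _))// ltry.
under eq_integral do rewrite EFinM.
have m3 : measurable_fun [set: measurableTypeR R] (fun t => (pwt 1 (- 1 - 1) t)%:E).
  exact: (measurable_EFinT (measurable_pwt _ _)).
rewrite ge0_integralZl//.
- by rewrite integral_pwt// -EFinM ltry.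
- by move=> t _; rewrite lee_fin pwt_ge0.
- by rewrite lee_fin ler0n.
Qed.

Lemma Gamma_gt0 p : 0 < p -> 0 < Gamma p.
Proof.
move=> p0; rewrite -lte_fin -GammaEFin//.
have m1 : measurable_fun [set: measurableTypeR R]
    (fun t => (pwt 1 (p - 1) t * (t <= 2)%R%:R)%:E).
  apply: measurable_EFinT; apply: measurable_funM;
    [exact: measurable_pwt|exact: measurable_leb].
have m2 : measurable_fun [set: measurableTypeR R]
    (fun t => (expR (- 2) * (pwt 1 (p - 1) t * (t <= 2)%R%:R))%:E).
  apply: measurable_EFinT; apply: measurable_funM => //; apply: measurable_funM;
    [exact: measurable_pwt|exact: measurable_leb].
apply: (@lt_le_trans _ _ (\int[mu1]_t (expR (- 2) * (pwt 1 (p - 1) t * (t <= 2)%R%:R))%:E)%E).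
  under eq_integral do rewrite EFinM.
  rewrite ge0_integralZl ?lee_fin ?expR_ge0//; last first.
    by move=> t _; rewrite lee_fin mulr_ge0 ?pwt_ge0.
  have p_neq0 : p != 0 by rewrite gt_eqF.
  have le12 : (0 < (1 : R) <= 2) by rewrite ltr01 ler1n.
  rewrite (integral_pwt_oc le12 p_neq0) -EFinM lte_fin mulr_gt0 ?expR_gt0//.
  by rewrite divr_gt0// subr_gt0 gt0_ltr_powR ?nnegrE ?ltr1n.
apply: ge0_le_integral => //.
- by move=> t _; rewrite lee_fin !mulr_ge0 ?pwt_ge0 ?expR_ge0.
- exact: measurable_GammaF.
- move=> t _; rewrite lee_fin; case: (leP t 2) => t2; last first.
    by rewrite !mulr0 mulr_ge0 ?pwt_ge0 ?expR_ge0.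
  by rewrite mulr1 mulrC ler_pM ?pwt_ge0 ?expR_ge0 ?pwt_mono// ler_expR lerN2.
Qed.

(** The decreasing substitution [t -> c / t] is made on the compact intervals [I n], whose images
    are the [J n]. Both families exhaust the half-line, and monotone convergence over increasing
    sets concludes. *)
Lemma integral_inversion c (f : R -> R) : 0 < c ->
  (forall t, 0 < t -> {for t, continuous f}) -> (forall t, 0 <= f t) ->
  (\int[mu1]_(t in [set t : R | (0 < t)%R]) (f t)%:E =
   \int[mu1]_(t in [set t : R | (0 < t)%R]) (f (c / t) * (c / t ^+ 2))%:E)%E.
Proof.
move=> c0 cf f0.
pose I n : set R := `[n.+1%:R^-1, n.+1%:R]%classic.
pose J n : set R := `[c / n.+1%:R, c / n.+1%:R^-1]%classic.
have n0 n : 0 < n.+1%:R^-1 :> R by rewrite invr_gt0.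
have inI (t : R) : 0 < t -> exists n, I n t.
  move=> t0; exists (maxn (Num.truncn t) (Num.truncn t^-1)); rewrite /I/= in_itv/=.
  rewrite invf_ple ?posrE//; apply/andP; split; apply: le_trans (ltW (truncnS_gt _)) _;
    by rewrite ler_nat ltnS leq_max leqnn ?orbT.
have IE : [set t : R | 0 < t] = \bigcup_n I n.
  apply/seteqP; split => t /=; first by move/inI => [n In]; exists n.
  by move=> [n _]; rewrite /I/= in_itv/= => /andP[+ _]; exact: lt_le_trans.
have JE : [set t : R | 0 < t] = \bigcup_n J n.
  apply/seteqP; split => t /=.
    move=> t0; have [n] := inI _ (divr_gt0 c0 t0).
    rewrite /I/= in_itv/= => /andP[n1 n2]; exists n => //; rewrite /J/= in_itv/=.
    by rewrite ler_pdivrMr// mulrC -ler_pdivrMr// n2/= ler_pdivlMr// mulrC -ler_pdivlMr.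
  by move=> [n _]; rewrite /J/= in_itv/= => /andP[+ _]; apply: lt_le_trans; exact: divr_gt0.
have eqIJ n : (\int[mu1]_(t in J n) (f t)%:E = \int[mu1]_(t in I n) (f (c / t) * (c / t ^+ 2))%:E)%E.
  pose F t : R^o := c *: (t^-1 : R^o).
  have dF (x : R) : x != 0 -> is_derive x 1 F (c *: (- x ^- 2 *: (1 : R^o))).
    by move=> x0; apply: is_deriveZ; apply: is_deriveV.
  have d1F (x : R) : 0 < x -> F^`()%classic x = - (c / x ^+ 2).
    move=> x0; have [_ dFx] := dF _ (lt0r_neq0 x0).
    by rewrite derive1E dFx /GRing.scale/= mulr1 mulrN.
  have d1F' (x : R) : 0 < x -> F^`()%classic x = (- c) * x `^ (- 2).
    by move=> x0; rewrite d1F// powRN powR_mulrn ?ltW// mulNr.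
  have cdF (x : R) : 0 < x -> F^`()%classic y @[y --> x] --> ((- c) * x `^ (- 2)).
    move=> x0; apply: (@cvg_trans _ ((- c) * y `^ (- 2) @[y --> x])).
      by apply: near_eq_cvg; near=> y; rewrite d1F'//; near: y; exact: lt_nbhsr.
    exact: cvgM_powR.
  rewrite [LHS](@integration_by_substitution_decreasing _ F f (n.+1%:R^-1) (n.+1%:R)).
  - apply: eq_integral => t; rewrite inE/= in_itv/= => /andP[nt _].
    congr (_%:E); rewrite -[LHS]/(f (F t) * - (F^`()%classic t)) d1F ?opprK//.
    exact: lt_le_trans nt.
  - rewrite (@le_trans _ _ 1)// ?invf_le1// ?ler1n//.
  - move=> x y; rewrite !in_itv/= => /andP[nx _] /andP[ny _] xy.
    rewrite /F /GRing.scale/= ltr_pM2l// ltf_pV2// posrE (lt_le_trans (n0 n))//.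
  - move=> x; rewrite in_itv/= => /andP[nx _].
    by rewrite /continuous_at d1F'; [apply: cdF|]; exact: lt_trans nx.
  - by apply/cvg_ex; exists ((- c) * (n.+1%:R^-1) `^ (- 2)); apply: cvg_at_right_filter; exact: cdF.
  - by apply/cvg_ex; exists ((- c) * (n.+1%:R) `^ (- 2)); apply: cvg_at_left_filter; exact: cdF.
  - have cF (x : R) : 0 < x -> F y @[y --> x] --> F x.
      by move=> x0; apply: cvgZr; apply: cvgV; [rewrite gt_eqF|exact: cvg_id].
    split.
    + move=> x; rewrite in_itv/= => /andP[nx _].
      by have [] := dF x (lt0r_neq0 (lt_trans (n0 n) nx)).
    + by apply: cvg_at_right_filter; exact: cF.
    + by apply: cvg_at_left_filter; exact: cF.
  - apply: continuous_in_subspaceT => x; rewrite inE/= in_itv/= => /andP[ax _].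
    by apply: cf; apply: lt_le_trans ax; rewrite /F mulr_gt0 ?invr_gt0.
have incr (u v : nat -> R) : {homo u : x y / (x <= y)%N >-> y <= x} ->
    {homo v : x y / (x <= y)%N >-> x <= y} ->
    {homo (fun n => `[u n, v n]%classic) : x y / (x <= y)%N >-> (x <= y)%O}.
  move=> hu hv x y xy; apply/subsetPset => t /=; rewrite !in_itv/= => /andP[ut tv].
  by rewrite (le_trans (hu _ _ xy) ut) (le_trans tv (hv _ _ xy)).
have mV : {homo (fun n : nat => n.+1%:R^-1 : R) : x y / (x <= y)%N >-> y <= x}.
  by move=> x y xy; rewrite lef_pV2 ?posrE// ler_nat.
have mN : {homo (fun n : nat => n.+1%:R : R) : x y / (x <= y)%N >-> x <= y}.
  by move=> x y xy; rewrite ler_nat.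
have mf : measurable_fun [set t : R | 0 < t] f.
  rewrite (_ : [set t : R | 0 < t] = `]0, +oo[%classic).
    apply: open_continuous_measurable_fun; first exact: interval_open.
    by move=> t; rewrite inE/= in_itv/= andbT; exact: cf.
  by apply/seteqP; split => t /=; rewrite in_itv/= andbT.
have mpos : measurable [set t : R | 0 < t].
  by rewrite pos_bigcup; apply: bigcupT_measurable.
have mI : measurable_fun [set t : R | 0 < t] (fun t => f (c / t) * (c / t ^+ 2)).
  apply: measurable_funM.
    rewrite (_ : [set t : R | 0 < t] = `]0, +oo[%classic).
      apply: open_continuous_measurable_fun; first exact: interval_open.
      move=> t; rewrite inE/= in_itv/= andbT => t0.
      have ct : (c / u) @[u --> t] --> c / t.
        by apply: cvgM; [exact: cvg_cst|apply: inv_continuous; rewrite gt_eqF].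
      apply: (@cvg_comp _ _ _ (fun u => c / u) f _ _ _ ct).
      exact: (cf _ (divr_gt0 c0 t0)).
    by apply/seteqP; split => t /=; rewrite in_itv/= andbT.
  apply: (eq_measurable_fun (fun t => c * t `^ (- 2))).
    by move=> t; rewrite inE/= => t0; rewrite powRN powR_mulrn// ltW.
  apply: measurable_funTS; apply: measurable_funM => //; exact: measurable_powR.
rewrite {2}IE -[RHS](cvg_lim _ (ge0_nondecreasing_set_cvg_integral _ _ _ _))//; last 4 first.
- exact: incr.
- by move=> n; exact: measurable_itv.
- move=> n; apply/measurable_EFinP; apply: measurable_funS mI => //.
  by rewrite IE; exact: bigcup_sup.
- by move=> n t _; rewrite lee_fin mulr_ge0// divr_ge0 ?sqr_ge0// ltW.
rewrite JE -[LHS](cvg_lim _ (ge0_nondecreasing_set_cvg_integral _ _ _ _))//; last 4 first.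
- apply: incr => x y xy.
    by rewrite ler_pM2l// mV.
  by rewrite ler_pM2l// !invrK mN.
- by move=> n; exact: measurable_itv.
- move=> n; apply/measurable_EFinP; apply: measurable_funS mf => //.
  by rewrite JE; exact: bigcup_sup.
- by move=> n t _; rewrite lee_fin.
by congr (lim (_ @ \oo)); apply/funext => n; exact: eqIJ.
Unshelve. all: end_near. Qed.

End LineIntegrals.

(** * Powers of the distance as time integrals of the heat kernel *)

Section FracConstant.
Variable R : realType.
Notation mu1 := (@lebesgue_measure R).
Implicit Types (p r t u h s x beta eps th nu K : R).

(** This is the Gamma integral after the substitution [t -> r / t]. *)
Lemma integral_exp_inv p r : 0 < p -> 0 < r ->
  (\int[mu1]_t (pwt 0 (- p - 1) t * expR (- r / t))%:E = (r `^ (- p) * Gamma p)%:E)%E.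
Proof.
move=> p0 r0.
have posE (g : R -> R) q : (\int[mu1]_t (pwt 0 q t * g t)%:E =
    \int[mu1]_(t in [set t : R | (0 < t)%R]) (t `^ q * g t)%:E)%E.
  rewrite [RHS]integral_mkcond; apply: eq_integral => t _; rewrite patchE /pwt.
  case: ltP => t0; first by rewrite mem_set.
  by rewrite memNset ?mul0r//=; apply/negP; rewrite -leNgt.
rewrite EFinM -GammaEFin// !posE.
rewrite (integral_inversion r0); last 2 first.
- move=> t t0; apply: cvgM; first exact: cont_powR.
  apply: (@cvg_comp _ _ _ (fun u => - r / u) expR); last exact: continuous_expR.
  by apply: cvgM; [exact: cvg_cst|apply: inv_continuous; rewrite gt_eqF].
- by move=> t; rewrite mulr_ge0 ?powR_ge0 ?expR_ge0.
have m1 : measurable_fun [set t : R | 0 < t] (fun t : measurableTypeR R => (t `^ (p - 1) * expR (- t))%:E).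
  apply: measurable_funTS; apply: measurable_EFinT; apply: measurable_funM.
    exact: measurable_powR.
  by apply: measurableT_comp.
rewrite -ge0_integralZl//=; last 3 first.
- by rewrite pos_bigcup; apply: bigcupT_measurable.
- by move=> t _; rewrite lee_fin mulr_ge0 ?powR_ge0 ?expR_ge0.
- by rewrite lee_fin powR_ge0.
apply: eq_integral => t; rewrite inE/= => t0; rewrite -EFinM; congr (_%:E).
rewrite (_ : - r / (r / t) = - t); last by field; rewrite !gt_eqF.
have rE : r = r `^ 1 by rewrite powRr1// ltW.
have E : (r / t) `^ (- p - 1) * (r / t ^+ 2) = r `^ (- p) * t `^ (p - 1).
  rewrite powRM ?invr_ge0 ?(ltW r0) ?(ltW t0)//.
  rewrite -[t^-1]powR_inv1 ?ltW// -powRrM mulN1r opprD !opprK.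
  rewrite {2}rE -[t ^+ 2]powR_mulrn ?ltW// -powRN.
  rewrite mulrACA -!powRD; do ?by rewrite ?(gt_eqF r0) ?(gt_eqF t0) implybT.
  by congr (_ `^ _ * _ `^ _); ring.
by rewrite mulrAC E mulrA.
Qed.

Lemma measurable_exp_inv q c : measurable_fun [set: measurableTypeR R]
  (fun t => (pwt 0 q t * expR (- c / t))%:E).
Proof.
have m : measurable_fun setT (fun t => pwt 0 q t * expR (- c * t `^ (- 1))).
  apply: measurable_funM; first exact: measurable_pwt.
  have m' : measurable_fun setT (fun t => - c * t `^ (- 1)).
    by apply: measurable_funM => //; exact: (measurable_powR (- 1)).
  exact: (measurableT_comp (@measurable_expR R) m').
rewrite [X in measurable_fun _ X](_ : _ = EFin \o (fun t => pwt 0 q t * expR (- c * t `^ (- 1)))).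
  exact: (measurable_EFinT m).
apply/funext => t /=; rewrite /pwt; case: ifPn => t0; last by rewrite !mul0r.
by rewrite powR_inv1 ?ltW.
Qed.

(** Up to constants, [b = - s] gives the jump kernel, [b = beta] the ground state and [b = beta - s]
    the ground state times the Hardy weight [|x|^(-2s)], for [beta = (d + 2s)/4]. *)
Lemma integral_heat_time d (b : R) (x y : 'rV[R]_d) : b < d%:R / 2 -> x != y ->
  (\int[mu1]_t (pwt 0 (b - 1) t * heat t x y)%:E =
   (4 `^ (- b) * pi `^ (- (d%:R / 2)) * Gamma (d%:R / 2 - b) * enorm (x - y) `^ (2 * b - d%:R))%:E)%E.
Proof.
move=> bd xy.
pose p := d%:R / 2 - b; have p0 : 0 < p by rewrite subr_gt0.
have q0 : 0 < sqn (x - y).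
  rewrite lt_neqAle sqn_ge0 andbT eq_sym; apply: contra xy => /eqP/sqn_eq0/eqP.
  by rewrite subr_eq0.
have pi0 := pi_gt0 R.
pose K : R := (4 * pi) `^ (- (d%:R / 2)).
transitivity (\int[mu1]_t (K%:E * (pwt 0 (- p - 1) t * expR (- (sqn (x - y) / 4) / t))%:E))%E.
  apply: eq_integral => t _; rewrite -EFinM; congr (_%:E).
  rewrite /pwt; case: ifPn => t0; last by rewrite !mul0r mulr0.
  rewrite heatE// [(_ * t) `^ _]powRM ?mulr_ge0 ?ltW// -/K.
  rewrite [LHS](_ : _ = K * ((t `^ (b - 1) * t `^ (- (d%:R / 2))) *
    expR (- sqn (x - y) / (4 * t)))); last by ring.
  rewrite -powRD; last by rewrite (gt_eqF t0) implybT.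
  congr (_ * (_ `^ _ * expR _)); first by rewrite /p; ring.
  by field; rewrite gt_eqF.
have m1 : measurable_fun [set: measurableTypeR R]
    (fun t => (pwt 0 (- p - 1) t * expR (- (sqn (x - y) / 4) / t))%:E).
  exact: measurable_exp_inv.
rewrite ge0_integralZl ?lee_fin ?powR_ge0//; last first.
  by move=> t _; rewrite lee_fin mulr_ge0 ?pwt_ge0 ?expR_ge0.
rewrite integral_exp_inv ?divr_gt0// -EFinM enorm_powR; congr (_%:E).
rewrite /K (powRM _ _ (ltW pi0))// (powRM _ (ltW q0)) ?invr_ge0// -/p.
rewrite -[4^-1]powR_inv1// -powRrM.
rewrite (_ : (2 * b - d%:R) / 2 = - p); last by rewrite /p; field.
rewrite [LHS](_ : _ = (4 `^ (- (d%:R / 2)) * 4 `^ (- 1 * - p)) * pi `^ (- (d%:R / 2)) * Gamma p * sqn (x - y) `^ (- p)); last by ring.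
rewrite -powRD; last by rewrite pnatr_eq0 implybT.
by congr (_ `^ _ * _ * _ * _); rewrite /p; ring.
Qed.

End FracConstant.

(** * The one-dimensional inequality on the time axis *)

Section FractionalConstant.
Variable R : realType.
Notation mu1 := (@lebesgue_measure R).
Implicit Types (p q r t u h s x beta eps th nu K : R).

(** By the semigroup law, convolving two heat potentials in space amounts to convolving their time
    densities. The factor with [q = - s - 1] must be cut off; the one with [p = beta - 1] is
    integrable at zero. *)
Definition conv_pw q p eps t : \bar R :=
  (\int[mu1]_h (pwt eps q h * pwt 0 p (t - h))%:E)%E.

Lemma measurable_pwt2 q p a t :
  measurable_fun setT (fun h => pwt a q h * pwt 0 p (t - h)).
Proof.
apply: measurable_funM; first exact: measurable_pwt.
have m : measurable_fun setT (fun h => t - h) by exact: measurable_funB.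
exact: (measurableT_comp (@measurable_pwt R 0 p) m).
Qed.

Lemma measurable_pwt2E q p a t :
  measurable_fun [set: measurableTypeR R] (fun h => (pwt a q h * pwt 0 p (t - h))%:E).
Proof. exact: (measurable_EFinT (measurable_pwt2 _ _ _ _)). Qed.

Lemma pwt2_ge0 q p a t h : 0 <= pwt a q h * pwt 0 p (t - h).
Proof. by rewrite mulr_ge0 ?pwt_ge0. Qed.

Lemma conv_pw_ge0 q p eps t : (0 <= conv_pw q p eps t)%E.
Proof. by apply: integral_ge0 => h _; rewrite lee_fin pwt2_ge0. Qed.

Lemma pwtZ a q t x : 0 <= a -> 0 < t -> pwt a q (t * x) = t `^ q * pwt (a / t) q x.
Proof.
move=> a0 t0; rewrite /pwt mulrC ltr_pdivrMr//; case: ltP => [atx|_]; last by rewrite mulr0.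
have x0 : 0 < x by rewrite -(pmulr_lgt0 _ t0) (le_lt_trans a0).
by rewrite powRM ?ltW// mulrC.
Qed.

(** Homogeneity: only the ratio [eps / t] matters, so what follows is about one function of [th] at
    time one. *)
Lemma conv_pw_scale q p eps t : 0 <= eps -> 0 < t ->
  conv_pw q p eps t = ((t `^ (q + p + 1))%:E * conv_pw q p (eps / t) 1)%E.
Proof.
move=> e0 t0; rewrite /conv_pw.
rewrite (ge0_integral_affine 0 t0 (measurable_pwt2E _ _ _ _)); last first.
  by move=> h; rewrite lee_fin pwt2_ge0.
have E x : (pwt eps q (t * x + 0) * pwt 0 p (t - (t * x + 0)))%:E =
    ((t `^ (q + p))%:E * (pwt (eps / t) q x * pwt 0 p (1 - x))%:E)%E.
  rewrite addr0 -EFinM; congr (_%:E).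
  rewrite (_ : t - t * x = t * (1 - x)); last by ring.
  rewrite !pwtZ// mul0r powRD ?(gt_eqF t0) ?implybT//; ring.
under eq_integral do rewrite E.
rewrite ge0_integralZl ?lee_fin ?powR_ge0//.
- rewrite muleA -EFinM; congr (_%:E * _)%E.
  by rewrite [in RHS]powRD ?powRr1 ?(gt_eqF t0) ?implybT ?ltW// mulrC.
- exact: measurable_pwt2E.
- by move=> h _; rewrite lee_fin pwt2_ge0.
Qed.

Lemma conv_pw_split q p a b : a <= b ->
  conv_pw q p a 1 = (conv_pw q p b 1 +
    \int[mu1]_x (pwt a q x * (x <= b)%R%:R * pwt 0 p (1 - x))%:E)%E.
Proof.
move=> ab; rewrite /conv_pw -ge0_integralD//; first last.
- apply: measurable_EFinT; apply: measurable_funM.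
    by apply: measurable_funM; [exact: measurable_pwt|exact: measurable_leb].
  have m : measurable_fun setT (fun h => 1 - h : R) by exact: measurable_funB.
  exact: (measurableT_comp (@measurable_pwt R 0 p) m).
- by move=> x _; rewrite lee_fin !mulr_ge0 ?pwt_ge0.
- exact: measurable_pwt2E.
- by move=> x _; rewrite lee_fin pwt2_ge0.
apply: eq_integral => x _; rewrite -EFinD -mulrDl; congr (_ * _)%:E.
rewrite /pwt; case: (ltP b x) => bx; last by rewrite mulr1 add0r.
by rewrite (le_lt_trans ab bx) mulr0 addr0.
Qed.

Section Monotonicity.
Variable s beta : R.
Hypothesis s01 : 0 < s < 1.

Let s0 : 0 < s. Proof. by case/andP: s01. Qed.
Let sN0 : - s != 0. Proof. by rewrite oppr_eq0 gt_eqF. Qed.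
Notation B th := (conv_pw (- s - 1) (beta - 1) th 1).
Notation P th := (th `^ (- s) / s).

Let piece a b : 0 < a <= b -> 
  (\int[mu1]_t (pwt a (- s - 1) t * (t <= b)%R%:R)%:E + (P b)%:E = (P a)%:E)%E.
Proof.
move=> ab; rewrite integral_pwt_oc// -EFinD; congr (_%:E).
by field; rewrite gt_eqF.
Qed.

Let mpiece a b : measurable_fun [set: measurableTypeR R]
  (fun t => (pwt a (- s - 1) t * (t <= b)%R%:R)%:E).
Proof.
by apply: measurable_EFinT; apply: measurable_funM; [exact: measurable_pwt|exact: measurable_leb].
Qed.

Let mpiece2 a b : measurable_fun [set: measurableTypeR R]
  (fun t => (pwt a (- s - 1) t * (t <= b)%R%:R * pwt 0 (beta - 1) (1 - t))%:E).
Proof.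
apply: measurable_EFinT; apply: measurable_funM.
  by apply: measurable_funM; [exact: measurable_pwt|exact: measurable_leb].
have m : measurable_fun setT (fun h => 1 - h : R) by exact: measurable_funB.
exact: (measurableT_comp (@measurable_pwt R 0 _) m).
Qed.

(** [P th] is the integral of [h^(-s-1)] over [h > th], while [B th] carries the extra factor
    [(1 - h)^(beta-1)] on [(th, 1)]. For [1 <= beta] this factor is at most one, so [P - B]
    decreases in [th]. The sums avoid subtracting [B], which is an extended real. *)
Lemma conv_pw_le_mono a b : 1 <= beta -> 0 < a <= b -> b <= 1 ->
  (B a + (P b)%:E <= B b + (P a)%:E)%E.
Proof.
move=> b1 /[dup] ab' /andP[a0 ab] bl1.
rewrite (conv_pw_split _ _ ab) -(piece ab') -addeA leeD2l// leeD2r//.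
apply: ge0_le_integral => //.
- by move=> x _; rewrite lee_fin !mulr_ge0 ?pwt_ge0.
- move=> x _; rewrite lee_fin /pwt; case: ltP => ax; last by rewrite !mul0r.
  case: (leP x b) => xb; last by rewrite mulr0 mul0r.
  rewrite mulr1 ler_piMr ?powR_ge0//; case: ifP => // x1.
  have : (1 - x) `^ (beta - 1) <= 1 `^ (beta - 1).
    have y0 : 0 <= 1 - x by rewrite ltW.
    have y1 : 1 - x <= 1 by rewrite gerBl ltW// (lt_trans a0).
    by rewrite ge0_ler_powR ?nnegrE ?y0 ?subr_ge0.
  by rewrite powR1.
Qed.

(** For [beta <= 1] the factor [(1 - h)^(beta-1)] is at least one and [P - B] increases instead. [B]
    may then be large away from zero, hence the separate treatment of the two ranges of [beta]
    below. *)
Lemma conv_pw_ge_mono a b : beta <= 1 -> 0 < a <= b -> b < 1 ->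
  (B b + (P a)%:E <= B a + (P b)%:E)%E.
Proof.
move=> b1 /[dup] ab' /andP[a0 ab] bl1.
rewrite (conv_pw_split _ _ ab) -(piece ab') -[leRHS]addeA; apply: leeD2l; apply: leeD2r.
apply: ge0_le_integral => //.
- by move=> x _; rewrite lee_fin !mulr_ge0 ?pwt_ge0.
- move=> x _; rewrite lee_fin /pwt; case: ltP => ax; last by rewrite !mul0r.
  case: (leP x b) => xb; last by rewrite mulr0 mul0r.
  have x1 : x < 1 by exact: le_lt_trans bl1.
  have x0 : 0 < x by exact: lt_trans ax.
  rewrite mulr1 ler_peMr ?powR_ge0// subr_gt0 x1.
  have y0 : 0 < 1 - x by rewrite subr_gt0.
  rewrite -[beta - 1]opprB powRN invf_ge1 ?powR_gt0//.
  have : (1 - x) `^ (1 - beta) <= 1 `^ (1 - beta).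
    have y1 : 1 - x <= 1 by rewrite gerBl ltW.
    by rewrite ge0_ler_powR ?nnegrE ?(ltW y0) ?subr_ge0.
  by rewrite powR1.
Qed.

End Monotonicity.

End FractionalConstant.

(** * The sharp constant in time, by a Laplace transform *)

Section FractionalConstantValue.
Variable R : realType.
Notation mu1 := (@lebesgue_measure R).
Implicit Types (p q r t u h x s beta eps th nu K : R).

Lemma measurable_expRN : measurable_fun setT (fun t : R => expR (- t)).
Proof. by apply: measurableT_comp. Qed.

Lemma measurable_pwt_exp a p : measurable_fun [set: measurableTypeR R]
  (fun t => (pwt a p t * expR (- t))%:E).
Proof.
apply: measurable_EFinT; apply: measurable_funM; first exact: measurable_pwt.
exact: measurable_expRN.
Qed.

Lemma pwt_exp_ge0 a p t : 0 <= pwt a p t * expR (- t).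
Proof. by rewrite mulr_ge0 ?pwt_ge0 ?expR_ge0. Qed.

Lemma Gamma_le_tail p eps : 0 < p -> 0 < eps ->
  ((Gamma p)%:E <= \int[mu1]_t (pwt eps (p - 1) t * expR (- t))%:E + (eps `^ p / p)%:E)%E.
Proof.
move=> p0 e0; rewrite -GammaEFin//.
apply: le_trans (leeD2l _ (integral_pwt0_le e0 p0)).
have m1 := measurable_pwt_exp eps (p - 1).
have m2 : measurable_fun [set: measurableTypeR R]
    (fun t => (pwt 0 (p - 1) t * (t <= eps)%R%:R)%:E).
  apply: measurable_EFinT; apply: measurable_funM;
    [exact: measurable_pwt|exact: measurable_leb].
rewrite -ge0_integralD//; first last.
- by move=> t _; rewrite lee_fin mulr_ge0 ?pwt_ge0.
- by move=> t _; rewrite lee_fin pwt_exp_ge0.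
apply: ge0_le_integral => //.
- by move=> t _; rewrite lee_fin pwt_exp_ge0.
- exact: measurable_pwt_exp.
- exact: emeasurable_funD.
- move=> t _; rewrite -EFinD lee_fin /pwt; case: (ltP eps t) => te.
    by rewrite (lt_trans e0 te) mulr0 addr0.
  rewrite mul0r add0r mulr1; case: ltP => t0; last by rewrite mul0r.
  by rewrite ler_piMr ?powR_ge0// -expR0 ler_expR oppr_le0 ltW.
Qed.

Lemma integral_expRN_tail h : (\int[mu1]_t (pwt h 0 t * expR (- t))%:E = (expR (- h))%:E)%E.
Proof.
rewrite (@pwt_indic _ _ _ (fun t => expR (- t)) (fun t => expR (- t))); last first.
  by move=> t _; rewrite powRr0 mul1r.
rewrite integral_itv_obnd_cbnd; last first.
  by apply/measurable_EFinP; apply: measurable_funTS; exact: measurable_expRN.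
have dF (x : R) : is_derive x 1 (fun t : R => - expR (- t) : R^o) (expR (- x)).
  by apply: is_derive_eq; rewrite /GRing.scale/= mulrN1 opprK.
have cE (x : R) : expR (- u) @[u --> x] --> expR (- x).
  by apply: (@cvg_comp _ _ _ (fun u => - u) expR _ (nbhs (- x))); [apply: cvgN; exact: cvg_id|exact: continuous_expR].
rewrite (@ge0_continuous_FTC2y _ _ (fun t : R => - expR (- t)) _ 0).
- by rewrite -EFinB sub0r opprK.
- by move=> x _; exact: expR_ge0.
- by apply: continuous_in_subspaceT => x _; exact: cE.
- by rewrite -oppr0; apply: cvgN; exact: cvgr_expR.
- by move=> x _; have [] := dF x.
- by apply: cvgN; apply: cvg_at_right_filter; exact: cE.
- by move=> x _; have [_ <-] := dF x; rewrite derive1E.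
Qed.

Section Test.
Variable s : R.
Hypothesis s01 : 0 < s < 1.
Let s0 : 0 < s. Proof. by case/andP: s01. Qed.
Let s1 : 0 < 1 - s. Proof. by rewrite subr_gt0; case/andP: s01. Qed.

Lemma measurable_fstM (f g : R -> R) (k : R * R -> R) :
  measurable_fun setT f -> measurable_fun setT g ->
  measurable_fun [set: measurableTypeR R * measurableTypeR R] k ->
  measurable_fun [set: measurableTypeR R * measurableTypeR R]
    (fun z => (f z.1 * (g z.2 * k z))%:E).
Proof.
move=> mf mg mk; apply/measurable_EFinP; apply: measurable_funM.
  exact: (measurableT_comp (mf : measurable_fun [set: measurableTypeR R] f) measurable_fst).
apply: measurable_funM => //.
exact: (measurableT_comp (mg : measurable_fun [set: measurableTypeR R] g) measurable_snd).
Qed.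

(** Integration by parts, done with Tonelli: write [exp (-h)] as the integral of [exp (-u)] over
    [u > h] and integrate [h^(-s-1)] over [(eps, u]] first, which gives
    [(eps^(-s) - u^(-s)) / s]. *)
Lemma exp_tail_bound eps : 0 < eps ->
  (\int[mu1]_h (pwt eps (- s - 1) h * expR (- h))%:E +
   (s^-1)%:E * \int[mu1]_u (pwt eps (- s) u * expR (- u))%:E <= (eps `^ (- s) / s)%:E)%E.
Proof.
move=> e0.
pose k (z : R * R) : R := (z.2 <= z.1)%R%:R.
have mk : measurable_fun [set: measurableTypeR R * measurableTypeR R] k.
  rewrite (_ : k = fun z => if z.2 <= z.1 then 1 else 0); last first.
    by apply/funext => z; rewrite /k; case: ifP.
  apply: measurable_fun_ifT => //; apply: measurable_fun_ler.
    exact: measurable_snd.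
  exact: measurable_fst.
have mF : measurable_fun [set: measurableTypeR R * measurableTypeR R]
    (fun z => (pwt eps 0 z.1 * expR (- z.1) * (pwt eps (- s - 1) z.2 * k z))%:E).
  apply: (measurable_fstM (f := fun u => pwt eps 0 u * expR (- u))) => //.
    by apply: measurable_funM; [exact: measurable_pwt|exact: measurable_expRN].
  exact: measurable_pwt.
have F0 z : (0 <= (pwt eps 0 z.1 * expR (- z.1) * (pwt eps (- s - 1) z.2 * k z))%:E)%E.
  by rewrite lee_fin !mulr_ge0 ?pwt_ge0 ?expR_ge0.
have H1 : (\int[mu1]_h (pwt eps (- s - 1) h * expR (- h))%:E <=
  \int[mu1]_h \int[mu1]_u (pwt eps 0 u * expR (- u) * (pwt eps (- s - 1) h * k (u, h)))%:E)%E.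
  apply: ge0_le_integral => //.
  - by move=> h _; rewrite lee_fin pwt_exp_ge0.
  - exact: measurable_pwt_exp.
  - exact: (measurable_fun_fubini_tonelli_G (m1 := mu1) _ mF F0).
  - move=> h _; have [eh|he] := ltP eps h; last first.
      rewrite /pwt ltNge he mul0r.
      by apply: integral_ge0 => u _; rewrite lee_fin !mulr_ge0 ?pwt_ge0 ?expR_ge0//; case: ifP.
    rewrite EFinM -integral_expRN_tail -ge0_integralZl ?lee_fin ?pwt_ge0//; first last.
    - by move=> u _; rewrite lee_fin pwt_exp_ge0.
    - exact: measurable_pwt_exp.
    apply: ge0_le_integral => //.
    - by move=> u _; rewrite -EFinM lee_fin mulr_ge0 ?pwt_exp_ge0 ?pwt_ge0.
    - by apply: measurable_funeM; exact: measurable_pwt_exp.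
    - exact: (measurable_fun_pair1 h mF).
    move=> u _; rewrite -EFinM lee_fin /k/=.
    rewrite [leRHS](_ : _ = pwt eps (- s - 1) h * ((pwt eps 0 u * (h <= u)%R%:R) * expR (- u))); last by ring.
    rewrite ler_wpM2l ?pwt_ge0// ler_wpM2r ?expR_ge0//.
    rewrite /pwt; case: ltP => [hu|_]; last exact: (mulr_ge0 (pwt_ge0 _ _ _)).
    by rewrite (lt_trans eh hu) (ltW hu) mulr1.
apply: (@le_trans _ _ (\int[mu1]_u ((eps `^ (- s) / s)%:E * (pwt eps 0 u * expR (- u))%:E))%E); last first.
  rewrite ge0_integralZl; [|by []|exact: measurable_pwt_exp|..].
  - rewrite integral_expRN_tail -EFinM lee_fin ler_piMr ?divr_ge0 ?powR_ge0 ?(ltW s0)//.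
    by rewrite -expR0 ler_expR oppr_le0 ltW.
  - by move=> u _; rewrite lee_fin pwt_exp_ge0.
  - by rewrite lee_fin divr_ge0 ?powR_ge0 ?(ltW s0).
apply: (le_trans (leeD2r _ H1)).
rewrite -(fubini_tonelli (m1 := mu1) (m2 := mu1) _ mF F0)/=.
rewrite -ge0_integralZl ?lee_fin ?invr_ge0 ?(ltW s0)//; first last.
- by move=> u _; rewrite lee_fin pwt_exp_ge0.
- exact: measurable_pwt_exp.
have m1 : measurable_fun [set: measurableTypeR R]
    (fun u => (s^-1)%:E * (pwt eps (- s) u * expR (- u))%:E)%E.
  by apply: measurable_funeM; exact: measurable_pwt_exp.
have m2 := measurable_fun_fubini_tonelli_F (m2 := mu1) _ mF F0.
rewrite -ge0_integralD//; first last.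
- by move=> u _; rewrite -EFinM lee_fin mulr_ge0 ?pwt_exp_ge0 ?invr_ge0// ltW.
- move=> u _; apply: integral_ge0 => h _; exact: F0 (u, h).
apply: ge0_le_integral => //.
- move=> u _; rewrite adde_ge0//; first by apply: integral_ge0 => h _; exact: F0 (u, h).
  by rewrite -EFinM lee_fin mulr_ge0 ?pwt_exp_ge0 ?invr_ge0// ltW.
- exact: emeasurable_funD.
- by apply: measurable_funeM; exact: measurable_pwt_exp.
move=> u _; have [eu|ue] := ltP eps u; last first.
  rewrite /pwt ltNge ue/= !mul0r !mule0 adde0 integral0_eq// => h _.
  by rewrite mul0r.
have -> : (\int[mu1]_h (pwt eps 0 u * expR (- u) * (pwt eps (- s - 1) h * k (u, h)))%:E =
    (expR (- u))%:E * \int[mu1]_h (pwt eps (- s - 1) h * (h <= u)%R%:R)%:E)%E.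
  rewrite -ge0_integralZl ?lee_fin ?expR_ge0//; first last.
  - by move=> h _; rewrite lee_fin mulr_ge0 ?pwt_ge0.
  - apply: measurable_EFinT; apply: measurable_funM;
      [exact: measurable_pwt|exact: measurable_leb].
  by apply: eq_integral => h _; rewrite -EFinM {1}/pwt eu powRr0 mul1r.
rewrite integral_pwt_oc ?oppr_eq0 ?(gt_eqF s0)//; last by rewrite e0 ltW.
rewrite -!EFinM -EFinD lee_fin /pwt eu powRr0 mul1r le_eqVlt; apply/orP; left.
by apply/eqP; field; rewrite gt_eqF.
Qed.

End Test.

Lemma measurable_conv_pw q p eps : measurable_fun [set: measurableTypeR R] (conv_pw q p eps).
Proof.
have mk : measurable_fun [set: measurableTypeR R * measurableTypeR R]
    (fun z => pwt 0 p (z.1 - z.2)).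
  apply: (measurableT_comp (@measurable_pwt R 0 p : measurable_fun [set: measurableTypeR R] _)).
  have : measurable_fun [set: measurableTypeR R * measurableTypeR R]
      (fun z => (z.1 : R) - (z.2 : R)).
    by apply: measurable_funB; [exact: measurable_fst|exact: measurable_snd].
  exact.
have m1 : measurable_fun setT (fun _ : R => 1 : R) by exact: measurable_cst.
have mF := measurable_fstM m1 (@measurable_pwt R eps q) mk.
have F0 z : (0 <= (1 * (pwt eps q z.2 * pwt 0 p (z.1 - z.2)))%:E)%E.
  by rewrite lee_fin !mulr_ge0 ?pwt_ge0.
have := measurable_fun_fubini_tonelli_F (m2 := mu1) _ mF F0.
rewrite [X in measurable_fun _ X -> _](_ : _ = conv_pw q p eps)//.
by apply/funext => t; apply: eq_integral => h _; rewrite mul1r.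
Qed.

(** The Laplace transform at one turns the convolution into a product, because
    [exp (-t) = exp (-h) * exp (-(t - h))]. *)
Lemma integral_exp_conv q p eps :
  0 < p + 1 ->
  (\int[mu1]_t ((expR (- t))%:E * conv_pw q p eps t) =
   \int[mu1]_h (pwt eps q h * expR (- h))%:E * (Gamma (p + 1))%:E)%E.
Proof.
move=> p1.
have mk : measurable_fun [set: measurableTypeR R * measurableTypeR R]
    (fun z => pwt 0 p (z.1 - z.2)).
  apply: (measurableT_comp (@measurable_pwt R 0 p : measurable_fun [set: measurableTypeR R] _)).
  have : measurable_fun [set: measurableTypeR R * measurableTypeR R]
      (fun z => (z.1 : R) - (z.2 : R)).
    by apply: measurable_funB; [exact: measurable_fst|exact: measurable_snd].
  exact.
have mF := measurable_fstM measurable_expRN (@measurable_pwt R eps q) mk.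
have F0 z : (0 <= (expR (- z.1) * (pwt eps q z.2 * pwt 0 p (z.1 - z.2)))%:E)%E.
  by rewrite lee_fin !mulr_ge0 ?pwt_ge0 ?expR_ge0.
transitivity (\int[mu1]_t \int[mu1]_h (expR (- t) * (pwt eps q h * pwt 0 p (t - h)))%:E)%E.
  apply: eq_integral => t _; rewrite /conv_pw -ge0_integralZl ?lee_fin ?expR_ge0//.
  - exact: measurable_pwt2E.
  - by move=> h _; rewrite lee_fin pwt2_ge0.
rewrite (fubini_tonelli (m1 := mu1) (m2 := mu1) _ mF F0)/= -ge0_integralZr ?lee_fin ?(ltW (Gamma_gt0 _))//; first last.
- by move=> h _; rewrite lee_fin pwt_exp_ge0.
- exact: measurable_pwt_exp.
apply: eq_integral => h _.
rewrite (ge0_integral_affine h ltr01); first last.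
- by move=> t; exact: F0 (t, h).
- exact: (measurable_fun_pair1 h mF).
rewrite mul1e -GammaEFin// addrK -ge0_integralZl ?lee_fin ?pwt_exp_ge0//; first last.
- by move=> t _; rewrite lee_fin pwt_exp_ge0.
- exact: measurable_pwt_exp.
apply: eq_integral => t _; rewrite -EFinM; congr (_%:E).
by rewrite mul1r addrK opprD expRD; ring.
Qed.

Lemma lerB_chain (x1 x2 x3 x4 x5 x6 : R) : x4 <= x1 + x2 -> x1 <= x3 + (x5 + x6) ->
  x4 - x3 <= x5 + x6 + x2.
Proof. lra. Qed.

Lemma frac_const_id (g g' e1 e2 c s1 k th s b n : R) : s1 != 0 -> s != 0 -> b != 0 -> k != 0 ->
  (n + c * (e2 * th / k) + e2 / (s * b) < g * (g' - e1 / s1) / s) =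
  (g / s1 / s * e1 + (c * (th / k) + (s * b)^-1) * e2 < g * g' / s - n).
Proof.
move=> s10 sn0 b0 k0; rewrite -subr_gt0 -[RHS]subr_gt0; congr (0 < _); field.
by rewrite s10 sn0 b0 k0.
Qed.

Section Limit.
Variables s beta nu K th0 : R.
Hypotheses (s01 : 0 < s < 1) (sb : s < beta) (nu0 : 0 <= nu) (K0 : 0 <= K)
  (th00 : 0 < th0).
Hypothesis H : forall th, 0 < th < 1 ->
  ((th `^ (- s) / s)%:E <= conv_pw (- s - 1) (beta - 1) th 1 +
     (nu + K * (th0 <= th)%R%:R)%:E)%E.

Let s0 : 0 < s. Proof. by case/andP: s01. Qed.
Let s1 : 0 < 1 - s. Proof. by rewrite subr_gt0; case/andP: s01. Qed.
Let b0 : 0 < beta. Proof. exact: lt_trans sb. Qed.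
Let bs0 : 0 < beta - s. Proof. by rewrite subr_gt0. Qed.

(** Take [H] at [th = eps / t], multiply by [t^(beta-s-1) * exp (-t)] and integrate over [t > eps].
    The exceptional range [th0 <= eps / t] is [t <= eps / th0], whose contribution vanishes with
    [eps]. *)
Let key eps : 0 < eps ->
  ((eps `^ (- s) / s)%:E * \int[mu1]_t (pwt eps (beta - 1) t * expR (- t))%:E <=
   \int[mu1]_h (pwt eps (- s - 1) h * expR (- h))%:E * (Gamma beta)%:E +
   ((nu * Gamma (beta - s))%:E +
    (K * ((eps / th0) `^ (beta - s) / (beta - s)))%:E))%E.
Proof.
move=> e0.
have m1 := measurable_pwt_exp eps (beta - 1).
have m2 := measurable_pwt_exp 0 (beta - s - 1).
have m3 : measurable_fun [set: measurableTypeR R]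
    (fun t => (pwt 0 (beta - s - 1) t * (t <= eps / th0)%R%:R)%:E).
  apply: measurable_EFinT; apply: measurable_funM;
    [exact: measurable_pwt|exact: measurable_leb].
have m4 : measurable_fun [set: measurableTypeR R]
    (fun t => (expR (- t))%:E * conv_pw (- s - 1) (beta - 1) eps t)%E.
  by apply: emeasurable_funM; [apply: measurable_EFinT; exact: measurable_expRN
    |exact: measurable_conv_pw].
have p1 t : (0 <= (expR (- t))%:E * conv_pw (- s - 1) (beta - 1) eps t)%E.
  by rewrite mule_ge0 ?conv_pw_ge0// lee_fin expR_ge0.
have p2 t : (0 <= nu%:E * (pwt 0 (beta - s - 1) t * expR (- t))%:E)%E.
  by rewrite -EFinM lee_fin mulr_ge0 ?pwt_exp_ge0.
have p3 t : (0 <= K%:E * (pwt 0 (beta - s - 1) t * (t <= eps / th0)%R%:R)%:E)%E.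
  by rewrite -EFinM lee_fin !mulr_ge0 ?pwt_ge0.
have m2' : measurable_fun [set: measurableTypeR R]
    (fun t => nu%:E * (pwt 0 (beta - s - 1) t * expR (- t))%:E)%E.
  exact: measurable_funeM.
have m3' : measurable_fun [set: measurableTypeR R]
    (fun t => K%:E * (pwt 0 (beta - s - 1) t * (t <= eps / th0)%R%:R)%:E)%E.
  exact: measurable_funeM.
have b1 : 0 < beta - 1 + 1 by rewrite subrK.
have := integral_exp_conv (- s - 1) eps b1; rewrite subrK => <-.
apply: (@le_trans _ _ (\int[mu1]_t ((expR (- t))%:E * conv_pw (- s - 1) (beta - 1) eps t +
  (nu%:E * (pwt 0 (beta - s - 1) t * expR (- t))%:E +
   K%:E * (pwt 0 (beta - s - 1) t * (t <= eps / th0)%R%:R)%:E)))%E); last first.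
  rewrite ge0_integralD//; first last.
  - exact: emeasurable_funD.
  - by move=> t _; rewrite adde_ge0.
  apply: leeD2l; rewrite ge0_integralD//.
  rewrite !ge0_integralZl//; first last.
  - by move=> t _; rewrite lee_fin pwt_exp_ge0.
  - by move=> t _; rewrite lee_fin mulr_ge0 ?pwt_ge0.
  rewrite GammaEFin// EFinM; apply: leeD2l; rewrite EFinM; apply: lee_wpmul2l => //.
  by apply: integral_pwt0_le => //; rewrite divr_gt0.
rewrite -ge0_integralZl ?lee_fin ?divr_ge0 ?powR_ge0 ?(ltW s0)//; last first.
  by move=> t _; rewrite lee_fin pwt_exp_ge0.
apply: ge0_le_integral => //.
- move=> t _; rewrite -EFinM lee_fin mulr_ge0 ?pwt_exp_ge0// divr_ge0 ?powR_ge0//.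
  exact: ltW.
- exact: measurable_funeM.
- by apply: emeasurable_funD => //; exact: emeasurable_funD.
move=> t _; have [et|te] := ltP eps t; last first.
  by rewrite {1}/pwt ltNge te/= mul0r mule0 !adde_ge0.
have t0 : 0 < t by exact: lt_trans et.
rewrite conv_pw_scale ?(ltW e0)//.
rewrite (_ : - s - 1 + (beta - 1) + 1 = beta - s - 1); last by ring.
have th1 : 0 < eps / t < 1 by rewrite divr_gt0//= ltr_pdivrMr// mul1r.
set b' := beta - s - 1; set B := conv_pw _ _ _ 1.
have tb0 : (0 <= (t `^ b' * expR (- t))%:E)%E by rewrite lee_fin mulr_ge0 ?powR_ge0 ?expR_ge0.
have := lee_wpmul2l tb0 (H th1); rewrite -/B.
rewrite ge0_muleDr ?conv_pw_ge0//; last by rewrite lee_fin addr_ge0// mulr_ge0.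
rewrite (_ : (t `^ b' * expR (- t))%:E * ((eps / t) `^ (- s) / s)%:E =
  (eps `^ (- s) / s)%:E * (pwt eps (beta - 1) t * expR (- t))%:E)%E; last first.
  rewrite -!EFinM; congr (_%:E); rewrite /pwt et powRM ?invr_ge0 ?(ltW t0) ?(ltW e0)//.
  rewrite -powR_inv1 ?(ltW t0)// -powRrM mulN1r opprK.
  rewrite (_ : beta - 1 = b' + s); last by rewrite /b'; ring.
  by rewrite powRD ?(gt_eqF t0) ?implybT//; ring.
move/le_trans; apply.
apply: leeD; first by rewrite EFinM -muleA [leRHS]muleCA.
rewrite -!EFinM -EFinD lee_fin /pwt t0 mulrDr; apply: lerD; first by rewrite mulrC.
rewrite (_ : (th0 <= eps / t) = (t <= eps / th0)); last first.
  by rewrite !ler_pdivlMr// mulrC.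
rewrite mulrCA ler_wpM2l// ler_wpM2r// ler_piMr ?powR_ge0//.
by rewrite -expR0 ler_expR oppr_le0 ltW.
Qed.

(* The convolution of truncated powers is tested against [exp (- t)], and [eps] is sent to [0]. *)
Lemma frac_const_le : Gamma beta * Gamma (1 - s) / s <= nu * Gamma (beta - s).
Proof.
have G1 := Gamma_gt0 b0. have G2 := Gamma_gt0 s1. have G3 := Gamma_gt0 bs0.
(* In [key] the left integral is at least [Gamma beta - eps^beta / beta], and [exp_tail_bound]
   bounds the right one by [eps^(-s) / s] minus about [Gamma (1 - s) / s]. The divergent term
   [eps^(-s) / s * Gamma beta] then cancels between the two sides. *)
have main eps : 0 < eps ->
  Gamma beta * (Gamma (1 - s) - eps `^ (1 - s) / (1 - s)) / s <=
  nu * Gamma (beta - s) + K * ((eps / th0) `^ (beta - s) / (beta - s)) +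
  eps `^ (beta - s) / (s * beta).
  move=> e0.
  have k1 := key e0.
  have k2 := Gamma_le_tail b0 e0.
  have k3 := exp_tail_bound s01 e0.
  have k4 := Gamma_le_tail s1 e0.
  have : (1 - s) - 1 = - s by ring.
  move=> ss; rewrite ss in k4.
  move: k1 k2 k3 k4.
  set e := (\int[mu1]_h (pwt eps (- s - 1) h * expR (- h))%:E)%E.
  set a := (\int[mu1]_h (pwt eps (beta - 1) h * expR (- h))%:E)%E.
  set c := (\int[mu1]_h (pwt eps (- s) h * expR (- h))%:E)%E.
  have : (0 <= e)%E by apply: integral_ge0 => t _; rewrite lee_fin pwt_exp_ge0.
  have : (0 <= a)%E by apply: integral_ge0 => t _; rewrite lee_fin pwt_exp_ge0.
  have : (0 <= c)%E by apply: integral_ge0 => t _; rewrite lee_fin pwt_exp_ge0.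
  have : (a <= (Gamma beta)%:E)%E.
    rewrite -GammaEFin//; apply: ge0_le_integral => //.
    - by move=> t _; rewrite lee_fin pwt_exp_ge0.
    - exact: measurable_pwt_exp.
    - exact: measurable_pwt_exp.
    - move=> t _; rewrite lee_fin ler_wpM2r ?expR_ge0//; apply: pwt_mono; exact: ltW.
  case: a => [a| |] //; case: c => [c| |]//; case: e => [e| |]//; rewrite ?lee_fin => aG c0 a0 ee0.
  - move=> k1 k2 k3 k4.
    pose X := K * ((eps / th0) `^ (beta - s) / (beta - s)).
    pose Y := eps `^ beta / beta; pose Z := eps `^ (1 - s) / (1 - s).
    pose kap := eps `^ (- s) / s.
    have kap0 : 0 <= kap by rewrite divr_ge0 ?powR_ge0// ltW.
    have -> : eps `^ (beta - s) / (s * beta) = kap * Y.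
      rewrite /kap /Y mulf_div -powRD ?(gt_eqF e0) ?implybT//.
      by congr (_ `^ _ / _); ring.
    rewrite -/X -/Z.
    have l1 : Gamma beta * (Gamma (1 - s) - Z) / s <= Gamma beta * (kap - e).
      rewrite -mulrA ler_wpM2l ?(ltW G1)//.
      apply: (@le_trans _ _ (c / s)).
        by rewrite ler_wpM2r ?invr_ge0 ?(ltW s0)// lerBlDr.
      by rewrite lerBrDl mulrC.
    apply: (le_trans l1); rewrite mulrBr.
    have l2 : Gamma beta * kap <= kap * a + kap * Y.
      by rewrite mulrC -mulrDr ler_wpM2l.
    have l3 : kap * a <= e * Gamma beta + (nu * Gamma (beta - s) + X) by exact: k1.
    rewrite [Gamma beta * e]mulrC.
    exact: lerB_chain l2 l3.
  - by move=> _ _; rewrite ?gt0_muley ?lte_fin ?invr_gt0// ?addye// ?addey.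
  - by move=> _ _; rewrite ?gt0_muley ?lte_fin ?invr_gt0// ?addye// ?addey.
(* All error terms of [main] are multiples of [eps^(1-s)] and [eps^(beta-s)], both exponents being
   positive; a strict failure is contradicted by a small [eps]. *)
rewrite leNgt; apply/negP => lt.
pose a1 := Gamma beta / (1 - s) / s.
pose b1 := K * (th0^-1 `^ (beta - s) / (beta - s)) + (s * beta)^-1.
have lim0 : a1 * e `^ (1 - s) + b1 * e `^ (beta - s) @[e --> 0^'+] --> a1 * 0 + b1 * 0.
  by apply: cvgD; apply: cvgM; [exact: cvg_cst|exact: powR_cvg0|exact: cvg_cst|exact: powR_cvg0].
rewrite !mulr0 addr0 in lim0.
have A0 : 0 < Gamma beta * Gamma (1 - s) / s - nu * Gamma (beta - s) by rewrite subr_gt0.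
have [e [e0 eA]] : exists e, 0 < e /\
    a1 * e `^ (1 - s) + b1 * e `^ (beta - s) < Gamma beta * Gamma (1 - s) / s - nu * Gamma (beta - s).
  near ((0:R)^'+) => e; exists e; split; first by near: e; exact: nbhs_right_gt.
  by near: e; exact: (cvgr_lt _ lim0).
have := main _ e0; rewrite leNgt => /negP; apply.
rewrite powRM ?invr_ge0 ?(ltW e0) ?(ltW th00)//.
by rewrite frac_const_id// gt_eqF.
Unshelve. all: end_near. Qed.

End Limit.

End FractionalConstantValue.

Section FractionalConstantBound.
Variable R : realType.
Variables s beta nu : R.
Hypotheses (s01 : 0 < s < 1) (sb : s < beta) (nu0 : 0 <= nu).
Hypothesis nuC : nu * Gamma (beta - s) < Gamma beta * Gamma (1 - s) / s.

Let s0 : 0 < s. Proof. by case/andP: s01. Qed.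
Notation B th := (conv_pw (- s - 1) (beta - 1) th 1).
Notation P th := (th `^ (- s) / s).

Let B1 : B 1 = 0%E.
Proof.
rewrite /conv_pw integral0_eq// => x _; rewrite /pwt.
case: (ltP 1 x) => x1; last by rewrite mul0r.
by rewrite subr_gt0 ltNge (ltW x1) mulr0.
Qed.

Let PE_mono a b : 0 < a <= b -> P b <= P a.
Proof.
move=> /andP[a0 ab]; rewrite ler_pM2r ?invr_gt0// !powRN lef_pV2 ?posrE ?powR_gt0//.
  by rewrite ge0_ler_powR ?nnegrE ?(ltW s0) ?(ltW a0)// (le_trans (ltW a0)).
exact: lt_le_trans ab.
Qed.

(** If [1 <= beta], [P - B] decreases: one good [th0] makes every smaller [th] good, and if there
    were none [frac_const_le] with [K = 0] would contradict [nuC]. If [beta < 1], [P - B] increases: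
    a failure at [th] spreads to all smaller values, and [frac_const_le] again contradicts [nuC], so
    every [th] is good and [th0 = 1]. *)
Let step : exists2 th0, 0 < th0 <= 1 & (forall th, 0 < th < th0 -> (B th + nu%:E <= (P th)%:E)%E) /\
  (forall th, 0 < th < 1 -> (B th <= (P th)%:E)%E).
Proof.
have [b1|b1] := leP 1 beta.
  have BP th : 0 < th <= 1 -> (B th <= (P th)%:E)%E.
    move=> th1; have := conv_pw_le_mono s01 b1 th1 (lexx 1).
    rewrite B1 add0e; apply: le_trans; rewrite leeDl// lee_fin.
    by rewrite divr_ge0 ?powR_ge0 ?ltW.
  have finB th : 0 < th <= 1 -> B th \is a fin_num.
    move=> th1; rewrite ge0_fin_numE ?conv_pw_ge0//.
    by rewrite (le_lt_trans (BP _ th1))// ltry.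
  apply: contrapT => nex.
  have H th : 0 < th < 1 -> ((P th)%:E <= B th + nu%:E)%E.
    move=> th1; have th1' : 0 < th <= 1 by case/andP: th1 => -> /ltW.
    apply: contrapT => /negP; rewrite -ltNge => lt.
    apply: nex; exists th => //; split; last first.
      by move=> x /andP[x0 x1]; apply: BP; rewrite x0 ltW.
    move=> x /andP[x0 xth]; have xth' : 0 < x <= th by rewrite x0 ltW.
    have x1 : 0 < x <= 1 by rewrite x0 (le_trans (ltW xth))//; case/andP: th1'.
    have := conv_pw_le_mono s01 b1 xth' (proj2 (andP th1')).
    move: lt; rewrite -(fineK (finB _ x1)) -(fineK (finB _ th1')) -!EFinD !lte_fin !lee_fin.
    set u := fine _; set v := fine _; lra.
  have := @frac_const_le R s beta nu 0 1 s01 sb nu0 (lexx 0) ltr01.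
  rewrite leNgt nuC => /(_ _)/negP; apply => // th th1.
  by rewrite mul0r addr0; exact: H.
suff H th : 0 < th < 1 -> (B th + nu%:E <= (P th)%:E)%E.
  exists 1; first by rewrite ltr01 lexx.
  split => // th th1.
  by apply: le_trans (H _ th1); rewrite leeDl// lee_fin.
move=> /andP[th0 th1]; apply: contrapT => /negP; rewrite -ltNge => lt.
have PK : 0 <= P th by rewrite divr_ge0 ?powR_ge0 ?ltW.
(* The constant [K = P th] covers the values above [th], where [P] is smaller than [P th] and
   nothing is known of [B]. *)
have := @frac_const_le R s beta nu (P th) th s01 sb nu0 PK th0.
rewrite leNgt nuC => /(_ _)/negP; apply => // x /andP[x0 x1].
have [thx|xth] := leP th x.
  rewrite mulr1 -[leLHS]add0e; apply: leeD; first exact: conv_pw_ge0.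
  rewrite lee_fin (le_trans (@PE_mono th x _)) ?lerDr//.
  by rewrite th0.
rewrite mulr0 addr0.
have := conv_pw_ge_mono s01 (ltW b1) _ th1 (a := x); rewrite x0 (ltW xth) => /(_ isT).
case: (B x) (conv_pw_ge0 (- s - 1) (beta - 1) x 1) => [bx| |]//.
move: lt; case: (B th) (conv_pw_ge0 (- s - 1) (beta - 1) th 1) => [bt| |]//.
  move=> _; rewrite -!EFinD lte_fin !lee_fin; set u := P x; set v := P th.
  by move=> l1 _ l2; move: l1 l2; lra.
by move=> _ _; rewrite addye// leey.
Qed.

(** Only for [eps / t < th0] is there room for the term in [nu]; with [M = 1 / th0] this reads
    [t > M * eps], which is why that term is cut off at [M * eps]. For the remaining times the
    weaker bound [B <= P] is enough. *)
Lemma frac_const : exists2 M, 1 <= M & forall eps t, 0 < eps ->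
  (conv_pw (- s - 1) (beta - 1) eps t + (nu * pwt (M * eps) (beta - s - 1) t)%:E <=
   (eps `^ (- s) / s * pwt eps (beta - 1) t)%:E)%E.
Proof.
have [th0 /andP[th00 th01] [H1 H2]] := step.
exists th0^-1; first by rewrite invf_ge1.
move=> eps t e0; have [et|te] := ltP eps t; last first.
  have pw0 a q : eps <= a -> pwt a q t = 0 by move=> ea; rewrite /pwt ltNge (le_trans te ea).
  rewrite !pw0// ?ler_peMl ?(ltW e0) ?invf_ge1// !mulr0 adde0.
  rewrite /conv_pw integral0_eq// => h _; rewrite /pwt.
  case: (ltP eps h) => eh; last by rewrite mul0r.
  by rewrite subr_gt0 ltNge (le_trans te (ltW eh)) mulr0.
have t0 : 0 < t by exact: lt_trans et.
rewrite conv_pw_scale ?(ltW e0)//.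
rewrite (_ : - s - 1 + (beta - 1) + 1 = beta - s - 1); last by ring.
have th1 : 0 < eps / t < 1 by rewrite divr_gt0//= ltr_pdivrMr// mul1r.
have E : (eps `^ (- s) / s * pwt eps (beta - 1) t) = t `^ (beta - s - 1) * P (eps / t).
  rewrite /pwt et powRM ?invr_ge0 ?(ltW t0) ?(ltW e0)//.
  rewrite -[t^-1]powR_inv1 ?(ltW t0)// -powRrM mulN1r opprK.
  rewrite (_ : beta - 1 = beta - s - 1 + s); last by ring.
  by rewrite powRD ?(gt_eqF t0) ?implybT//; ring.
rewrite E [in leRHS]EFinM.
have [Met|Met] := ltP (th0^-1 * eps) t.
  have tt : 0 < eps / t < th0.
    by rewrite divr_gt0//= ltr_pdivrMr// -ltr_pdivrMl.
  rewrite /pwt Met [nu * _]mulrC EFinM -ge0_muleDr ?conv_pw_ge0 ?lee_fin//.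
  by apply: lee_wpmul2l; rewrite ?lee_fin ?powR_ge0//; exact: H1.
rewrite /pwt ltNge Met/= mulr0 adde0.
by apply: lee_wpmul2l; rewrite ?lee_fin ?powR_ge0//; exact: H2.
Qed.

End FractionalConstantBound.

(** * Truncated potentials *)

Section HeatPotentials.
Variable R : realType.
Variable d : nat.
Notation mu1 := (@lebesgue_measure R).
Notation L := (leb R d).
Notation V := (rVb R d).
Implicit Types (p q r t u h eps : R).

(** Extended by zero to [h <= 0], so that it is jointly measurable in space and time on the whole
    line and no time domain has to be carried along. *)
Definition hk h (x y : 'rV[R]_d) : R := if 0 < h then heat h x y else 0.

Lemma hk_ge0 h x y : 0 <= hk h x y.
Proof. by rewrite /hk; case: ifP => // _; exact: heat_ge0. Qed.

Lemma hkC h x y : hk h x y = hk h y x.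
Proof. by rewrite /hk heatC. Qed.

Lemma hkE h x y : hk h x y =
  pwt 0 (- (d%:R / 2)) h * ((4 * pi) `^ (- (d%:R / 2)) * expR (- 4^-1 * (sqn (x - y) * h `^ (- 1)))).
Proof.
rewrite /hk /pwt; case: ifPn => h0; last by rewrite mul0r.
rewrite heatE// [(_ * h) `^ _]powRM ?mulr_ge0 ?pi_ge0 ?(ltW h0)//.
rewrite powR_inv1 ?(ltW h0)// mulrA [h `^ _ * _]mulrC; congr (_ * expR _).
by field; rewrite gt_eqF.
Qed.

Lemma measurable_hk : measurable_fun [set: (V * V) * measurableTypeR R]
  (fun z => hk z.2 z.1.1 z.1.2).
Proof.
under eq_fun do rewrite hkE.
have m2 (g : R -> R) : measurable_fun setT g ->
    measurable_fun [set: (V * V) * measurableTypeR R] (fun z => g z.2).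
  move=> mg; exact: (measurableT_comp (mg : measurable_fun [set: measurableTypeR R] g) measurable_snd).
apply: measurable_funM; first exact: (m2 _ (measurable_pwt _ _)).
apply: measurable_funM => //; apply: measurableT_comp => //.
apply: measurable_funM => //; apply: measurable_funM; last exact: (m2 (fun h => h `^ (- 1)) (measurable_powR (- 1))).
exact: (measurableT_comp (@measurable_sqn_sub R d) measurable_fst).
Qed.

Lemma measurable_hk_swap (x : 'rV[R]_d) : measurable_fun [set: V * measurableTypeR R]
  (fun z => hk z.2 x z.1).
Proof.
have m : measurable_fun [set: V * measurableTypeR R]
    (fun z : V * measurableTypeR R => ((x : V), z.1, z.2)).
  apply: measurable_fun_pair; last exact: measurable_snd.
  by apply: measurable_fun_pair => //; exact: measurable_fst.
exact: (measurableT_comp measurable_hk m).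
Qed.

Lemma measurable_hk_time (x y : 'rV[R]_d) : measurable_fun [set: R] (fun h => hk h x y).
Proof. exact: (measurable_fun_pair2 (x : V, y : V) measurable_hk). Qed.

Lemma integral_hk h (x : 'rV[R]_d) : 0 < h -> (\int[L]_y (hk h x y)%:E = 1)%E.
Proof. by move=> h0; rewrite /hk h0; exact: integral_heat. Qed.

Lemma integral_hkM h t (x z : 'rV[R]_d) : 0 < h -> 0 < t ->
  (\int[L]_y (hk h x y * hk t y z)%:E = (hk (h + t) x z)%:E)%E.
Proof. by move=> h0 t0; rewrite /hk h0 t0 addr_gt0//; exact: integral_heatM. Qed.

(** A heat potential with density [h^q] cut off at [eps]. For [eps = 0] and [q = b - 1] it is a
    multiple of [|x - y|^(2b-d)] off the diagonal ([tpot0E]). *)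
Definition tpot q eps (x y : 'rV[R]_d) : \bar R :=
  (\int[mu1]_h (pwt eps q h * hk h x y)%:E)%E.

Lemma tpot_ge0 q eps x y : (0 <= tpot q eps x y)%E.
Proof. by apply: integral_ge0 => h _; rewrite lee_fin mulr_ge0 ?pwt_ge0 ?hk_ge0. Qed.

Lemma tpotC q eps x y : tpot q eps x y = tpot q eps y x.
Proof. by apply: eq_integral => h _; rewrite hkC. Qed.

Lemma measurable_pwt_hk q eps : measurable_fun [set: (V * V) * measurableTypeR R]
  (fun z => (pwt eps q z.2 * hk z.2 z.1.1 z.1.2)%:E).
Proof.
apply/measurable_EFinP; apply: measurable_funM; last exact: measurable_hk.
exact: (measurableT_comp (@measurable_pwt R eps q : measurable_fun [set: measurableTypeR R] _)
  measurable_snd).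
Qed.

Lemma measurable_pwt_hk_time q eps (x y : 'rV[R]_d) : measurable_fun [set: measurableTypeR R]
  (fun h => (pwt eps q h * hk h x y)%:E).
Proof. exact: (measurable_fun_pair2 (x : V, y : V) (measurable_pwt_hk q eps)). Qed.

Lemma measurable_tpot q eps : measurable_fun [set: V * V] (fun z => tpot q eps z.1 z.2).
Proof.
apply: (measurable_fun_fubini_tonelli_F (m2 := mu1) _ (measurable_pwt_hk q eps)).
by move=> z; rewrite lee_fin mulr_ge0 ?pwt_ge0 ?hk_ge0.
Qed.

Lemma measurable_pwt_hk_swap q eps (x : 'rV[R]_d) : measurable_fun [set: V * measurableTypeR R]
  (fun z => (pwt eps q z.2 * hk z.2 x z.1)%:E).
Proof.
apply/measurable_EFinP; apply: measurable_funM; last exact: measurable_hk_swap.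
exact: (measurableT_comp (@measurable_pwt R eps q : measurable_fun [set: measurableTypeR R] _)
  measurable_snd).
Qed.

(** The heat kernel has mass one at each time, so the mass in space is that of the time density. For
    [q = - s - 1] it is finite exactly thanks to the cut-off. *)
Lemma integral_tpot q eps (x : 'rV[R]_d) : 0 < eps ->
  (\int[L]_y tpot q eps x y = \int[mu1]_h (pwt eps q h)%:E)%E.
Proof.
move=> e0.
rewrite /tpot (fubini_tonelli (m1 := L) (m2 := mu1) _ (measurable_pwt_hk_swap q eps x))/=; last first.
  by move=> z; rewrite lee_fin mulr_ge0 ?pwt_ge0 ?hk_ge0.
apply: eq_integral => h _; under eq_integral do rewrite EFinM.
rewrite ge0_integralZl ?lee_fin ?pwt_ge0//; first last.
- by move=> y _; rewrite lee_fin hk_ge0.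
- apply/measurable_EFinP; exact: (measurable_fun_pair1 (h : measurableTypeR R) (measurable_hk_swap x)).
rewrite /pwt; case: ifPn => eh; last by rewrite mul0e.
by rewrite integral_hk ?mule1// (lt_trans e0).
Qed.

Lemma tpot_mono q eps eps' x y : eps' <= eps -> (tpot q eps x y <= tpot q eps' x y)%E.
Proof.
move=> ee; apply: ge0_le_integral => //.
- by move=> h _; rewrite lee_fin mulr_ge0 ?pwt_ge0 ?hk_ge0.
- exact: measurable_pwt_hk_time.
- exact: measurable_pwt_hk_time.
- by move=> h _; rewrite lee_fin ler_wpM2r ?hk_ge0// pwt_mono.
Qed.

End HeatPotentials.

(** * Convolution of heat potentials *)

Section PotentialConvolution.
Variable R : realType.
Variable d : nat.
Notation mu1 := (@lebesgue_measure R).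
Notation L := (leb R d).
Notation V := (rVb R d).
Notation R1 := (measurableTypeR R).
Implicit Types (p q r t u h eps : R).

(** The semigroup law at a fixed first time [h], with the second time shifted so that [t] becomes
    the total time. *)
Lemma tpot_conv_slice q p eps h (x z : 'rV[R]_d) : 0 < eps ->
  (\int[L]_y ((pwt eps q h * hk h x y)%:E * tpot p eps y z) =
   \int[mu1]_t (pwt eps q h * (pwt eps p (t - h) * hk t x z))%:E)%E.
Proof.
move=> e0.
have [eh|he] := ltP eps h; last first.
  rewrite /pwt ltNge he/= !integral0_eq// => t _; first by rewrite mul0r.
  by rewrite mul0r mul0e.
have h0 : 0 < h by exact: lt_trans eh.
have mF : measurable_fun [set: V * R1]
    (fun w => (pwt eps q h * (hk h x w.1 * (pwt eps p w.2 * hk w.2 w.1 z)))%:E).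
  apply/measurable_EFinP; apply: measurable_funM => //; apply: measurable_funM.
    have m1 : measurable_fun [set: V] (fun y => hk h x y).
      exact: (measurable_fun_pair1 (h : R1) (measurable_hk_swap x)).
    exact: (measurableT_comp m1 measurable_fst).
  apply/measurable_EFinP.
  have := measurable_pwt_hk_swap p eps z.
  rewrite [X in measurable_fun _ X -> _](_ : _ = (fun w : V * R1 => (pwt eps p w.2 * hk w.2 w.1 z)%:E))//.
  by apply/funext => w; rewrite hkC.
have F0 w : (0 <= (pwt eps q h * (hk h x w.1 * (pwt eps p w.2 * hk w.2 w.1 z)))%:E)%E.
  by rewrite lee_fin !mulr_ge0 ?pwt_ge0 ?hk_ge0.
transitivity (\int[L]_y \int[mu1]_t (pwt eps q h * (hk h x y * (pwt eps p t * hk t y z)))%:E)%E.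
  apply: eq_integral => y _; rewrite /tpot -ge0_integralZl ?lee_fin ?mulr_ge0 ?pwt_ge0 ?hk_ge0//.
  - by apply: eq_integral => t _; rewrite -EFinM mulrA.
  - exact: measurable_pwt_hk_time.
  - by move=> t _; rewrite lee_fin mulr_ge0 ?pwt_ge0 ?hk_ge0.
rewrite (fubini_tonelli (m1 := L) (m2 := mu1) _ mF F0)/=.
have mg : measurable_fun [set: R1] (fun t => (pwt eps q h * (pwt eps p t * hk (h + t) x z))%:E).
  apply: measurable_EFinT; apply: measurable_funM => //; apply: measurable_funM.
    exact: measurable_pwt.
  have m1 : measurable_fun setT (fun t : R => h + t) by exact: measurable_funD.
  exact: (measurableT_comp (measurable_hk_time x z) m1).
transitivity (\int[mu1]_t (pwt eps q h * (pwt eps p t * hk (h + t) x z))%:E)%E.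
  apply: eq_integral => t _.
  transitivity (\int[L]_y ((pwt eps q h * pwt eps p t)%:E * (hk h x y * hk t y z)%:E))%E.
    by apply: eq_integral => y _; rewrite -EFinM; congr (_%:E); ring.
  have m1 : measurable_fun [set: V] (fun y => hk h x y).
    exact: (measurable_fun_pair1 (h : R1) (measurable_hk_swap x)).
  have m2 : measurable_fun [set: V] (fun y => hk t y z).
    under eq_fun do rewrite hkC.
    exact: (measurable_fun_pair1 (t : R1) (measurable_hk_swap z)).
  have m3 : measurable_fun [set: V] (fun y => (hk h x y * hk t y z)%:E).
    by apply/measurable_EFinP; exact: measurable_funM.
  rewrite ge0_integralZl ?lee_fin ?mulr_ge0 ?pwt_ge0//; last first.
    by move=> y _; rewrite lee_fin mulr_ge0 ?hk_ge0.
  have [et|te] := ltP eps t; last by rewrite /pwt [eps < t]ltNge te/= mulr0 mul0e mul0r mulr0.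
  by rewrite integral_hkM ?(lt_trans e0)// -EFinM mulrA.
rewrite (ge0_integral_affine (- h) ltr01 mg); last first.
  by move=> t; rewrite lee_fin !mulr_ge0 ?pwt_ge0 ?hk_ge0.
rewrite mul1e; apply: eq_integral => t _; rewrite mul1r.
by rewrite (_ : h + (t - h) = t)//; ring.
Qed.

(** Only an inequality, since the cut-off of the second density is dropped to reach [conv_pw]; this
    is the direction a supersolution needs. *)
Lemma tpot_conv q p eps (x z : 'rV[R]_d) : 0 < eps ->
  (\int[L]_y (tpot q eps x y * tpot p eps y z) <=
   \int[mu1]_t ((hk t x z)%:E * conv_pw q p eps t))%E.
Proof.
move=> e0.
have mtp : measurable_fun [set: V] (fun y => tpot p eps y z).
  under eq_fun do rewrite tpotC.
  exact: (measurable_fun_pair2 (z : V) (@measurable_tpot R d p eps)).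
have mF : measurable_fun [set: V * R1]
    (fun w => (pwt eps q w.2 * hk w.2 x w.1)%:E * tpot p eps w.1 z)%E.
  apply: emeasurable_funM; first exact: measurable_pwt_hk_swap.
  exact: (measurableT_comp mtp measurable_fst).
have F0 w : (0 <= (pwt eps q w.2 * hk w.2 x w.1)%:E * tpot p eps w.1 z)%E.
  by rewrite mule_ge0 ?tpot_ge0 ?lee_fin ?mulr_ge0 ?pwt_ge0 ?hk_ge0.
have -> : (\int[L]_y (tpot q eps x y * tpot p eps y z) =
    \int[L]_y \int[mu1]_h ((pwt eps q h * hk h x y)%:E * tpot p eps y z))%E.
  apply: eq_integral => y _; rewrite [in LHS]/tpot -ge0_integralZr ?tpot_ge0//.
  - exact: measurable_pwt_hk_time.
  - by move=> h _; rewrite lee_fin mulr_ge0 ?pwt_ge0 ?hk_ge0.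
rewrite (fubini_tonelli (m1 := L) (m2 := mu1) _ mF F0)/=.
under eq_integral do rewrite tpot_conv_slice//.
have mG : measurable_fun [set: R1 * R1]
    (fun w => (pwt eps q w.1 * (pwt eps p (w.2 - w.1) * hk w.2 x z))%:E).
  apply/measurable_EFinP; apply: measurable_funM.
    exact: (measurableT_comp (@measurable_pwt R eps q : measurable_fun [set: R1] _) measurable_fst).
  apply: measurable_funM; last first.
    exact: (measurableT_comp (measurable_hk_time x z : measurable_fun [set: R1] _) measurable_snd).
  apply: (measurableT_comp (@measurable_pwt R eps p : measurable_fun [set: R1] _)).
  have : measurable_fun [set: R1 * R1] (fun w => (w.2 : R) - (w.1 : R)).
    by apply: measurable_funB; [exact: measurable_snd|exact: measurable_fst].
  exact.
have G0 w : (0 <= (pwt eps q w.1 * (pwt eps p (w.2 - w.1) * hk w.2 x z))%:E)%E.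
  by rewrite lee_fin !mulr_ge0 ?pwt_ge0 ?hk_ge0.
rewrite (fubini_tonelli (m1 := mu1) (m2 := mu1) _ mG G0)/=.
apply: ge0_le_integral => //.
- by move=> t _; apply: integral_ge0 => h _; exact: G0 (h, t).
- exact: (measurable_fun_fubini_tonelli_G (m1 := mu1) _ mG G0).
- apply: emeasurable_funM; last exact: measurable_conv_pw.
  by apply: measurable_EFinT; exact: measurable_hk_time.
move=> t _; rewrite /conv_pw -ge0_integralZl ?lee_fin ?hk_ge0//; first last.
- by move=> h _; rewrite lee_fin pwt2_ge0.
- exact: measurable_pwt2E.
apply: ge0_le_integral => //.
- by move=> h _; exact: G0 (h, t).
- exact: (measurable_fun_pair1 (t : R1) mG).
- by apply: measurable_funeM; exact: measurable_pwt2E.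
move=> h _; rewrite -EFinM lee_fin mulrA mulrC ler_wpM2l ?hk_ge0//.
by rewrite ler_wpM2l ?pwt_ge0// pwt_mono// ltW.
Qed.

End PotentialConvolution.

(** * The truncated ground state is a supersolution *)

Section Supersolution.
Variable R : realType.
Variable d : nat.
Notation mu1 := (@lebesgue_measure R).
Notation L := (leb R d).
Notation V := (rVb R d).
Notation R1 := (measurableTypeR R).
Implicit Types (p q r t u h eps : R).

Lemma ler_powRN p t u : 0 <= p -> 0 < t -> t <= u -> u `^ (- p) <= t `^ (- p).
Proof.
move=> p0 t0 tu; have u0 : 0 < u by exact: lt_le_trans tu.
rewrite !powRN lef_pV2 ?posrE ?powR_gt0//.
by rewrite ge0_ler_powR ?nnegrE ?(ltW t0) ?(ltW u0).
Qed.

(** The heat kernel is at most a multiple of [h^(-d/2)], which makes the density integrable at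
    infinity. The cut-off makes this hold on the diagonal too, so the truncated weight is
    real-valued everywhere. *)
Lemma tpot_fin b eps (x y : 'rV[R]_d) : 0 < eps -> b < d%:R / 2 ->
  (tpot (b - 1) eps x y < +oo)%E.
Proof.
move=> e0 bd; have p0 : 0 < d%:R / 2 - b by rewrite subr_gt0.
pose C : R := (4 * pi) `^ (- (d%:R / 2)).
apply: (@le_lt_trans _ _ (\int[mu1]_t (C%:E * (pwt eps (- (d%:R / 2 - b) - 1) t)%:E))%E).
  apply: ge0_le_integral => //.
  - by move=> t _; rewrite lee_fin mulr_ge0 ?pwt_ge0 ?hk_ge0.
  - exact: measurable_pwt_hk_time.
  - apply: measurable_funeM; apply: measurable_EFinT; exact: measurable_pwt.
  move=> t _; rewrite -EFinM lee_fin hkE /pwt; case: (ltP eps t) => et; last by rewrite mul0r mulr0.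
  have t0 : 0 < t by exact: lt_trans et.
  rewrite t0 mulrA -powRD; last by rewrite (gt_eqF t0) implybT.
  rewrite (_ : b - 1 + - (d%:R / 2) = - (d%:R / 2 - b) - 1); last by ring.
  rewrite mulrC -/C ler_wpM2r ?powR_ge0// ler_piMr ?powR_ge0//.
  rewrite -expR0 ler_expR mulNr oppr_le0 !mulr_ge0 ?sqn_ge0 ?powR_ge0//.
rewrite ge0_integralZl ?lee_fin ?powR_ge0//; first last.
- by move=> t _; rewrite lee_fin pwt_ge0.
- apply: measurable_EFinT; exact: measurable_pwt.
by rewrite integral_pwt// -EFinM ltry.
Qed.

(** The times in [(eps, 2 eps]] alone contribute a positive amount. *)
Lemma tpot_gt0 b eps (x y : 'rV[R]_d) : 0 < eps -> b != 0 ->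
  (0 < tpot (b - 1) eps x y)%E.
Proof.
move=> e0 b0.
pose C : R := (2 * eps) `^ (- (d%:R / 2)) *
  ((4 * pi) `^ (- (d%:R / 2)) * expR (- 4^-1 * (sqn (x - y) * eps `^ (- 1)))).
have C0 : 0 < C.
  by rewrite !mulr_gt0 ?powR_gt0 ?expR_gt0 ?mulr_gt0 ?pi_gt0.
have m1 : measurable_fun [set: R1] (fun t => (pwt eps (b - 1) t * (t <= 2 * eps)%R%:R)%:E).
  apply: measurable_EFinT; apply: measurable_funM;
    [exact: measurable_pwt|exact: measurable_leb].
apply: (@lt_le_trans _ _ (\int[mu1]_t (C%:E * (pwt eps (b - 1) t * (t <= 2 * eps)%R%:R)%:E))%E).
  rewrite ge0_integralZl ?lee_fin ?(ltW C0)//; last first.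
    by move=> t _; rewrite lee_fin mulr_ge0 ?pwt_ge0.
  have ee : 0 < eps <= 2 * eps by rewrite e0 ler_peMl ?(ltW e0)// ler1n.
  rewrite (integral_pwt_oc ee b0) -EFinM lte_fin mulr_gt0//.
  have e2 : eps < 2 * eps by rewrite ltr_pMl ?ltr1n.
  have lt_pow p : 0 < p -> eps `^ p < (2 * eps) `^ p.
    by move=> p0; rewrite gt0_ltr_powR ?nnegrE ?(ltW e0) ?mulr_ge0 ?(ltW e0).
  have [b1|b1] := ltP 0 b.
    by rewrite divr_gt0// subr_gt0 lt_pow.
  have {}b0 : 0 < - b by rewrite oppr_gt0 lt_neqAle b0.
  rewrite -mulrNN -invrN divr_gt0// opprB subr_gt0.
  have := lt_pow _ b0; rewrite !powRN ltf_pV2 ?posrE ?powR_gt0 ?mulr_gt0//.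
apply: ge0_le_integral => //.
- by move=> t _; rewrite -EFinM lee_fin mulr_ge0 ?(ltW C0)// mulr_ge0 ?pwt_ge0.
- exact: measurable_funeM.
- exact: measurable_pwt_hk_time.
move=> t _; rewrite -EFinM lee_fin hkE {1 2}/pwt; case: (ltP eps t) => et; last by rewrite !mul0r mulr0.
have [te|te] := leP t (2 * eps); last first.
  by rewrite !mulr0 !mulr_ge0 ?pwt_ge0 ?powR_ge0 ?expR_ge0.
have t0 : 0 < t by exact: lt_trans et.
rewrite mulr1 [leLHS]mulrC; apply: ler_wpM2l; first exact: powR_ge0.
rewrite /C /pwt t0; apply: ler_pM.
- exact: powR_ge0.
- by rewrite mulr_ge0 ?powR_ge0 ?expR_ge0.
- by apply: ler_powRN => //; rewrite divr_ge0.
rewrite ler_wpM2l ?powR_ge0// ler_expR !mulNr lerN2 ler_wpM2l// ler_wpM2l ?sqn_ge0//.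
by apply: ler_powRN => //; exact: ltW.
Qed.

Section Constants.
Variable s : R.
Hypotheses (s01 : 0 < s < 1) (sd : 2 * s < d%:R).
Notation beta := ((d%:R + 2 * s) / 4).
Let s0 : 0 < s. Proof. by case/andP: s01. Qed.
Let sb : s < beta. Proof. by move: sd; set D := d%:R; lra. Qed.
Let b0 : 0 < beta. Proof. exact: lt_trans sb. Qed.
Let bd : beta < d%:R / 2. Proof. by move: sd; set D := d%:R; lra. Qed.

Variables (nu M : R).
Hypotheses (nu0 : 0 <= nu) (M1 : 1 <= M).
Hypothesis nuM : forall eps t, 0 < eps ->
  (conv_pw (- s - 1) (beta - 1) eps t + (nu * pwt (M * eps) (beta - s - 1) t)%:E <=
   (eps `^ (- s) / s * pwt eps (beta - 1) t)%:E)%E.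

(** All three terms are time integrals against the heat kernel from [x] to [z], and [nuM] compares
    their densities pointwise in [t]. *)
Lemma supersolution eps (x z : 'rV[R]_d) : 0 < eps ->
  (\int[L]_y (tpot (- s - 1) eps x y * tpot (beta - 1) eps y z) +
    nu%:E * tpot (beta - s - 1) (M * eps) x z <=
   (eps `^ (- s) / s)%:E * tpot (beta - 1) eps x z)%E.
Proof.
move=> e0; apply: (le_trans (leeD2r _ (tpot_conv _ _ _ _ e0))).
have mhk : measurable_fun [set: R1] (fun t => (hk t x z)%:E).
  by apply: measurable_EFinT; exact: measurable_hk_time.
rewrite /tpot -!ge0_integralZl ?lee_fin ?divr_ge0 ?powR_ge0 ?(ltW s0)//; first last.
- by move=> t _; rewrite lee_fin mulr_ge0 ?pwt_ge0 ?hk_ge0.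
- exact: measurable_pwt_hk_time.
- by move=> t _; rewrite lee_fin mulr_ge0 ?pwt_ge0 ?hk_ge0.
- exact: measurable_pwt_hk_time.
have m1 : measurable_fun [set: R1] (fun t => (hk t x z)%:E * conv_pw (- s - 1) (beta - 1) eps t)%E.
  by apply: emeasurable_funM => //; exact: measurable_conv_pw.
have m2 : measurable_fun [set: R1]
    (fun t => nu%:E * (pwt (M * eps) (beta - s - 1) t * hk t x z)%:E)%E.
  by apply: measurable_funeM; exact: measurable_pwt_hk_time.
rewrite -ge0_integralD//; first last.
- by move=> t _; rewrite -EFinM lee_fin !mulr_ge0 ?pwt_ge0 ?hk_ge0.
- by move=> t _; rewrite mule_ge0 ?conv_pw_ge0// lee_fin hk_ge0.
apply: ge0_le_integral => //.
- move=> t _; rewrite adde_ge0//; first by rewrite mule_ge0 ?conv_pw_ge0// lee_fin hk_ge0.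
  by rewrite -EFinM lee_fin !mulr_ge0 ?pwt_ge0 ?hk_ge0.
- exact: emeasurable_funD.
- by apply: measurable_funeM; exact: measurable_pwt_hk_time.
move=> t _.
have -> : (nu%:E * (pwt (M * eps) (beta - s - 1) t * hk t x z)%:E =
    (hk t x z)%:E * (nu * pwt (M * eps) (beta - s - 1) t)%:E)%E.
  by rewrite -!EFinM; congr (_%:E); ring.
rewrite -ge0_muleDr ?conv_pw_ge0 ?lee_fin ?mulr_ge0 ?pwt_ge0//.
rewrite (_ : _%:E * (_ * hk t x z)%:E =
  (hk t x z)%:E * (eps `^ (- s) / s * pwt eps (beta - 1) t)%:E)%E; last first.
  by rewrite -!EFinM; congr (_%:E); ring.
by apply: lee_wpmul2l; [rewrite lee_fin hk_ge0|exact: nuM].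
Qed.

End Constants.

End Supersolution.

(** * The sharp fractional Hardy inequality *)

Section TruncatedHardy.
Variable R : realType.
Variable d : nat.
Notation L := (leb R d).
Notation V := (rVb R d).
Notation P := (leb R d \x leb R d)%E.
Implicit Types (g w : V -> R).

(** The difference of the two sides is the square [(a v - b u)^2 / (2 u v)]. *)
Lemma picone (a b u v : R) : 0 < u -> 0 < v ->
  a ^+ 2 / 2 + b ^+ 2 / 2 <= (a - b) ^+ 2 / 2 + (a ^+ 2 / u * v / 2 + b ^+ 2 / v * u / 2).
Proof.
move=> u0 v0; rewrite -subr_ge0.
rewrite [X in 0 <= X](_ : _ = (a * v - b * u) ^+ 2 / (2 * u * v)).
  by rewrite divr_ge0 ?sqr_ge0// !mulr_ge0// ltW.
by field; rewrite !gt_eqF.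
Qed.

Section SymmetricKernel.
Variable K : V -> V -> \bar R.
Hypotheses (K0 : forall x y, (0 <= K x y)%E) (KC : forall x y, K x y = K y x).
Hypothesis mK : measurable_fun [set: V * V] (fun z => K z.1 z.2).

Lemma measurable_fstK g : measurable_fun setT g ->
  measurable_fun [set: V * V] (fun z => (g z.1)%:E * K z.1 z.2)%E.
Proof.
move=> mg; apply: emeasurable_funM => //; apply/measurable_EFinP.
exact: (measurableT_comp mg measurable_fst).
Qed.

Lemma integral_fstK g : measurable_fun setT g -> (forall x, 0 <= g x) ->
  (\int[P]_z ((g z.1)%:E * K z.1 z.2) = \int[L]_x ((g x)%:E * \int[L]_y K x y))%E.
Proof.
move=> mg g0; rewrite fubini_tonelli1; first last.
- by move=> z; rewrite mule_ge0 ?lee_fin.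
- exact: measurable_fstK.
apply: eq_integral => x _; rewrite /fubini_F/= ge0_integralZl ?lee_fin//.
exact: (measurable_fun_pair2 x mK).
Qed.

Lemma integral_sndK g : measurable_fun setT g -> (forall x, 0 <= g x) ->
  (\int[P]_z ((g z.2)%:E * K z.1 z.2) = \int[L]_x ((g x)%:E * \int[L]_y K x y))%E.
Proof.
move=> mg g0; rewrite fubini_tonelli2; first last.
- by move=> z; rewrite mule_ge0 ?lee_fin.
- apply: emeasurable_funM => //; apply/measurable_EFinP.
  exact: (measurableT_comp mg measurable_snd).
apply: eq_integral => y _; rewrite /fubini_G/=.
rewrite ge0_integralZl ?lee_fin//; last exact: (measurable_fun_pair1 y mK).
by congr (_ * _)%E; apply: eq_integral => x _; rewrite KC.
Qed.

(* The ground state substitution: [2 f x f y <= f x ^ 2 w y / w x + f y ^ 2 w x / w y]. *)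
Lemma ground_state (f : V -> R) w (kap : R) (D : V -> \bar R) :
  measurable_fun setT f -> (forall x, 0 <= f x) ->
  (\int[L]_x (f x ^+ 2)%:E < +oo)%E ->
  measurable_fun setT w -> (forall x, 0 < w x) -> 0 <= kap ->
  measurable_fun setT D -> (forall x, 0 <= D x)%E ->
  (forall x, \int[L]_y K x y = kap%:E)%E ->
  (forall x, \int[L]_y (K x y * (w y)%:E) + D x <= kap%:E * (w x)%:E)%E ->
  (\int[L]_x ((f x ^+ 2 / w x)%:E * D x) <=
   \int[P]_z (((f z.1 - f z.2) ^+ 2 / 2)%:E * K z.1 z.2))%E.
Proof.
move=> mf f0 f2oo mw w0 kap0 mD D0 Kkap super.
have mf2 : measurable_fun setT (fun x => f x ^+ 2) by exact: measurable_funX.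
have mfw : measurable_fun setT (fun x => f x ^+ 2 / w x).
  have mwV : measurable_fun setT (fun x => w x `^ (- 1)).
    exact: (measurableT_comp (measurable_powR (- 1)) mw).
  rewrite (_ : (fun x => f x ^+ 2 / w x) = fun x => f x ^+ 2 * w x `^ (- 1)).
    exact: measurable_funM.
  by apply/funext => x; rewrite powR_inv1// ltW.
have fw0 x : 0 <= f x ^+ 2 / w x by rewrite divr_ge0 ?sqr_ge0// ltW.
pose S x := (\int[L]_y (K x y * (w y)%:E))%E.
have mKw : measurable_fun [set: V * V] (fun z => K z.1 z.2 * (w z.2)%:E)%E.
  apply: emeasurable_funM => //; apply/measurable_EFinP.
  exact: (measurableT_comp mw measurable_snd).
have Kw0 z : (0 <= K z.1 z.2 * (w z.2)%:E)%E by rewrite mule_ge0// lee_fin ltW.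
have mS : measurable_fun setT S by exact: (measurable_fun_fubini_tonelli_F (m2 := L) _ mKw Kw0).
have S0 x : (0 <= S x)%E by apply: integral_ge0 => y _; exact: Kw0 (x, y).
(* The cross term. By symmetry of [K] it can be read with either variable carrying [f^2 / w], and
   half of each reading matches the right side of [picone]. *)
pose X := (\int[L]_x ((f x ^+ 2 / w x)%:E * S x))%E.
have XE : (X = \int[P]_z ((f z.1 ^+ 2 / w z.1 * w z.2)%:E * K z.1 z.2))%E.
  rewrite fubini_tonelli1; first last.
  - by move=> z; rewrite mule_ge0// lee_fin mulr_ge0// ltW.
  - apply: emeasurable_funM => //; apply/measurable_EFinP; apply: measurable_funM.
      exact: (measurableT_comp mfw measurable_fst).
    exact: (measurableT_comp mw measurable_snd).
  apply: eq_integral => x _; rewrite /fubini_F/= -ge0_integralZl//.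
  - by apply: eq_integral => y _; rewrite [(K x y * _)%E]muleC muleA -EFinM.
  - exact: (measurable_fun_pair2 x mKw).
  - by move=> y _; exact: Kw0 (x, y).
  - by rewrite lee_fin.
have XE' : (X = \int[P]_z ((f z.2 ^+ 2 / w z.2 * w z.1)%:E * K z.1 z.2))%E.
  rewrite XE fubini_tonelli1; first last.
  - by move=> z; rewrite mule_ge0// lee_fin mulr_ge0// ltW.
  - apply: emeasurable_funM => //; apply/measurable_EFinP; apply: measurable_funM.
      exact: (measurableT_comp mfw measurable_fst).
    exact: (measurableT_comp mw measurable_snd).
  rewrite fubini_tonelli2; first last.
  - by move=> z; rewrite mule_ge0// lee_fin mulr_ge0// ltW.
  - apply: emeasurable_funM => //; apply/measurable_EFinP; apply: measurable_funM.
      exact: (measurableT_comp mfw measurable_snd).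
    exact: (measurableT_comp mw measurable_fst).
  by apply: eq_integral => x _; apply: eq_integral => y _/=; rewrite KC.
pose E := (\int[P]_z (((f z.1 - f z.2) ^+ 2 / 2)%:E * K z.1 z.2))%E.
pose F2 := (\int[L]_x (f x ^+ 2)%:E)%E.
have le1 : (kap%:E * F2 <= E + X)%E.
  rewrite [E + X](_ : _ = E + (2^-1%:E * X + 2^-1%:E * X))%E; last first.
    rewrite -ge0_muleDl ?lee_fin ?invr_ge0// -EFinD -mulr2n -[_ *+ 2]mulr_natl.
    by rewrite divff// mul1e.
  have mh (c : V * V -> R) : measurable_fun setT c ->
      measurable_fun [set: V * V] (fun z => (c z)%:E * K z.1 z.2)%E.
    by move=> mc; apply: emeasurable_funM => //; exact/measurable_EFinP.
  have m1 (u : V -> R) : measurable_fun setT u -> measurable_fun [set: V * V] (fun z => u z.1).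
    by move=> mu; exact: (measurableT_comp mu measurable_fst).
  have m2 (u : V -> R) : measurable_fun setT u -> measurable_fun [set: V * V] (fun z => u z.2).
    by move=> mu; exact: (measurableT_comp mu measurable_snd).
  have X2 : (2^-1%:E * X = \int[P]_z ((f z.1 ^+ 2 / w z.1 * w z.2 / 2)%:E * K z.1 z.2))%E.
    rewrite XE -ge0_integralZl ?lee_fin ?invr_ge0//.
    - by apply: eq_integral => z _; rewrite muleA -EFinM; congr (_%:E * _)%E; rewrite mulrC.
    - by apply: mh; apply: measurable_funM; [exact: m1 mfw|exact: m2].
    - by move=> z _; rewrite mule_ge0// lee_fin mulr_ge0// ltW.
  have X2' : (2^-1%:E * X = \int[P]_z ((f z.2 ^+ 2 / w z.2 * w z.1 / 2)%:E * K z.1 z.2))%E.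
    rewrite XE' -ge0_integralZl ?lee_fin ?invr_ge0//.
    - by apply: eq_integral => z _; rewrite muleA -EFinM; congr (_%:E * _)%E; rewrite mulrC.
    - by apply: mh; apply: measurable_funM; [exact: m2 mfw|exact: m1].
    - by move=> z _; rewrite mule_ge0// lee_fin mulr_ge0// ltW.
  rewrite {1}X2 X2' {X2 X2' XE XE'}.
  have mE : measurable_fun [set: V * V] (fun z => ((f z.1 - f z.2) ^+ 2 / 2)%:E * K z.1 z.2)%E.
    apply: mh; apply: measurable_funM => //; apply: measurable_funX.
    by apply: measurable_funB; [exact: m1|exact: m2].
  have mX : measurable_fun [set: V * V] (fun z => (f z.1 ^+ 2 / w z.1 * w z.2 / 2)%:E * K z.1 z.2)%E.
    by apply: mh; apply: measurable_funM => //; apply: measurable_funM; [exact: m1 mfw|exact: m2].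
  have mX' : measurable_fun [set: V * V] (fun z => (f z.2 ^+ 2 / w z.2 * w z.1 / 2)%:E * K z.1 z.2)%E.
    by apply: mh; apply: measurable_funM => //; apply: measurable_funM; [exact: m2 mfw|exact: m1].
  have E0 z : (0 <= ((f z.1 - f z.2) ^+ 2 / 2)%:E * K z.1 z.2)%E.
    by rewrite mule_ge0// lee_fin divr_ge0 ?sqr_ge0.
  have X0 z : (0 <= (f z.1 ^+ 2 / w z.1 * w z.2 / 2)%:E * K z.1 z.2)%E.
    by rewrite mule_ge0// lee_fin divr_ge0// mulr_ge0// ltW.
  have X0' z : (0 <= (f z.2 ^+ 2 / w z.2 * w z.1 / 2)%:E * K z.1 z.2)%E.
    by rewrite mule_ge0// lee_fin divr_ge0// mulr_ge0// ltW.
  have mXX : measurable_fun [set: V * V] (fun z =>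
      (f z.1 ^+ 2 / w z.1 * w z.2 / 2)%:E * K z.1 z.2 +
      (f z.2 ^+ 2 / w z.2 * w z.1 / 2)%:E * K z.1 z.2)%E by exact: emeasurable_funD.
  rewrite -ge0_integralD//.
  rewrite -ge0_integralD//; last by move=> z _; rewrite adde_ge0.
  have -> : (kap%:E * F2 = \int[P]_z ((f z.1 ^+ 2 / 2)%:E * K z.1 z.2 +
      (f z.2 ^+ 2 / 2)%:E * K z.1 z.2))%E.
    have mf22 : measurable_fun setT (fun x => f x ^+ 2 / 2) by exact: measurable_funM.
    have f22 x : 0 <= f x ^+ 2 / 2 by rewrite divr_ge0 ?sqr_ge0.
    rewrite ge0_integralD//; first last.
    - exact: mh (m2 _ mf22).
    - by move=> z _; rewrite mule_ge0// lee_fin.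
    - exact: mh (m1 _ mf22).
    - by move=> z _; rewrite mule_ge0// lee_fin.
    rewrite (integral_fstK mf22)// (integral_sndK mf22)//.
    under eq_integral do rewrite Kkap.
    rewrite ge0_integralZr ?lee_fin//; first last.
    - by move=> x _; rewrite lee_fin.
    - exact/measurable_EFinP.
    rewrite -ge0_muleDl ?integral_ge0// => [|x _|x _]; rewrite ?lee_fin//.
    rewrite -ge0_integralD//; first last.
    - exact/measurable_EFinP.
    - by move=> x _; rewrite lee_fin.
    - exact/measurable_EFinP.
    - by move=> x _; rewrite lee_fin.
    rewrite muleC; congr (_ * _)%E; apply: eq_integral => x _.
    by rewrite -EFinD; congr (_%:E); field.
  apply: ge0_le_integral => //.
  - by move=> z _; rewrite adde_ge0// mule_ge0// lee_fin divr_ge0 ?sqr_ge0.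
  - apply: emeasurable_funD; apply: mh; apply: measurable_funM => //.
      exact: m1 mf2.
    exact: m2 mf2.
  - exact: emeasurable_funD.
  move=> z _.
  rewrite -!ge0_muleDl ?lee_fin ?divr_ge0 ?addr_ge0 ?sqr_ge0 ?mulr_ge0 ?invr_ge0 ?(ltW (w0 _))//.
  apply: lee_wpmul2r => //; rewrite -!EFinD lee_fin.
  exact: picone.
have le2 : (X + \int[L]_x ((f x ^+ 2 / w x)%:E * D x) <= kap%:E * F2)%E.
  rewrite -ge0_integralD//; first last.
  - by apply: emeasurable_funM => //; exact/measurable_EFinP.
  - by move=> x _; rewrite mule_ge0// lee_fin.
  - by apply: emeasurable_funM => //; exact/measurable_EFinP.
  - by move=> x _; rewrite mule_ge0// lee_fin.
  rewrite -ge0_integralZl//; first last.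
  - by move=> x _; rewrite lee_fin sqr_ge0.
  - exact/measurable_EFinP.
  apply: ge0_le_integral => //.
  - by move=> x _; rewrite adde_ge0// mule_ge0// lee_fin.
  - apply: emeasurable_funD; apply: emeasurable_funM => //; exact/measurable_EFinP.
  - by apply: measurable_funeM; exact/measurable_EFinP.
  move=> x _; rewrite -ge0_muleDr//.
  have fx : (0 <= (f x ^+ 2 / w x)%:E)%E by rewrite lee_fin.
  apply: (le_trans (lee_wpmul2l fx (super x))).
  rewrite -!EFinM lee_fin le_eqVlt; apply/orP; left; apply/eqP; field.
  by rewrite gt_eqF.
(* The two bounds read [kap F2 <= E + X] and [X + G <= kap F2]. Cancelling [X] requires [kap F2] to
   be finite, which uses [f] in [L^2] and the finite mass of the kernel. *)
have F2fin : (kap%:E * F2)%E \is a fin_num.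
  rewrite fin_numM// ge0_fin_numE//; apply: integral_ge0 => x _.
  by rewrite lee_fin sqr_ge0.
move: le1 le2 F2fin; set G := integral _ _ _.
have X0 : (0 <= X)%E by apply: integral_ge0 => x _; rewrite mule_ge0// lee_fin.
have G0 : (0 <= G)%E by apply: integral_ge0 => x _; rewrite mule_ge0// lee_fin.
have E0 : (0 <= E)%E.
  by apply: integral_ge0 => z _; rewrite mule_ge0// lee_fin divr_ge0 ?sqr_ge0.
rewrite -/E; move: X0 G0 E0; clear XE XE'; clearbody X G E.
move: (kap%:E * F2)%E => c; case: c => [c| |]//.
case: X => [a| |]//; case: G => [b| |]//; case: E => [e| |]//.
  rewrite -!EFinD !lee_fin => _ _ _ l1 l2 _.
  by rewrite -(lerD2r a) (le_trans _ l1)// addrC.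
by move=> *; rewrite leey.
Qed.

End SymmetricKernel.
End TruncatedHardy.

Section FractionalHardy.
Variable R : realType.
Variable d : nat.
Notation mu1 := (@lebesgue_measure R).
Notation L := (leb R d).
Notation V := (rVb R d).
Notation R1 := (measurableTypeR R).
Notation P := (leb R d \x leb R d)%E.
Implicit Types (p q r t u h eps b : R).

Lemma monotone_limit_le d' (T : measurableType d') (mu : {measure set T -> \bar R})
  (g : (T -> \bar R)^nat) (l : \bar R) :
  (forall n, measurable_fun setT (g n)) -> (forall n x, 0 <= g n x)%E ->
  (forall x, {homo g^~ x : n m / (n <= m)%N >-> (n <= m)%E}) ->
  (forall n, \int[mu]_x g n x <= l)%E ->
  (\int[mu]_x limn (g^~ x) <= l)%E.
Proof.
move=> mg g0 ndg gl; rewrite monotone_convergence//.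
apply: lime_le; last by apply: nearW => n; exact: gl.
apply: ereal_nondecreasing_is_cvgn => m n mn; apply: ge0_le_integral => //.
by move=> x _; exact: ndg.
Qed.

Lemma tpot_lim q (x y : 'rV[R]_d) :
  (tpot q (n.+1%:R^-1) x y)%E @[n --> \oo] --> tpot q 0 x y.
Proof.
pose f n t := (pwt (n.+1%:R^-1) q t * hk t x y)%:E.
have fE t : (pwt 0 q t * hk t x y)%:E = limn (f ^~ t).
  apply/esym/cvg_lim => //; apply: cvg_EFin; first exact: nearW.
  by apply: cvgM; [exact: pwt_cvg|exact: cvg_cst].
rewrite {2}/tpot; under [X in _ --> X]eq_integral do rewrite fE.
apply: cvg_monotone_convergence => //.
- by move=> n; exact: measurable_pwt_hk_time.
- by move=> n t _; rewrite lee_fin mulr_ge0 ?pwt_ge0 ?hk_ge0.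
- move=> t _ m n mn; rewrite lee_fin ler_wpM2r ?hk_ge0// pwt_mono//.
  by rewrite lef_pV2 ?posrE// ler_nat.
Qed.

Definition heat_const b : R := 4 `^ (- b) * pi `^ (- (d%:R / 2)) * Gamma (d%:R / 2 - b).

Lemma heat_const_gt0 b : b < d%:R / 2 -> 0 < heat_const b.
Proof.
move=> bd; have pi0 := pi_gt0 R.
by rewrite !mulr_gt0 ?powR_gt0 ?Gamma_gt0 ?subr_gt0.
Qed.

Lemma tpot0E b (x y : 'rV[R]_d) : b < d%:R / 2 -> x != y ->
  tpot (b - 1) 0 x y = (heat_const b * enorm (x - y) `^ (2 * b - d%:R))%:E.
Proof.
move=> bd xy; rewrite -integral_heat_time//; apply: eq_integral => t _.
by rewrite /hk /pwt; case: ifP => // _; rewrite !mul0r.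
Qed.

Lemma enorm0 : enorm (0 : 'rV[R]_d) = 0.
Proof. by rewrite /enorm big1 ?sqrtr0// => i _; rewrite mxE expr0n. Qed.

Lemma enorm_gt0 (x : 'rV[R]_d) : x != 0 -> 0 < enorm x.
Proof.
move=> x0; rewrite sqrtr_gt0 lt_neqAle sqn_ge0 andbT eq_sym.
by apply: contra x0 => /eqP/sqn_eq0/eqP.
Qed.

Section Inequality.
Variable s : R.
Hypotheses (s01 : 0 < s < 1) (sd : 2 * s < d%:R).
Notation beta := ((d%:R + 2 * s) / 4).
Let s0 : 0 < s. Proof. by case/andP: s01. Qed.
Let sb : s < beta. Proof. by move: sd; set D := d%:R; lra. Qed.
Let b0 : 0 < beta. Proof. exact: lt_trans sb. Qed.
Let bd : beta < d%:R / 2. Proof. by move: sd; set D := d%:R; lra. Qed.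
Let bsd : beta - s < d%:R / 2. Proof. by move: sd s0; set D := d%:R; lra. Qed.
Let Nsd : - s < d%:R / 2.
Proof. by rewrite (@lt_trans _ _ 0) ?oppr_lt0// (lt_trans b0). Qed.

Let Nbd : 2 * beta - d%:R < 0.
Proof. by move: sd; set D := d%:R; lra. Qed.

(** [ground_state] is applied with the potentials cut off at [eps]. On the right the truncated
    kernel is below the full one; on the left the truncated weight, in the denominator, is replaced
    by the larger [W0], and the cut-off of the remaining potential is removed by monotone
    convergence. *)
Lemma hardy_heat (nu : R) (f : V -> R) :
  0 <= nu -> nu * Gamma (beta - s) < Gamma beta * Gamma (1 - s) / s ->
  measurable_fun setT f -> (forall x, 0 <= f x) ->
  (\int[L]_x (f x ^+ 2)%:E < +oo)%E ->
  ((nu * heat_const (beta - s) / heat_const beta)%:E *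
     \int[L]_x (f x ^+ 2 * enorm (x : 'rV[R]_d) `^ (- (2 * s)))%:E <=
   (heat_const (- s) / 2)%:E * \int[P]_z ((f z.1 - f z.2) ^+ 2 * kern s z.1 z.2)%:E)%E.
Proof.
move=> nu0 nuC mf f0 f2.
have [M M1 HM] := frac_const s01 sb nu0 nuC.
have M0 : 0 < M by exact: lt_le_trans M1.
have mf2 : measurable_fun setT (fun x => f x ^+ 2) by exact: measurable_funX.
have Cw0 := heat_const_gt0 bd.
have men p : measurable_fun [set: V] (fun x : 'rV[R]_d => enorm x `^ p).
  under eq_fun do rewrite enorm_powR.
  exact: (measurableT_comp (measurable_powR (p / 2)) (@measurable_sqn R d)).
have mkern : measurable_fun [set: V * V] (fun z => kern s (z.1 : 'rV[R]_d) z.2).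
  rewrite /kern; under eq_fun do rewrite enorm_powR.
  exact: (measurableT_comp (measurable_powR _) (@measurable_sqn_sub R d)).
have kern0 x y : 0 <= kern s (x : 'rV[R]_d) y by exact: powR_ge0.
pose W0 (x : 'rV[R]_d) := heat_const beta * enorm x `^ (2 * beta - d%:R).
pose E := ((heat_const (- s) / 2)%:E * \int[P]_z ((f z.1 - f z.2) ^+ 2 * kern s z.1 z.2)%:E)%E.
pose g n (x : V) := ((f x ^+ 2 / W0 x)%:E * (nu%:E * tpot (beta - s - 1) (n.+1%:R^-1) x 0))%E.
have gE n : (\int[L]_x g n x <= E)%E.
  (* Chosen so that [M * eps = 1/(n+1)], which makes the source term increase with [n]. *)
  pose eps : R := n.+1%:R^-1 / M.
  have e0 : 0 < eps by rewrite divr_gt0 ?invr_gt0.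
  pose w (x : V) := fine (tpot (beta - 1) eps x 0).
  have wE x : tpot (beta - 1) eps x 0 = (w x)%:E.
    by rewrite fineK// ge0_fin_numE ?tpot_ge0// tpot_fin.
  have w0 x : 0 < w x by rewrite -lte_fin -wE tpot_gt0// gt_eqF.
  have mw : measurable_fun setT w.
    apply/measurable_EFinP; rewrite (_ : EFin \o w = fun x => tpot (beta - 1) eps x 0).
      exact: (measurable_fun_pair1 (0 : V) (@measurable_tpot R d (beta - 1) eps)).
    by apply/funext => x /=; rewrite wE.
  pose D (x : V) := (nu%:E * tpot (beta - s - 1) (M * eps) x 0)%E.
  have mD : measurable_fun setT D.
    apply: measurable_funeM.
    exact: (measurable_fun_pair1 (0 : V) (@measurable_tpot R d _ _)).
  have D0 x : (0 <= D x)%E by rewrite mule_ge0 ?tpot_ge0 ?lee_fin.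
  have kap0 : 0 <= eps `^ (- s) / s by rewrite divr_ge0 ?powR_ge0// ltW.
  have Kkap x : (\int[L]_y tpot (- s - 1) eps x y = (eps `^ (- s) / s)%:E)%E.
    by rewrite integral_tpot// integral_pwt.
  have super x : (\int[L]_y (tpot (- s - 1) eps x y * (w y)%:E) + D x <=
      (eps `^ (- s) / s)%:E * (w x)%:E)%E.
    have -> : (\int[L]_y (tpot (- s - 1) eps x y * (w y)%:E) =
        \int[L]_y (tpot (- s - 1) eps x y * tpot (beta - 1) eps y 0))%E.
      by apply: eq_integral => y _; rewrite wE.
    by rewrite -wE; exact: (supersolution s01 nu0 HM x 0 e0).
  have H := ground_state (fun x y => tpot_ge0 (- s - 1) eps x y)
    (fun x y => tpotC (- s - 1) eps x y) (@measurable_tpot R d (- s - 1) eps)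
    mf f0 f2 mw w0 kap0 mD D0 Kkap super.
  have W0ge x : x != 0 -> w x <= W0 x.
    move=> x0; rewrite -lee_fin -wE /W0.
    apply: (le_trans (tpot_mono _ _ _ (ltW e0))).
    by rewrite (tpot0E bd x0) subr0.
  have mW0 : measurable_fun setT (fun x => f x ^+ 2 / W0 x).
    rewrite (_ : (fun x => _) =
        fun x => f x ^+ 2 * (heat_const beta)^-1 * enorm (x : 'rV[R]_d) `^ (- (2 * beta - d%:R))).
      by apply: measurable_funM => //; exact: measurable_funM.
    by apply/funext => x; rewrite /W0 powRN invfM -[RHS]mulrA.
  apply: le_trans (le_trans H _).
    apply: ge0_le_integral => //.
    - move=> x _; rewrite mule_ge0 ?mule_ge0 ?tpot_ge0 ?lee_fin// divr_ge0 ?sqr_ge0//.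
      by rewrite mulr_ge0 ?powR_ge0// ltW.
    - apply: emeasurable_funM; first exact/measurable_EFinP.
      apply: measurable_funeM.
      exact: (measurable_fun_pair1 (0 : V) (@measurable_tpot R d _ _)).
    - apply: emeasurable_funM => //; apply/measurable_EFinP.
      rewrite (_ : (fun x => _) = fun x => f x ^+ 2 * w x `^ (- 1)).
        by apply: measurable_funM => //; exact: (measurableT_comp (measurable_powR (- 1)) mw).
      by apply/funext => x; rewrite powR_inv1// ltW.
    move=> x _; rewrite /g /D /eps mulrCA divff ?gt_eqF// mulr1.
    apply: lee_wpmul2r; first by rewrite mule_ge0 ?tpot_ge0 ?lee_fin.
    rewrite lee_fin ler_wpM2l ?sqr_ge0//.
    (* At the origin the true weight is infinite but [W0 0 = 0] by the convention for powers of
       zero; as [0^-1 = 0] the left side vanishes there. *)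
    have [->|x0] := eqVneq x 0; last by rewrite lef_pV2 ?posrE ?W0ge ?(lt_le_trans (w0 x) (W0ge x x0)).
    rewrite /W0 (_ : enorm 0 = 0) ?powR0 ?mulr0 ?invr0 ?invr_ge0 ?(ltW (w0 0))//.
      by rewrite lt_eqF// Nbd.
    exact: enorm0.
  rewrite /E -ge0_integralZl ?lee_fin ?divr_ge0 ?(ltW (heat_const_gt0 Nsd))//; first last.
  - by move=> z _; rewrite lee_fin mulr_ge0 ?sqr_ge0.
  - apply/measurable_EFinP; apply: measurable_funM => //; apply: measurable_funX.
    apply: measurable_funB.
      exact: (measurableT_comp mf measurable_fst).
    exact: (measurableT_comp mf measurable_snd).
  apply: ge0_le_integral => //.
  - by move=> z _; rewrite mule_ge0 ?tpot_ge0// lee_fin divr_ge0 ?sqr_ge0.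
  - apply: emeasurable_funM; last exact: measurable_tpot.
    apply/measurable_EFinP; apply: measurable_funM => //; apply: measurable_funX.
    apply: measurable_funB.
      exact: (measurableT_comp mf measurable_fst).
    exact: (measurableT_comp mf measurable_snd).
  - apply: measurable_funeM; apply/measurable_EFinP.
    apply: measurable_funM => //; apply: measurable_funX.
    apply: measurable_funB.
      exact: (measurableT_comp mf measurable_fst).
    exact: (measurableT_comp mf measurable_snd).
  case=> x y _ /=; have [->|xy] := eqVneq x y.
    by rewrite subrr expr0n/= !mul0r mul0e mule0.
  have := tpot_mono (- s - 1) x y (ltW e0); rewrite (tpot0E Nsd xy) => le1.
  apply: (le_trans (lee_wpmul2l _ le1)); first by rewrite lee_fin divr_ge0 ?sqr_ge0.
  rewrite -!EFinM lee_fin /kern (_ : 2 * - s - d%:R = - (d%:R + 2 * s)); last by ring.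
  by rewrite le_eqVlt; apply/orP; left; apply/eqP; ring.
have gpos n x : (0 <= g n x)%E.
  rewrite mule_ge0 ?mule_ge0 ?tpot_ge0 ?lee_fin// divr_ge0 ?sqr_ge0//.
  by rewrite mulr_ge0 ?powR_ge0// ltW.
have gmono x : {homo g^~ x : n m / (n <= m)%N >-> (n <= m)%E}.
  move=> m n mn; rewrite /g; apply: lee_wpmul2l.
    by rewrite lee_fin divr_ge0 ?sqr_ge0// mulr_ge0 ?powR_ge0// ltW.
  apply: lee_wpmul2l; rewrite ?lee_fin//; apply: tpot_mono.
  by rewrite lef_pV2 ?posrE// ler_nat.
have mW0 : measurable_fun setT (fun x => f x ^+ 2 / W0 x).
  rewrite (_ : (fun x => _) =
      fun x => f x ^+ 2 * (heat_const beta)^-1 * enorm (x : 'rV[R]_d) `^ (- (2 * beta - d%:R))).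
    by apply: measurable_funM => //; exact: measurable_funM.
  by apply/funext => x; rewrite /W0 powRN invfM -[RHS]mulrA.
have mg n : measurable_fun setT (g n).
  apply: emeasurable_funM; first exact/measurable_EFinP.
  apply: measurable_funeM.
  exact: (measurable_fun_pair1 (0 : V) (@measurable_tpot R d _ _)).
have := monotone_limit_le mg gpos gmono gE; apply: le_trans.
have cc0 : 0 <= nu * heat_const (beta - s) / heat_const beta.
  exact: divr_ge0 (mulr_ge0 nu0 (ltW (heat_const_gt0 bsd))) (ltW Cw0).
rewrite -ge0_integralZl ?lee_fin//; first last.
- by move=> x _; rewrite lee_fin mulr_ge0 ?sqr_ge0 ?powR_ge0.
- by apply/measurable_EFinP; exact: measurable_funM.
apply: ge0_le_integral => //.
- by move=> x _; rewrite -EFinM lee_fin; apply: mulr_ge0 => //; rewrite mulr_ge0 ?sqr_ge0 ?powR_ge0.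
- by apply: measurable_funeM; apply/measurable_EFinP; exact: measurable_funM.
- apply: (emeasurable_fun_cvg g) => // x _.
  by apply: ereal_nondecreasing_is_cvgn => m n mn; exact: gmono.
(* At the origin the Hardy weight is [0] by the convention for powers of zero, so the bound is
   trivial. *)
move=> x _; have [->|x0] := eqVneq x 0.
  rewrite (_ : enorm 0 = 0) ?powR0 ?mulr0 ?mule0; first last.
  - exact: enorm0.
  - by rewrite oppr_eq0 mulf_neq0// gt_eqF.
  apply: lime_ge; last by apply: nearW => n; exact: gpos.
  by apply: ereal_nondecreasing_is_cvgn => m n mn; exact: gmono.
have cg : (g n x @[n --> \oo] -->
   (f x ^+ 2 / W0 x)%:E * (nu%:E * tpot (beta - s - 1) 0 x 0))%E.
  by apply: cvgeZl => //; apply: cvgeZl => //; exact: tpot_lim.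
rewrite (cvg_lim _ cg)// (tpot0E bsd x0) subr0 -!EFinM lee_fin /W0 le_eqVlt; apply/orP; left; apply/eqP.
set e := enorm _.
have e0 : 0 < e by rewrite enorm_gt0.
rewrite [in RHS]invfM -[(e `^ _)^-1]powRN.
rewrite (_ : - (2 * s) = - (2 * beta - d%:R) + (2 * (beta - s) - d%:R)); last by ring.
rewrite powRD; last by rewrite (gt_eqF e0) implybT.
by field; rewrite gt_eqF.
Qed.

End Inequality.
End FractionalHardy.

(** * Identification of the constants with [ads] and [LambdaH] *)

Section HardyConstant.
Variable R : realType.
Variable d : nat.
Notation L := (leb R d).
Notation V := (rVb R d).
Notation P := (leb R d \x leb R d)%E.

Lemma measurable_enorm_powR p : measurable_fun [set: V] (fun x : 'rV[R]_d => enorm x `^ p).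
Proof.
under eq_fun do rewrite enorm_powR.
exact: (measurableT_comp (measurable_powR (p / 2)) (@measurable_sqn R d)).
Qed.

Lemma measurable_kern (s : R) :
  measurable_fun [set: V * V] (fun z => kern s (z.1 : 'rV[R]_d) z.2).
Proof.
rewrite /kern; under eq_fun do rewrite enorm_powR.
exact: (measurableT_comp (measurable_powR _) (@measurable_sqn_sub R d)).
Qed.

Lemma kern_ge0 (s : R) (x y : 'rV[R]_d) : 0 <= kern s x y.
Proof. exact: powR_ge0. Qed.

Lemma powR4 (p : R) : 4 `^ p = 2 `^ (2 * p).
Proof.
rewrite powRrM (_ : 2 `^ 2 = 4 :> R)//.
by rewrite -[X in 2 `^ X]/(2%:R) powR_mulrn// expr2 -natrM.
Qed.

Section Constants.
Variable s : R.
Hypotheses (s01 : 0 < s < 1) (sd : 2 * s < d%:R).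
Notation beta := ((d%:R + 2 * s) / 4).
Let s0 : 0 < s. Proof. by case/andP: s01. Qed.
Let s1 : 0 < 1 - s. Proof. by rewrite subr_gt0; case/andP: s01. Qed.
Let b0 : 0 < beta. Proof. by move: sd s0; set D := d%:R; lra. Qed.
Let bs0 : 0 < beta - s. Proof. by move: sd; set D := d%:R; lra. Qed.
Let d2 : d%:R / 2 - beta = beta - s. Proof. by field. Qed.
Let d2' : d%:R / 2 - (beta - s) = beta. Proof. by field. Qed.
Let d4 : (d%:R - 2 * s) / 4 = beta - s. Proof. by field. Qed.
Let ds0 : 0 < d%:R / 2 + s.
Proof. by move: sd s0; set D := d%:R; lra. Qed.

(** [heat_const d (- s)] is the factor between [kern] and the time integral with density [h^(-s-1)];
    the remaining [s / Gamma (1 - s)] is [1 / |Gamma (- s)|]. *)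
Lemma adsE : ads d s = heat_const d (- s) * (s / Gamma (1 - s)).
Proof.
have g1 := Gamma_gt0 s1; have pi0 := pi_gt0 R.
have pd : 0 < pi `^ (d%:R / 2) :> R by rewrite powR_gt0.
rewrite /ads /heat_const !opprK powR4 powRN.
rewrite (_ : (d%:R + 2 * s) / 2 = d%:R / 2 + s); last by field.
by field; rewrite !gt_eqF.
Qed.

Lemma ads_gt0 : 0 < ads d s.
Proof.
rewrite adsE; apply: mulr_gt0; last by rewrite divr_gt0// Gamma_gt0.
by apply: heat_const_gt0; rewrite -subr_gt0 opprK.
Qed.

(** Since [d/2 - beta = beta - s], the quotient of the two heat constants is
    [4^s * Gamma beta / Gamma (beta - s)]; multiplied by the sharp time constant it produces the
    squares in [LambdaH]. Passing to [|f|] only lowers the energy. *)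
Lemma hardy_fractional (nu : R) (f : V -> R) :
  0 <= nu -> nu < LambdaH d s -> measurable_fun setT f ->
  (\int[L]_x (f x ^+ 2)%:E < +oo)%E ->
  (nu%:E * \int[L]_x (f x ^+ 2 * enorm (x : 'rV[R]_d) `^ (- (2 * s)))%:E <=
   (ads d s / 2)%:E * \int[P]_z ((f z.1 - f z.2) ^+ 2 * kern s z.1 z.2)%:E)%E.
Proof.
move=> nu0 nuL mf f2.
have g1 := Gamma_gt0 s1; have gb := Gamma_gt0 b0; have gbs := Gamma_gt0 bs0.
have p4 : 0 < 4 `^ s :> R by rewrite powR_gt0.
have pos0 (a b c e : R) : 0 < a -> 0 < b -> 0 < c -> 0 < e -> 0 <= nu * c * b / (s * e * a).
  move=> a0 b0' c0 e0.
  by rewrite divr_ge0 ?mulr_ge0 ?(ltW s0) ?(ltW a0) ?(ltW b0') ?(ltW c0) ?(ltW e0).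
have pos1 (a b c e : R) : 0 < a -> 0 < b -> 0 < c -> 0 < e -> 0 < c * b ^+ 2 / (s * e * a).
  by move=> a0 b0' c0 e0; rewrite divr_gt0 ?mulr_gt0 ?exprn_gt0.
(* The constant on the time axis that corresponds to [nu]; the condition [nu < LambdaH d s] becomes
   exactly the hypothesis of [hardy_heat]. *)
pose nu' := nu * Gamma (1 - s) * Gamma (beta - s) / (s * 4 `^ s * Gamma beta).
have nu'0 : 0 <= nu' by exact: (pos0 _ _ _ _ gb gbs g1 p4).
have nu'C : nu' * Gamma (beta - s) < Gamma beta * Gamma (1 - s) / s.
  rewrite -subr_gt0.
  rewrite (_ : _ - _ = (LambdaH d s - nu) *
      (Gamma (1 - s) * Gamma (beta - s) ^+ 2 / (s * 4 `^ s * Gamma beta))).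
    by apply: mulr_gt0; [rewrite subr_gt0|exact: (pos1 _ _ _ _ gb gbs g1 p4)].
  rewrite /nu' /LambdaH d4 -powR4.
  move: p4 gb gbs g1; generalize (Gamma beta) (Gamma (beta - s)) (Gamma (1 - s)) (4 `^ s).
  by move=> a b c e e0 a0 b0' c0; field; rewrite !gt_eqF.
have mabs : measurable_fun setT (fun x => `|f x|) by exact: measurableT_comp.
have abs2 x : `|f x| ^+ 2 = f x ^+ 2 by rewrite -normrX ger0_norm ?sqr_ge0.
have f2' : (\int[L]_x (`|f x| ^+ 2)%:E < +oo)%E by under eq_integral do rewrite abs2.
have := hardy_heat s01 sd nu'0 nu'C mabs (fun x => normr_ge0 (f x)) f2'.
under eq_integral do rewrite abs2.
have mk := @measurable_kern s.
have m1 : measurable_fun [set: V * V] (fun z => f z.1) by exact: (measurableT_comp mf measurable_fst).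
have m2 : measurable_fun [set: V * V] (fun z => f z.2) by exact: (measurableT_comp mf measurable_snd).
have absle : (\int[P]_z ((`|f z.1| - `|f z.2|) ^+ 2 * kern s z.1 z.2)%:E <=
    \int[P]_z ((f z.1 - f z.2) ^+ 2 * kern s z.1 z.2)%:E)%E.
  apply: ge0_le_integral => //.
  - by move=> z _; rewrite lee_fin mulr_ge0 ?sqr_ge0 ?kern_ge0.
  - apply/measurable_EFinP; apply: measurable_funM => //; apply: measurable_funX.
    by apply: measurable_funB; exact: measurableT_comp.
  - apply/measurable_EFinP; apply: measurable_funM => //; apply: measurable_funX.
    exact: measurable_funB.
  move=> z _; rewrite lee_fin ler_wpM2r ?kern_ge0//.
  by rewrite -[leRHS]real_normK ?num_real// -[leLHS]real_normK ?num_real// lerXn2r ?nnegrE// ler_dist_dist.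
set A := integral _ _ _ in absle *; set B := integral _ _ _ in absle *; set C := integral _ _ _.
have A0 : (0 <= A)%E by apply: integral_ge0 => z _; rewrite lee_fin mulr_ge0 ?sqr_ge0 ?kern_ge0.
move=> H.
have c0 : 0 <= s / Gamma (1 - s) by rewrite divr_ge0 ?(ltW s0) ?(ltW g1).
have hc0 : 0 < heat_const d (- s) by apply: heat_const_gt0; rewrite -subr_gt0 opprK.
have -> : ads d s / 2 = s / Gamma (1 - s) * (heat_const d (- s) / 2) by rewrite adsE; ring.
have nuE : nu = s / Gamma (1 - s) * (nu' * heat_const d (beta - s) / heat_const d beta).
  rewrite /nu' /heat_const d2 d2'.
  rewrite (_ : 4 `^ (- (beta - s)) = 4 `^ s * 4 `^ (- beta)); last first.
    by rewrite opprB powRD// pnatr_eq0 implybT.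
  have pp : 0 < pi `^ (- (d%:R / 2)) :> R by rewrite powR_gt0// pi_gt0.
  have p4b : 0 < 4 `^ (- beta) :> R by rewrite powR_gt0.
  have s0' := s0.
  move: pp p4b p4 gb gbs g1.
  generalize (Gamma beta) (Gamma (beta - s)) (Gamma (1 - s)) (4 `^ s) (pi `^ (- (d%:R / 2)) : R) (4 `^ (- beta)).
  by move=> a b c e g h g0 h0 e0 a0 b0' c0'; field; rewrite !gt_eqF.
rewrite {1}nuE [X in (X * C)%E]EFinM [X in (_ <= X * B)%E]EFinM -[leLHS]muleA -[leRHS]muleA.
apply: lee_wpmul2l; first by rewrite lee_fin.
apply: (le_trans H); apply: lee_wpmul2l => //.
by rewrite lee_fin divr_ge0 ?(ltW hc0).
Qed.
End Constants.
End HardyConstant.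

(** * Localization to a domain *)

Section KernelMoment.
Variable R : realType.
Variable d : nat.
Notation mu1 := (@lebesgue_measure R).
Notation L := (leb R d).
Notation V := (rVb R d).
Notation R1 := (measurableTypeR R).

(** From [x <= expR x] at [x = u / (8 h)]: half of the Gaussian exponent absorbs the factor [u]. The
    other half is the Gaussian at time [2 h], whose prefactor costs [2^(d/2)]. *)
Lemma sqn_hk_le (h : R) (x y : 'rV[R]_d) : 0 < h ->
  sqn (x - y) * hk h x y <= 8 * 2 `^ (d%:R / 2) * h * hk (2 * h) x y.
Proof.
move=> h0; have h20 : 0 < 2 * h by rewrite mulr_gt0.
rewrite /hk h0 h20 !heatE//.
set u := sqn (x - y); have u0 : 0 <= u by exact: sqn_ge0.
have -> : 4 * pi * (2 * h) = 2 * (4 * pi * h) by ring.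
have p0 : 0 <= 4 * pi * h by rewrite !mulr_ge0 ?pi_ge0 ?(ltW h0).
rewrite [(2 * (_ * h)) `^ _]powRM// [2 `^ (- _)]powRN.
set c := (_ * _) `^ _; set k := 2 `^ _.
have k0 : 0 < k by rewrite powR_gt0.
have c0 : 0 <= c by exact: powR_ge0.
rewrite (_ : 8 * k * h * _ = c * (8 * h * expR (- u / (4 * (2 * h))))); last first.
  by field; rewrite !gt_eqF.
rewrite mulrCA ler_wpM2l//.
have -> : - u / (4 * h) = - u / (4 * (2 * h)) + - u / (4 * (2 * h)) by field; rewrite gt_eqF.
rewrite expRD [leLHS]mulrA ler_wpM2r ?expR_ge0//.
rewrite mulNr expRN -ler_pdivlMr ?invr_gt0 ?expR_gt0// invrK -mulrA.
have := expR_ge1Dx (u / (4 * (2 * h))).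
set e := expR _ => /(le_trans _) le1.
have : u / (4 * (2 * h)) <= e by apply: le1; rewrite lerDr.
by rewrite ler_pdivrMr ?mulr_gt0// => le2; apply: (le_trans le2); rewrite le_eqVlt; apply/orP; left; apply/eqP; ring.
Qed.

(** Bounds the squared increment of a cut-off function living at scale [r] ([tcut_lip]). *)
Definition msq (r : R) (x y : 'rV[R]_d) : R := Num.min 1 (sqn (x - y) / r ^+ 2).

Lemma msq_ge0 r x y : 0 <= msq r x y.
Proof. by rewrite le_min ler01 divr_ge0 ?sqn_ge0 ?sqr_ge0. Qed.

Lemma measurable_msq r : measurable_fun [set: V * V] (fun z => msq r z.1 z.2).
Proof.
apply: measurable_minr => //; apply: measurable_funM => //.
exact: (@measurable_sqn_sub R d).
Qed.

Lemma integral_msq_hk r (h : R) (x : 'rV[R]_d) : 0 < r -> 0 < h ->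
  (\int[L]_y (msq r x y * hk h x y)%:E <=
   (Num.min 1 (8 * 2 `^ (d%:R / 2) / r ^+ 2 * h))%:E)%E.
Proof.
move=> r0 h0; have h20 : 0 < 2 * h by rewrite mulr_gt0.
have mhk t : measurable_fun [set: V] (fun y : V => (hk t x y)%:E).
  by apply/measurable_EFinP; exact: (measurable_fun_pair1 (t : R1) (measurable_hk_swap x)).
have mm : measurable_fun [set: V] (fun y : V => (msq r x y * hk h x y)%:E).
  apply/measurable_EFinP; apply: measurable_funM.
    exact: (measurable_fun_pair2 (x : V) (measurable_msq r)).
  by move/measurable_EFinP : (mhk h).
set c := 8 * _ / _.
have c0 : 0 <= c by rewrite divr_ge0 ?sqr_ge0// mulr_ge0 ?powR_ge0.
rewrite EFin_min le_min; apply/andP; split.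
  rewrite -(integral_hk x h0); apply: ge0_le_integral => //.
  - by move=> y _; rewrite lee_fin mulr_ge0 ?msq_ge0 ?hk_ge0.
  - by move=> y _; rewrite lee_fin ler_piMl ?hk_ge0// ge_min lexx.
rewrite -[leRHS]mule1 -(integral_hk x h20) -ge0_integralZl//; first last.
- by rewrite lee_fin mulr_ge0 ?(ltW h0).
- by move=> y _; rewrite lee_fin hk_ge0.
apply: ge0_le_integral => //.
- by move=> y _; rewrite lee_fin mulr_ge0 ?msq_ge0 ?hk_ge0.
- by apply: measurable_funeM.
move=> y _; rewrite -EFinM lee_fin.
apply: (@le_trans _ _ (sqn (x - y) / r ^+ 2 * hk h x y)).
  by rewrite ler_wpM2r ?hk_ge0// ge_min lexx orbT.
rewrite mulrAC ler_pdivrMr ?exprn_gt0//.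
apply: (le_trans (sqn_hk_le x y h0)); rewrite le_eqVlt; apply/orP; left; apply/eqP.
by rewrite /c; field; rewrite gt_eqF.
Qed.

(** The Levy measure condition for [kern]. In time it is the convergence of the integral of
    [t^(-s-1) * min 1 (c t)], at zero because [s < 1] and at infinity because [0 < s]. *)
Lemma kern_moment (s r : R) : 0 < s < 1 -> 0 < r ->
  exists2 C, 0 <= C & forall x : 'rV[R]_d,
    (\int[L]_y (msq r x y * kern s x y)%:E <= C%:E)%E.
Proof.
move=> /andP[s0 s1] r0.
have hc0 : 0 < heat_const d (- s).
  by apply: heat_const_gt0; rewrite (@lt_le_trans _ _ 0) ?oppr_lt0// divr_ge0.
pose c : R := 8 * 2 `^ (d%:R / 2) / r ^+ 2.
have c0 : 0 <= c by rewrite divr_ge0 ?sqr_ge0// mulr_ge0 ?powR_ge0.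
have cE : 8 * 2 `^ (d%:R / 2) / r ^+ 2 = c by [].
clearbody c; pose I : R := s^-1 + c / (1 - s).
have I0 : 0 <= I by rewrite addr_ge0 ?invr_ge0 ?(ltW s0)// divr_ge0// subr_ge0 ltW.
exists ((heat_const d (- s))^-1 * I); first by rewrite mulr_ge0// invr_ge0 ltW.
move=> x.
pose G (z : V * R1) := (msq r x z.1 * (pwt 0 (- s - 1) z.2 * hk z.2 x z.1))%:E.
have G0 z : (0 <= G z)%E by rewrite lee_fin !mulr_ge0 ?msq_ge0 ?pwt_ge0 ?hk_ge0.
have mG : measurable_fun setT G.
  apply/measurable_EFinP; apply: measurable_funM.
    exact: (measurableT_comp (measurable_fun_pair2 (x : V) (measurable_msq r)) measurable_fst).
  by move/measurable_EFinP : (measurable_pwt_hk_swap (- s - 1) 0 x).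
have mK : measurable_fun [set: V] (fun y : V => tpot (- s - 1) 0 x y).
  exact: (measurable_fun_pair2 (x : V) (@measurable_tpot R d _ _)).
have mm : measurable_fun [set: V] (fun y : V => msq r x y).
  exact: (measurable_fun_pair2 (x : V) (measurable_msq r)).
have kE y : (msq r x y * kern s x y)%:E =
    ((heat_const d (- s))^-1%:E * ((msq r x y)%:E * tpot (- s - 1) 0 x y))%E.
  have [->|xy] := eqVneq x y.
    by rewrite /msq subrr (_ : sqn 0 = 0) ?mul0r ?min_r// ?mul0r ?mul0e ?mule0// /sqn big1// => i _; rewrite mxE expr0n.
  rewrite tpot0E//; last by rewrite (@lt_le_trans _ _ 0) ?oppr_lt0// divr_ge0.
  rewrite -!EFinM /kern (_ : 2 * - s - d%:R = - (d%:R + 2 * s)); last by ring.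
  by congr (_%:E); field; rewrite gt_eqF.
under eq_integral do rewrite kE.
have mmK : measurable_fun [set: V] (fun y : V => (msq r x y)%:E * tpot (- s - 1) 0 x y)%E.
  by apply: emeasurable_funM => //; exact/measurable_EFinP.
rewrite ge0_integralZl//; first last.
- by rewrite lee_fin invr_ge0 ltW.
- by move=> y _; rewrite mule_ge0 ?tpot_ge0// lee_fin msq_ge0.
rewrite EFinM; apply: lee_wpmul2l; first by rewrite lee_fin invr_ge0 ltW.
have -> : (\int[L]_y ((msq r x y)%:E * tpot (- s - 1) 0 x y) =
    \int[L]_y \int[mu1]_t G (y, t))%E.
  apply: eq_integral => y _; rewrite /tpot -ge0_integralZl//.
  - exact: measurable_pwt_hk_time.
  - by move=> t _; rewrite lee_fin mulr_ge0 ?pwt_ge0 ?hk_ge0.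
  - by rewrite lee_fin msq_ge0.
rewrite (fubini_tonelli (m1 := L) (m2 := mu1) _ mG G0)/=.
have m1 : measurable_fun [set: R1] (fun t => (pwt 1 (- s - 1) t)%:E).
  exact: (measurable_EFinT (measurable_pwt _ _)).
have m2 : measurable_fun [set: R1] (fun t => (pwt 0 ((1 - s) - 1) t * (t <= 1)%R%:R)%:E).
  by apply: measurable_EFinT; apply: measurable_funM; [exact: measurable_pwt|exact: measurable_leb].
have m3 : measurable_fun [set: R1] (fun t => c%:E * (pwt 0 ((1 - s) - 1) t * (t <= 1)%R%:R)%:E)%E.
  exact: measurable_funeM.
apply: (@le_trans _ _ (\int[mu1]_t ((pwt 1 (- s - 1) t)%:E +
    c%:E * (pwt 0 ((1 - s) - 1) t * (t <= 1)%R%:R)%:E))%E); last first.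
  rewrite ge0_integralD//; first last.
  - by move=> t _; rewrite mule_ge0// lee_fin mulr_ge0 ?pwt_ge0.
  - by move=> t _; rewrite lee_fin pwt_ge0.
  rewrite ge0_integralZl//; last by move=> t _; rewrite lee_fin mulr_ge0 ?pwt_ge0.
  rewrite integral_pwt// powR1 mul1r EFinD; apply: leeD2l.
  have s1' : 0 < 1 - s by rewrite subr_gt0.
  have := @integral_pwt0_le R 1 (1 - s) ltr01 s1'; rewrite powR1 => le1.
  by rewrite (EFinM c); apply: lee_wpmul2l; rewrite ?lee_fin// (le_trans le1)// mul1r.
apply: ge0_le_integral => //.
- by move=> t _; apply: integral_ge0.
- exact: (measurable_fun_fubini_tonelli_G (m1 := L) _ mG G0).
- exact: emeasurable_funD.
move=> t _; rewrite /G/=.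
have [t0|t0] := ltP 0 t; last first.
  rewrite integral0_eq ?adde_ge0// ?mule_ge0 ?lee_fin ?mulr_ge0 ?pwt_ge0// => y _.
  by rewrite {1}/pwt ltNge t0 mul0r mulr0.
under eq_integral do rewrite mulrCA EFinM.
rewrite ge0_integralZl ?lee_fin ?pwt_ge0//; first last.
- by move=> y _; rewrite lee_fin mulr_ge0 ?msq_ge0 ?hk_ge0.
- apply/measurable_EFinP; apply: measurable_funM => //.
  exact: (measurable_fun_pair1 (t : R1) (measurable_hk_swap x)).
apply: (le_trans (lee_wpmul2l _ (integral_msq_hk x r0 t0))); first by rewrite lee_fin pwt_ge0.
rewrite -!EFinM -EFinD lee_fin cE /pwt t0.
case: leP => t1; rewrite ?mulr1 ?add0r ?mulr0 ?addr0; last first.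
  by rewrite -[leRHS]mulr1 ler_wpM2l ?powR_ge0// ge_min lexx.
have -> : 1 - s - 1 = - s - 1 + 1 by ring.
rewrite [t `^ (_ + 1)]powRD ?(gt_eqF t0) ?implybT// powRr1 ?(ltW t0)// mulrCA.
by rewrite ler_wpM2l ?powR_ge0// ge_min lexx orbT.
Qed.

End KernelMoment.

(** * A cut-off at the origin *)

Section LocalizedHardy.
Variable R : realType.
Variable d : nat.
Notation L := (leb R d).
Notation V := (rVb R d).
Notation P := (leb R d \x leb R d)%E.

Lemma sqr_norm_le_sqn (x : 'rV[R]_d) : `|x| ^+ 2 <= sqn x.
Proof.
have [x0|/mx_norm_neq0[[i j] /= xE]] := eqVneq (mx_norm x) 0.
  by rewrite [`|x|]x0 expr0n sqn_ge0.
rewrite [`|x|]xE (ord1 i) real_normK ?num_real// /sqn (bigD1 j)//= lerDl.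
by apply: sumr_ge0 => k _; exact: sqr_ge0.
Qed.

Definition bump (a : R) : R := (1 - a ^+ 2) / (1 + a ^+ 2).

Let onesq (a : R) : 0 < 1 + a ^+ 2.
Proof. by rewrite ltr_pwDl ?sqr_ge0. Qed.

(* With [a = tan (theta / 2)], [bump a = cos theta], so that [bump] and the sine
   form a quadratic partition of unity. *)
Lemma bump_ims (a b u v : R) :
  (bump a * u - bump b * v) ^+ 2 <= (u - v) ^+ 2 + 2 * (a - b) ^+ 2 * (u ^+ 2 + v ^+ 2).
Proof.
have a1 := onesq a; have b1 := onesq b.
pose z t : R := 2 * t / (1 + t ^+ 2).
pose del := 2 * (a - b) ^+ 2 / ((1 + a ^+ 2) * (1 + b ^+ 2)).
have del0 : 0 <= del.
  by rewrite /del; apply: divr_ge0; apply: mulr_ge0; rewrite ?sqr_ge0 ?(ltW a1) ?(ltW b1).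
have dle : del <= 2 * (a - b) ^+ 2.
  rewrite ler_pdivrMr ?mulr_gt0//; apply: ler_peMr; first by apply: mulr_ge0; rewrite ?sqr_ge0.
  by apply: mulr_ege1; rewrite lerDl sqr_ge0.
apply: (@le_trans _ _ ((u - v) ^+ 2 + del * (u ^+ 2 + v ^+ 2))); last first.
  by rewrite lerD2l ler_wpM2r// addr_ge0 ?sqr_ge0.
rewrite -subr_ge0 [X in 0 <= X](_ : _ = (z a * u - z b * v) ^+ 2 + del * (u - v) ^+ 2).
  by apply: addr_ge0; rewrite ?sqr_ge0//; apply: mulr_ge0; rewrite ?sqr_ge0.
by rewrite /z /del /bump; field; rewrite !gt_eqF.
Qed.

(** [bump] vanishes at [1], so this controls its increment between [a] and [1]. It serves pairs with
    one point outside the domain, where [tcut] equals [1]. *)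
Lemma bump_sqr_le (a : R) : 0 <= a <= 1 -> bump a ^+ 2 <= 4 * (a - 1) ^+ 2.
Proof.
move=> /andP[a0 a1]; have o := onesq a.
have b0 : 0 <= bump a by rewrite divr_ge0 ?(ltW o)// subr_ge0 expr_le1.
have le1 : bump a <= 2 * (1 - a).
  rewrite ler_pdivrMr// (_ : 1 - a ^+ 2 = (1 - a) * (1 + a)); last by ring.
  rewrite -mulrA mulrCA ler_wpM2l ?subr_ge0//.
  by move: (sqr_ge0 a) a1; move: (a ^+ 2) => q; lra.
apply: (@le_trans _ _ ((2 * (1 - a)) ^+ 2)).
  by rewrite lerXn2r ?nnegrE ?(le_trans b0).
by rewrite le_eqVlt; apply/orP; left; apply/eqP; ring.
Qed.

(** The left side is the squared sine [4 a^2 / (1 + a^2)^2]. Its quadratic vanishing at [0]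
    compensates the singularity of the Hardy weight in [tcut_enorm]. *)
Lemma bump_sqr_ge (a : R) : 1 - bump a ^+ 2 <= 4 * a ^+ 2.
Proof.
have o := onesq a; rewrite [leLHS](_ : _ = 4 * a ^+ 2 / (1 + a ^+ 2) ^+ 2).
  rewrite ler_pdivrMr ?exprn_gt0//; apply: ler_peMr; first by apply: mulr_ge0; rewrite ?sqr_ge0.
  by rewrite exprn_ege1// lerDl sqr_ge0.
by rewrite /bump; field; rewrite gt_eqF.
Qed.

(* The sup norm, since the triangle inequality is available for it but not for [enorm]. *)
Definition tcut (r : R) (x : 'rV[R]_d) : R := Num.min 1 (`|x| / r).

Lemma tcut01 r x : 0 < r -> 0 <= tcut r x <= 1.
Proof. by move=> r0; rewrite le_min ler01 ge_min lexx divr_ge0// ltW. Qed.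

Lemma tcut_lip r x y : 0 < r -> (tcut r x - tcut r y) ^+ 2 <= msq r x y.
Proof.
move=> r0; have /andP[x0 x1] := tcut01 x r0; have /andP[y0 y1] := tcut01 y r0.
rewrite le_min; apply/andP; split.
  rewrite -[leLHS]real_normK ?num_real// expr_le1// ler_norml.
  by move: x0 x1 y0 y1; set a := tcut r x; set b := tcut r y; lra.
apply: (@le_trans _ _ ((`|x - y| / r) ^+ 2)); last first.
  by rewrite expr_div_n ler_pM2r ?invr_gt0 ?exprn_gt0// sqr_norm_le_sqn.
rewrite -[leLHS]real_normK ?num_real// lerXn2r ?nnegrE ?divr_ge0 ?(ltW r0)//.
have xy : `| `|x| / r - `|y| / r| <= `|x - y| / r.
  rewrite -mulrBl normrM [`|r^-1|]gtr0_norm ?invr_gt0// ler_pM2r ?invr_gt0//.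
  exact: ler_dist_dist.
apply: (le_trans _ xy); rewrite /tcut.
move: (`|x| / r) (`|y| / r) => a b; rewrite /Num.min.
have A := ler_norm (a - b); have B := ler_norm (b - a); rewrite distrC in B.
by case: ltP => a1; case: ltP => b1; rewrite ler_norml; apply/andP; split; lra.
Qed.

Lemma measurable_bump_tcut r : measurable_fun [set: V] (fun x : V => bump (tcut r x)).
Proof.
have mt : measurable_fun [set: V] (fun x : V => tcut r x).
  apply: measurable_minr => //; apply: measurable_funM => //.
  by apply: continuous_measurable_rVb => x; exact: norm_continuous.
have mt2 : measurable_fun [set: V] (fun x : V => tcut r x ^+ 2) by exact: measurable_funX.
rewrite (_ : (fun x => _) = (fun x : V => (1 - tcut r x ^+ 2) * (1 + tcut r x ^+ 2) `^ (- 1))).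
  apply: measurable_funM; first exact: measurable_funB.
  by apply: (measurableT_comp (measurable_powR (- 1))); exact: measurable_funD.
by apply/funext => x; rewrite /bump powR_inv1// ltW.
Qed.

Variable s : R.
Hypotheses (s01 : 0 < s < 1) (sd : 2 * s < d%:R).
Let s0 : 0 < s. Proof. by case/andP: s01. Qed.

Lemma norm_le_enorm (x : 'rV[R]_d) : `|x| <= enorm x.
Proof.
rewrite -(@ler_pXn2r _ 2)// ?nnegrE ?sqrtr_ge0//.
by rewrite sqr_sqrtr ?sqn_ge0// sqr_norm_le_sqn.
Qed.

(** As [tcut] is at most one and [2 s <= 2], its square is at most its power [2 s], hence at most
    [(enorm x / r)^(2s)]. *)
Lemma tcut_enorm (r : R) (x : 'rV[R]_d) : 0 < r ->
  tcut r x ^+ 2 * enorm x `^ (- (2 * s)) <= r `^ (- (2 * s)).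
Proof.
move=> r0; have [->|x0] := eqVneq x 0.
  by rewrite /tcut normr0 mul0r min_r// expr0n mul0r powR_ge0.
have e0 := enorm_gt0 x0; have /andP[t0 t1] := tcut01 x r0.
have s20 : 0 <= 2 * s by rewrite mulr_ge0// ltW.
apply: (@le_trans _ _ ((enorm x / r) `^ (2 * s) * enorm x `^ (- (2 * s)))).
  rewrite ler_wpM2r ?powR_ge0//; apply: (@le_trans _ _ (tcut r x `^ (2 * s))).
    have [->|t00] := eqVneq (tcut r x) 0; first by rewrite expr0n powR_ge0.
    have tp : 0 < tcut r x by rewrite lt_neqAle eq_sym t00.
    rewrite -powR_mulrn//; apply: ger_powR; rewrite ?tp//.
    by rewrite -[leRHS]mulr1 ler_wpM2l// ltW//; case/andP: s01.
  apply: ge0_ler_powR => //; rewrite ?nnegrE ?divr_ge0 ?(ltW e0) ?(ltW r0)//.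
  by rewrite ge_min ler_pM2r ?invr_gt0// norm_le_enorm orbT.
rewrite powRM ?(ltW e0) ?invr_ge0 ?(ltW r0)// mulrAC -powRD ?(gt_eqF e0) ?implybT//.
by rewrite subrr powRr0 mul1r -powR_inv1 ?(ltW r0)// -powRrM mulN1r.
Qed.

End LocalizedHardy.

(** * The Hardy inequality on the domain, with a lower-order term *)

Section HardyDomain.
Variable R : realType.
Variable d : nat.
Notation L := (leb R d).
Notation V := (rVb R d).
Notation P := (leb R d \x leb R d)%E.
Variable s : R.
Hypotheses (s01 : 0 < s < 1) (sd : 2 * s < d%:R).
Variable Om : set 'rV[R]_d.
Hypotheses (oO : open Om) (O0 : Om 0).
Implicit Types (phi : V -> R).

Lemma measurable_indic_open (A : set 'rV[R]_d) : open A ->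
  measurable_fun [set: V] (fun x : V => \1_A x : R).
Proof. by move=> oA; apply: measurable_indic; exact: measurable_rVb. Qed.

Lemma indic_sqr (A : set 'rV[R]_d) x : (\1_A x : R) ^+ 2 = \1_A x.
Proof. by rewrite indicE; case: (x \in A); rewrite ?expr1n ?expr0n. Qed.

Lemma indic01 (A : set 'rV[R]_d) x : 0 <= (\1_A x : R) <= 1.
Proof. by rewrite indicE; case: (x \in A); rewrite ?lexx ler01. Qed.

Lemma bump01 (a : R) : 0 <= a <= 1 -> 0 <= bump a <= 1.
Proof.
move=> /andP[a0 a1]; have o : 0 < 1 + a ^+ 2 by rewrite ltr_pwDl ?sqr_ge0.
rewrite /bump; apply/andP; split.
  by apply: divr_ge0; [rewrite subr_ge0 expr_le1|exact: ltW].
by rewrite ler_pdivrMr// mul1r lerD2l (@le_trans _ _ 0)// ?oppr_le0 sqr_ge0.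
Qed.

Lemma tcut_out : exists2 r, 0 < r & forall x, ~ Om x -> tcut r x = 1.
Proof.
have [r /= r0 rO] : nbhs_ball (0 : 'rV[R]_d) Om by apply/nbhs_ballP/oO.
exists r => // x nOx; rewrite /tcut min_l// ler_pdivlMr// mul1r leNgt.
apply/negP => xr; apply: nOx; apply: rO; rewrite mx_norm_ball /ball_/= sub0r.
by rewrite normrN.
Qed.

(** Localization with a quadratic partition of unity: the cut-off function [psi] lives in [Om] and
    obeys the inequality on the whole space with the same [nu]. Both the error in the energy and the
    error in the weight are multiples of the [L^2] mass. *)
Lemma hardy_domain nu : 0 <= nu -> nu < LambdaH d s ->
  exists2 C, 0 <= C & forall phi, measurable_fun setT phi ->
   (\int[L]_x (\1_Om x * phi x ^+ 2)%:E < +oo)%E ->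
   (nu%:E * \int[L]_x (\1_Om x * phi x ^+ 2 * enorm (x : 'rV[R]_d) `^ (- (2 * s)))%:E <=
    (ads d s / 2)%:E *
      \int[P]_z (\1_Om z.1 * \1_Om z.2 * (phi z.1 - phi z.2) ^+ 2 * kern s z.1 z.2)%:E +
    C%:E * \int[L]_x (\1_Om x * phi x ^+ 2)%:E)%E.
Proof.
move=> nu0 nuL; have [r r0 rO] := tcut_out.
have [Cm Cm0 HCm] := kern_moment d s01 r0.
have a0 := ads_gt0 s01 sd.
have a20 : 0 <= ads d s / 2 := divr_ge0 (ltW a0) (ler0n R 2).
have m1O := measurable_indic_open oO.
exists (ads d s / 2 * (8 * Cm) + nu * (4 * r `^ (- (2 * s)))).
  apply: addr_ge0; first by apply: mulr_ge0 a20 _; rewrite mulr_ge0.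
  by rewrite mulr_ge0// mulr_ge0// powR_ge0.
move=> phi mphi; set N0 := integral _ _ _ => N0oo.
pose f (x : V) := \1_Om x * phi x.
have mf : measurable_fun setT f by exact: measurable_funM.
have f2 x : f x ^+ 2 = \1_Om x * phi x ^+ 2 by rewrite exprMn indic_sqr.
have N0E : N0 = (\int[L]_x (f x ^+ 2)%:E)%E by apply: eq_integral => x _; rewrite f2.
pose psi (x : V) := bump (tcut r x) * f x.
have mb := @measurable_bump_tcut R d r.
have mpsi : measurable_fun setT psi by exact: measurable_funM.
have mf2 : measurable_fun [set: V] (fun x => (f x ^+ 2)%:E).
  by apply/measurable_EFinP; exact: measurable_funX.
have mpsi2 : measurable_fun [set: V] (fun x => (psi x ^+ 2)%:E).
  by apply/measurable_EFinP; exact: measurable_funX.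
have bump_le1 x : bump (tcut r x) ^+ 2 <= 1.
  by have /andP[b0 b1] := bump01 (tcut01 x r0); rewrite expr_le1.
have psi2 : (\int[L]_x (psi x ^+ 2)%:E < +oo)%E.
  apply: le_lt_trans N0oo; rewrite N0E; apply: ge0_le_integral => //.
  - by move=> x _; rewrite lee_fin sqr_ge0.
  - by move=> x _; rewrite lee_fin [psi x ^+ 2]exprMn ler_piMl ?sqr_ge0.
have men := @measurable_enorm_powR R d (- (2 * s)).
have e0 (x : 'rV[R]_d) : 0 <= enorm x `^ (- (2 * s)) by exact: powR_ge0.
have rs0 : 0 <= 4 * r `^ (- (2 * s)) by rewrite mulr_ge0 ?powR_ge0.
have mpe : measurable_fun [set: V] (fun x => (psi x ^+ 2 * enorm (x : 'rV[R]_d) `^ (- (2 * s)))%:E).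
  by apply/measurable_EFinP; apply: measurable_funM => //; exact: measurable_funX.
(* What the cut-off loses is [1 - bump^2 <= 4 tcut^2], on which the Hardy weight is bounded by
   [tcut_enorm]. *)
have step1 : (\int[L]_x (\1_Om x * phi x ^+ 2 * enorm (x : 'rV[R]_d) `^ (- (2 * s)))%:E <=
    \int[L]_x (psi x ^+ 2 * enorm (x : 'rV[R]_d) `^ (- (2 * s)))%:E +
    (4 * r `^ (- (2 * s)))%:E * N0)%E.
  rewrite N0E -ge0_integralZl//; last by move=> x _; rewrite lee_fin sqr_ge0.
  have mf4 : measurable_fun [set: V] (fun x => (4 * r `^ (- (2 * s)))%:E * (f x ^+ 2)%:E)%E.
    exact: measurable_funeM.
  rewrite -ge0_integralD//; first last.
  - by move=> x _; rewrite -EFinM lee_fin mulr_ge0 ?sqr_ge0.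
  - by move=> x _; rewrite lee_fin mulr_ge0 ?sqr_ge0.
  apply: ge0_le_integral => //.
  - by move=> x _; rewrite -f2 lee_fin mulr_ge0 ?sqr_ge0.
  - apply/measurable_EFinP; apply: measurable_funM => //; apply: measurable_funM => //.
    exact: measurable_funX.
  - exact: emeasurable_funD.
  move=> x _; rewrite -f2 -EFinM -EFinD lee_fin [psi x ^+ 2]exprMn.
  have A := bump_sqr_ge (tcut r x); have B := tcut_enorm s01 x r0.
  rewrite -subr_ge0; set e := enorm _ `^ _ in B *.
  rewrite [X in 0 <= X](_ : _ = f x ^+ 2 * (4 * r `^ (- (2 * s)) -
    (1 - bump (tcut r x) ^+ 2) * e)); last by ring.
  apply: mulr_ge0; first exact: sqr_ge0.
  rewrite subr_ge0; apply: (@le_trans _ _ (4 * tcut r x ^+ 2 * e)).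
    by rewrite ler_wpM2r// e0.
  by rewrite -mulrA ler_wpM2l.
have := hardy_fractional s01 sd nu0 nuL mpsi psi2.
have mk := @measurable_kern R d s.
have mm := @measurable_msq R d r.
have m1 (g : V -> R) : measurable_fun setT g -> measurable_fun [set: V * V] (fun z => g z.1).
  by move=> mg; exact: (measurableT_comp mg measurable_fst).
have m2 (g : V -> R) : measurable_fun setT g -> measurable_fun [set: V * V] (fun z => g z.2).
  by move=> mg; exact: (measurableT_comp mg measurable_snd).
set E1 := integral _ _ _.
pose K (x y : V) := (msq r x y * kern s x y)%:E.
have mK : measurable_fun [set: V * V] (fun z => K z.1 z.2).
  by apply/measurable_EFinP; exact: measurable_funM.
have K0 x y : (0 <= K x y)%E by rewrite lee_fin mulr_ge0 ?msq_ge0 ?kern_ge0.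
have sqnC (x y : 'rV[R]_d) : sqn (x - y) = sqn (y - x).
  by apply: eq_bigr => i _; rewrite !mxE -sqrrN opprB.
have KC x y : K x y = K y x.
  by rewrite /K /msq sqnC /kern !enorm_powR sqnC.
pose g (x : V) := 4 * f x ^+ 2.
have mg : measurable_fun setT g by apply: measurable_funM => //; exact: measurable_funX.
have g0 x : 0 <= g x by rewrite mulr_ge0 ?sqr_ge0.
have gK : (\int[L]_x ((g x)%:E * \int[L]_y K x y) <= (4 * Cm)%:E * N0)%E.
  rewrite N0E -ge0_integralZl//; first last.
  - by rewrite lee_fin mulr_ge0.
  - by move=> x _; rewrite lee_fin sqr_ge0.
  have mIK : measurable_fun [set: V] (fun x => \int[L]_y K x y)%E.
    by apply: (measurable_fun_fubini_tonelli_F (m2 := L) _ mK) => z; exact: K0.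
  apply: ge0_le_integral => //.
  - by move=> x _; apply: mule_ge0; [rewrite lee_fin|exact: integral_ge0].
  - by apply: emeasurable_funM => //; apply/measurable_EFinP.
  - by apply: measurable_funeM.
  move=> x _; have := HCm x => /(lee_wpmul2l _) le1.
  apply: (le_trans (le1 _ _)); first by rewrite lee_fin.
  by rewrite -!EFinM lee_fin /g le_eqVlt; apply/orP; left; apply/eqP; ring.
pose A (z : V * V) := (\1_Om z.1 * \1_Om z.2 * (phi z.1 - phi z.2) ^+ 2 * kern s z.1 z.2)%:E.
have A0 z : (0 <= A z)%E.
  have /andP[i0 _] := indic01 Om z.1; have /andP[j0 _] := indic01 Om z.2.
  by rewrite lee_fin; apply: mulr_ge0; rewrite ?kern_ge0//; apply: mulr_ge0; rewrite ?sqr_ge0// mulr_ge0.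
have mA : measurable_fun setT A.
  apply/measurable_EFinP; apply: measurable_funM => //; apply: measurable_funM.
    by apply: measurable_funM; [exact: m1|exact: m2].
  by apply: measurable_funX; apply: measurable_funB; [exact: m1|exact: m2].
have mg1 : measurable_fun [set: V * V] (fun z => (g z.1)%:E * K z.1 z.2)%E.
  by apply: emeasurable_funM => //; apply/measurable_EFinP; exact: m1.
have mg2 : measurable_fun [set: V * V] (fun z => (g z.2)%:E * K z.1 z.2)%E.
  by apply: emeasurable_funM => //; apply/measurable_EFinP; exact: m2.
have g10 z : (0 <= (g z.1)%:E * K z.1 z.2)%E.
  by apply: mule_ge0; [rewrite lee_fin|exact: K0].
have g20 z : (0 <= (g z.2)%:E * K z.1 z.2)%E.
  by apply: mule_ge0; [rewrite lee_fin|exact: K0].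
(* Pairs inside [Om] use [bump_ims]; pairs with one point outside use [bump_sqr_le] with [tcut = 1]
   at that point, so only the energy over [Om * Om] appears. The constant [8 Cm] is [4 Cm] from each
   variable. *)
have step2 : (\int[P]_z ((psi z.1 - psi z.2) ^+ 2 * kern s z.1 z.2)%:E <=
    \int[P]_z A z + (8 * Cm)%:E * N0)%E.
  apply: (@le_trans _ _ (\int[P]_z (A z + ((g z.1)%:E * K z.1 z.2 + (g z.2)%:E * K z.1 z.2)))%E).
    have mgg : measurable_fun [set: V * V]
        (fun z => ((g z.1)%:E * K z.1 z.2 + (g z.2)%:E * K z.1 z.2))%E.
      exact: emeasurable_funD.
    apply: ge0_le_integral => //.
    - by move=> z _; rewrite lee_fin mulr_ge0 ?sqr_ge0 ?kern_ge0.
    - apply/measurable_EFinP; apply: measurable_funM => //; apply: measurable_funX.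
      by apply: measurable_funB; [exact: m1|exact: m2].
    - exact: emeasurable_funD.
    case=> x y _ /=; rewrite /A /K /g -!EFinM -!EFinD lee_fin /=.
    set k := kern s x y; have k0 : 0 <= k by exact: kern_ge0.
    rewrite !mulrA -!mulrDl ler_wpM2r//.
    have M := tcut_lip x y r0; have M0 := msq_ge0 r x y.
    rewrite /psi /f !indicE.
    have [/set_mem Ox|/negP nOx] := boolP (x \in Om); have [/set_mem Oy|/negP nOy] := boolP (y \in Om);
      rewrite /= ?mulr1n ?mulr0n ?mul1r ?mul0r ?mulr0 ?subrr ?expr0n/= ?mulr0 ?mul0r ?add0r ?addr0//.
    - apply: (le_trans (bump_ims _ _ _ _)).
      rewrite [leRHS](_ : _ = (phi x - phi y) ^+ 2 + 4 * msq r x y * (phi x ^+ 2 + phi y ^+ 2)); last by ring.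
      rewrite lerD2l; apply: ler_wpM2r; first by rewrite addr_ge0 ?sqr_ge0.
      by move: M M0; move: (_ ^+ 2) (msq r x y) => q m; lra.
    - rewrite subr0 exprMn [leRHS](_ : _ = 4 * msq r x y * phi x ^+ 2); last by ring.
      apply: ler_wpM2r; first exact: sqr_ge0.
      apply: (le_trans (bump_sqr_le (tcut01 x r0))); rewrite ler_wpM2l//.
      by rewrite -(rO y) => [|/mem_set/nOy//].
    - rewrite sqrrN exprMn [leRHS](_ : _ = 4 * msq r x y * phi y ^+ 2); last by ring.
      apply: ler_wpM2r; first exact: sqr_ge0.
      apply: (le_trans (bump_sqr_le (tcut01 y r0))); rewrite ler_wpM2l//.
      by rewrite -(rO x) => [|/mem_set/nOx//]; rewrite -sqrrN opprB.
    - by rewrite mul0r.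
  rewrite ge0_integralD//; first last.
  - exact: emeasurable_funD.
  - by move=> z _; rewrite adde_ge0.
  apply: leeD2l; rewrite ge0_integralD//.
  rewrite (integral_fstK K0 mK mg g0) (integral_sndK K0 KC mK mg g0).
  apply: (le_trans (leeD gK gK)).
  rewrite -ge0_muleDl ?lee_fin ?mulr_ge0// -EFinD.
  by apply: lee_wpmul2r; [apply: integral_ge0 => x _; rewrite -f2 lee_fin sqr_ge0|rewrite lee_fin le_eqVlt; apply/orP; left; apply/eqP; ring].
have N00 : (0 <= N0)%E by rewrite N0E; apply: integral_ge0 => x _; rewrite lee_fin sqr_ge0.
have IA0 : (0 <= \int[P]_z A z)%E by apply: integral_ge0.
have Ip0 : (0 <= \int[L]_x (psi x ^+ 2 * enorm (x : 'rV[R]_d) `^ (- (2 * s)))%:E)%E.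
  by apply: integral_ge0 => x _; rewrite lee_fin; apply: mulr_ge0; rewrite ?sqr_ge0.
move=> H; apply: (le_trans (lee_wpmul2l _ step1)); first by rewrite lee_fin.
rewrite ge0_muleDr//; last by apply: mule_ge0; rewrite ?lee_fin.
apply: (@le_trans _ _ ((ads d s / 2)%:E * (\int[P]_z A z + (8 * Cm)%:E * N0) +
    nu%:E * ((4 * r `^ (- (2 * s)))%:E * N0))%E).
  by apply: leeD2r; apply: (le_trans H); apply: lee_wpmul2l.
rewrite ge0_muleDr//; last by apply: mule_ge0; rewrite ?lee_fin ?mulr_ge0.
rewrite -addeA; apply: leeD2l; rewrite !muleA -!EFinM -ge0_muleDl ?lee_fin//.
- by apply: mulr_ge0 => //; rewrite mulr_ge0.
- exact: mulr_ge0.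
Qed.

End HardyDomain.

(** * Interior balls of smooth domains and the Nash inequality *)

Section DirectionalCalculus.
Variable R : realType.
Variable d : nat.
Implicit Types (f : 'rV[R]_d -> R) (x y v p : 'rV[R]_d).

Lemma is_derive_line f p v (c : R) : derivable f (p + c *: v) v ->
  is_derive (c : R) 1 (fun h => f (p + h *: v)) ('D_v f (p + c *: v)).
Proof.
move=> df.
have E : (fun h : R => h^-1 *: (((fun h => f (p + h *: v)) \o shift c) (h *: 1) -
      f (p + c *: v))) =
    (fun h => h^-1 *: ((f \o shift (p + c *: v)) (h *: v) - f (p + c *: v))).
  apply/funext => h; congr (_ *: (f _ - _)).
  by rewrite /= [h *: 1]mulr1 scalerDl addrCA.
by split; rewrite /derivable /derive E.
Qed.

Lemma mvt_line f p v (a : R) : (forall x, derivable f x v) ->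
  exists2 th, 0 <= th <= 1 & f (p + a *: v) - f p = a * 'D_v f (p + (th * a) *: v).
Proof.
move=> df; pose g h := f (p + h *: v).
have dg (c : R) : is_derive c 1 g ('D_v f (p + c *: v)) by exact: is_derive_line.
have cg : continuous g.
  by move=> c; apply/differentiable_continuous/derivable1_diffP; have [] := dg c.
have g0 : g 0 = f p by rewrite /g scale0r addr0.
have [a0|a0|->] := ltgtP a 0; last first.
- by exists 0; rewrite ?lexx ?ler01// mul0r scale0r addr0 subrr.
- have [c] := MVT a0 (fun c _ => dg c) (continuous_subspaceT cg).
  rewrite in_itv/= => /andP[c0 ca]; rewrite g0 subr0 => E.
  exists (c / a); last by rewrite divfK ?gt_eqF// -/(g a) E mulrC.
  by rewrite divr_ge0 ?(ltW c0) ?(ltW a0)//= ler_pdivrMr// mul1r ltW.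
- have [c] := MVT a0 (fun c _ => dg c) (continuous_subspaceT cg).
  rewrite in_itv/= => /andP[ac c0]; rewrite g0 sub0r => E.
  exists (c / a); last by rewrite divfK ?lt_eqF// -/(g a) -opprB E mulrN opprK mulrC.
  rewrite -[c / a]mulrNN -invrN divr_ge0 ?oppr_ge0 ?(ltW c0) ?(ltW a0)//=.
  by rewrite ler_pdivrMr ?oppr_gt0// mul1r lerN2 ltW.
Qed.

Definition evec (i : 'I_d) : 'rV[R]_d := delta_mx ord0 i.

(** Smoothness is given through directional derivatives, so the coordinates are changed one at a
    time. The intermediate points stay in the ball because it is a cube. *)
Lemma partial_lipschitz f x0 (del K : R) :
  (forall i x, derivable f x (evec i)) ->
  (forall i x, ball x0 del x -> `|'D_(evec i) f x| <= K) ->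
  forall x y r, ball x0 del x -> ball x0 del y ->
    (forall i, `|x ord0 i - y ord0 i| <= r) -> `|f y - f x| <= d%:R * (K * r).
Proof.
move=> df Kf x y r /[dup] bx /ball_rV[del0 xd] /ball_rV[_ yd] xy.
pose p k : 'rV[R]_d := \row_i if (i < k)%N then y ord0 i else x ord0 i.
suff H k : (k <= d)%N -> `|f (p k) - f x| <= k%:R * (K * r).
  have := H d (leqnn d); congr (`|f _ - _| <= _).
  by apply/rowP => i; rewrite mxE ltn_ord.
elim: k => [_|k IH kd].
  rewrite (_ : p 0 = x) ?subrr ?normr0 ?mul0r//.
  by apply/rowP => i; rewrite mxE.
pose i := Ordinal kd.
have pE : p k.+1 = p k + (y ord0 i - x ord0 i) *: evec i.
  apply/rowP => j; rewrite !mxE eqxx/= ltnS leq_eqVlt.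
  have [->|ji] := eqVneq j i; first by rewrite eqxx ltnn mulr1 addrC subrK.
  have -> : (j == k :> nat) = false by apply: contraNF ji => /eqP jk; apply/eqP/val_inj.
  by rewrite mulr0 addr0.
have [th /andP[th0 th1] E] := mvt_line (p k) (y ord0 i - x ord0 i) (df i).
rewrite pE -[f _](subrK (f (p k))) -addrA (le_trans (ler_normD _ _))//.
rewrite -natr1 mulrDl mul1r [leRHS]addrC lerD ?IH// 1?ltnW//.
rewrite E normrM mulrC ler_pM// ?Kf//; last by rewrite distrC.
apply/ball_rV; split => // j; rewrite !mxE eqxx/=.
have [->|ji] := eqVneq j i; last first.
  by rewrite mulr0 addr0; case: ifP.
rewrite ltnn mulr1 (_ : _ - _ = (1 - th) * (x0 ord0 i - x ord0 i) + th * (x0 ord0 i - y ord0 i)); last by ring.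
apply: (le_lt_trans (ler_normD _ _)); rewrite !normrM (ger0_norm th0).
rewrite [`|1 - th|]ger0_norm ?subr_ge0//.
have [->|th0'] := eqVneq th 0; first by rewrite subr0 mul1r mul0r addr0 xd.
rewrite [ltRHS](_ : _ = (1 - th) * del + th * del); last by ring.
apply: ler_ltD; first by rewrite ler_wpM2l ?subr_ge0// ltW// xd.
have thp : 0 < th by rewrite lt_neqAle eq_sym th0'.
by rewrite (ltr_pM2l thp) yd.
Qed.

Lemma smooth_derivable f v x : smooth_fun f -> derivable f x v.
Proof. by move=> /(_ 1)[_ /(_ v)[]]. Qed.

Lemma smooth_continuous_derive f v : smooth_fun f -> continuous (fun x => 'D_v f x).
Proof. by move=> /(_ 1)[_ /(_ v)[]]. Qed.

Lemma smooth_continuous f : smooth_fun f -> continuous f.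
Proof. by move=> /(_ 0). Qed.

End DirectionalCalculus.

Section Density.
Variable R : realType.
Variable d : nat.
Notation L := (leb R d).
Notation V := (rVb R d).
Implicit Types (x y z v : 'rV[R]_d) (Om : set 'rV[R]_d).

(** Balls are for the sup norm, hence cubes of side [2 * rho]. *)
Lemma leb_ball (c : 'rV[R]_d) (rho : R) : 0 < rho -> L (ball c rho) = ((2 * rho) ^+ d)%:E.
Proof.
move=> rho0.
have mB : measurable (ball c rho : set V) by apply: measurable_rVb; exact: ball_open.
rewrite -[ball c rho]setIT -integral_indic//.
pose f (i : 'I_d) (t : R) : R := \1_(`]c ord0 i - rho, c ord0 i + rho[%classic) t.
transitivity (\int[L]_x (\prod_(i < d) f i ((x : 'rV[R]_d) ord0 i))%:E)%E.
  apply: eq_integral => x _; congr (_%:E); rewrite indicE.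
  have fE i : f i ((x : 'rV[R]_d) ord0 i) = (`|c ord0 i - (x : 'rV[R]_d) ord0 i| < rho)%R%:R.
    by rewrite /f indicE mem_setE in_itv/= ltr_distlC.
  have [/set_mem/ball_rV[_ xb]|/negP nb] := boolP ((x : 'rV[R]_d) \in (ball c rho : set 'rV[R]_d)).
    by rewrite big1// => i _; rewrite fE xb.
  have [i xi] : exists i, ~ `|c ord0 i - (x : 'rV[R]_d) ord0 i| < rho.
    apply/existsNP => H; apply: nb; apply/mem_set/ball_rV; split => //.
  by rewrite (bigD1 i)//= fE; move/negP/negbTE : xi => ->; rewrite mul0r.
rewrite leb_prod.
- rewrite (eq_bigr (fun=> (2 * rho)%:E)).
    by rewrite prodEFin prodr_const card_ord.
  move=> i _; rewrite integral_indic// setIT.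
  rewrite [LHS](lebesgue_measure_itv `]c ord0 i - rho, c ord0 i + rho[)/= lte_fin ltrD2l.
  by rewrite gtrN// -EFinD; congr (_%:E); ring.
- by move=> i; exact: measurable_indic.
- by move=> i t; rewrite /f indicE.
Qed.

(* From [x] move along [-v] or [v] until [rho] has decreased linearly in [t]; Lipschitz continuity
   of [rho] then leaves room for a ball of radius proportional to [t]. *)
Lemma interior_ball (rho : 'rV[R]_d -> R) x0 v : smooth_fun rho -> rho x0 = 0 -> 'D_v rho x0 <> 0 ->
  exists2 kap, 0 < kap & forall x t, ball x0 kap x -> rho x < 0 -> 0 < t < kap ->
    exists z, ball z (kap * t) `<=` [set y | rho y < 0] `&` ball x t.
Proof.
move=> srho rho0 Dv0.
pose sg : R := Num.sg ('D_v rho x0).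
pose m : R := `|'D_v rho x0| / 2.
have m0 : 0 < m by rewrite divr_gt0// normr_gt0; apply/eqP.
have sgD : sg * 'D_v rho x0 = 2 * m.
  by rewrite /m mulrCA divff// mulr1 /sg -normrEsg.
have sg1 : `|sg| = 1 by rewrite /sg normr_sg; move/eqP : Dv0 => ->.
pose K : R := 1 + \sum_i `|'D_(evec R i) rho x0|.
have [del del0 H] : exists2 del, 0 < del & forall x, ball x0 del x ->
    m < sg * 'D_v rho x /\ forall i, `|'D_(evec R i) rho x| <= K.
  suff : \forall x \near x0, m < sg * 'D_v rho x /\ forall i, `|'D_(evec R i) rho x| <= K.
    by move=> /nbhs_ballP[del /= del0 H]; exists del.
  have c0 : 'D_v rho x @[x --> x0] --> 'D_v rho x0 by exact: smooth_continuous_derive.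
  have c1 : sg * 'D_v rho x @[x --> x0] --> 2 * m.
    by rewrite -sgD; exact: cvgM (cvg_cst sg) c0.
  have n1 : \forall x \near x0, m < sg * 'D_v rho x.
    by apply: (cvgr_gt _ c1); rewrite mulrDl mul1r ltrDl.
  have n2 : \forall x \near x0, forall i, `|'D_(evec R i) rho x| <= K.
    apply: (@filter_forall _ _ (fun i x => `|'D_(evec R i) rho x| <= K) _ (nbhs_filter x0)) => i.
    have c2 : `|'D_(evec R i) rho x| @[x --> x0] --> `|'D_(evec R i) rho x0|.
      have c3 : 'D_(evec R i) rho x @[x --> x0] --> 'D_(evec R i) rho x0.
        exact: smooth_continuous_derive.
      exact: cvg_norm c3.
    apply: (cvgr_le _ c2).
    rewrite /K (bigD1 i)//= addrCA ltrDl ltr_pwDl// sumr_ge0//.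
  near=> x; split; first by near: x.
  by near: x.
have K0 : 0 < K by rewrite ltr_pwDl// sumr_ge0.
pose A := `|v| + 1; have A0 : 0 < A by rewrite ltr_wpDl.
pose Q := d%:R * K + 1; have Q0 : 0 < Q by rewrite ltr_wpDl// mulr_ge0// ltW.
(* The three bounds keep [ball x t] inside [ball x0 del], put the ball around [z] inside [ball x t],
   and keep the Lipschitz loss [d K kap t] below the decrease [m t / (2 A)] of [rho]. *)
pose kap := Num.min (del / 2) (Num.min (1 / 2) (m / (2 * A * Q))).
have mAQ : 0 < 2 * A * Q by apply: mulr_gt0 => //; exact: mulr_gt0.
have kap0 : 0 < kap by rewrite !lt_min; apply/and3P; split; exact: divr_gt0.
have kdel : kap <= del / 2 by rewrite ge_min lexx.
have k12 : kap <= 1 / 2 by rewrite !ge_min lexx orbT.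
have kA : kap <= m / (2 * A * Q) by rewrite !ge_min lexx !orbT.
exists kap => // x t bx rx /andP[t0 tk].
have t20 : 0 < t / (2 * A) by rewrite divr_gt0// mulr_gt0.
(* The displacement has length [t |v| / (2 A) < t / 2], since [A] exceeds [|v|]. *)
pose a := - (sg * (t / (2 * A))); pose z := x + a *: v.
have Tball y : ball x t y -> ball x0 del y.
  move=> xy; have := ball_triangle bx xy; apply: le_ball.
  by rewrite [leRHS]splitr lerD// (le_trans (ltW tk)).
have xz : ball x (t / 2) z.
  rewrite mx_norm_ball /ball_/= /z opprD addNKr normrN normrZ /a normrN normrM sg1 mul1r.
  rewrite gtr0_norm// [ltLHS](_ : _ = t / 2 * (`|v| / A)); last by field; rewrite gt_eqF.
  by rewrite gtr_pMr ?divr_gt0// ltr_pdivrMr// mul1r ltrDl.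
have zt y : ball z (kap * t) y -> ball x t y.
  move=> zy; have := ball_triangle xz zy; apply: le_ball.
  by rewrite [leRHS]splitr lerD2l mulrC ler_pM2l// -[2^-1]mul1r.
exists z => y zy; split; last exact: zt.
rewrite /=.
have bz : ball x0 del z by apply: Tball; apply: (le_ball _ xz); rewrite ler_pdivrMr// ler_peMr ?ler1n// ltW.
have by_ : ball x0 del y by apply/Tball/zt.
have [th /andP[th0 th1] E] := mvt_line x a (fun x' => @smooth_derivable R d rho v x' srho).
have [mD _] : m < sg * 'D_v rho (x + (th * a) *: v) /\ True.
  split => //; apply: (H _ _).1; apply: Tball.
  move: xz; rewrite !mx_norm_ball /ball_/= !opprD !addNKr !normrN !normrZ (ger0_norm th0).
  move=> xz; apply: (@le_lt_trans _ _ (`|a| * `|v|)).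
    by rewrite -mulrA ler_piMl// mulr_ge0.
  by apply: (lt_le_trans xz); rewrite ler_pdivrMr// ler_peMr ?ler1n// ltW.
have zle : rho z < - (m * (t / (2 * A))).
  have -> : rho z = rho x + a * 'D_v rho (x + (th * a) *: v) by rewrite -E addrC subrK.
  rewrite -[ltRHS]add0r ltrD// /a mulNr ltrN2 [ltRHS](_ : _ = sg * 'D_v rho (x + (th * a) *: v) * (t / (2 * A))).
    by rewrite ltr_pM2r.
  by rewrite /a mulrAC.
have := partial_lipschitz (fun i x' => @smooth_derivable R d rho (evec R i) x' srho)
  (fun i x' bx' => (H x' bx').2 i) bz by_ (r := kap * t).
move/ball_rV : zy => [_ zy] /(_ (fun i => ltW (zy i))) lip.
have le2 : d%:R * (K * (kap * t)) <= m * (t / (2 * A)).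
  apply: (@le_trans _ _ (Q * (m / (2 * A * Q) * t))); last first.
    rewrite le_eqVlt; apply/orP; left; apply/eqP; rewrite /Q in Q0 *.
    by field; rewrite !gt_eqF.
  rewrite mulrA; apply: ler_pM; rewrite ?mulr_ge0 ?(ltW K0) ?(ltW kap0) ?(ltW t0)//.
    by rewrite lerDl.
  by rewrite ler_pM2r.
rewrite -[rho y](subrK (rho z)) (le_lt_trans (lerD (le_trans (ler_norm _) (le_trans lip le2)) (lexx _)))//.
by rewrite -ltrBrDl sub0r.
Unshelve. all: by end_near.
Qed.

End Density.

(** * Uniform density of the domain *)

Section Nash.
Variable R : realType.
Variable d : nat.
Notation L := (leb R d).
Notation V := (rVb R d).
Notation P := (leb R d \x leb R d)%E.
Variable Om : set 'rV[R]_d.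

(** Near a zero of [rho] this is [interior_ball], near a point of [Om] a small ball around the point
    itself fits; compactness makes the constant uniform. *)
Lemma density : smooth_bounded_domain Om -> exists2 kap, 0 < kap & forall x t,
  Om x -> 0 < t < kap -> (((kap * t) ^+ d)%:E <= L (Om `&` ball x t))%E.
Proof.
move=> [oO _ _ [M OM] [rho [srho OE rhoD]]].
have mO (x : 'rV[R]_d) t : measurable (Om `&` ball x t : set V).
  by apply: measurable_rVb; apply: openI => //; exact: ball_open.
(* A compact set containing [Om] on which every point is either in [Om] or a zero of [rho]. *)
pose K : set 'rV[R]_d := [set x | rho x <= 0 /\ `|x| <= M].
have OK : Om `<=` K.
  move=> x Ox; split; last exact: le_trans (norm_le_enorm x) (OM x Ox).
  by move: Ox; rewrite OE => /ltW.
have cK : compact K.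
  apply: bounded_closed_compact.
    exists M; split; first exact: num_real.
    by move=> N MN x [_ xM]; exact: le_trans xM (ltW MN).
  rewrite (_ : K = (rho @^-1` [set r | r <= 0]) `&` ((fun x => `|x|) @^-1` [set r | r <= M])).
    apply: closedI; apply: preimage_closed => //; try exact: closed_le.
      by move=> x _; exact: smooth_continuous.
    by move=> x _; exact: norm_continuous.
  by [].
pose Q kap x := Om x -> forall t, 0 < t < kap -> (((kap * t) ^+ d)%:E <= L (Om `&` ball x t))%E.
have ballQ x t z r kap : 0 < t -> 0 < kap -> kap * t <= r -> ball z r `<=` Om `&` ball x t ->
    (((kap * t) ^+ d)%:E <= L (Om `&` ball x t))%E.
  move=> t0 k0 kr sub; have r0 : 0 < r by rewrite (lt_le_trans _ kr) ?mulr_gt0.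
  apply: (@le_trans _ _ (L (ball z r))).
    rewrite leb_ball// lee_fin lerXn2r ?nnegrE ?mulr_ge0 ?(ltW t0) ?(ltW k0) ?(ltW r0)//.
    by rewrite (le_trans kr)// ler_peMl ?(ltW r0)// ler1n.
  apply: le_measure => //; rewrite inE; first by apply: measurable_rVb; exact: ball_open.
  exact: mO.
move/compact_near_coveringP : cK => /(_ R (0 : R)^'+ Q _).
have QK x : K x -> \forall x' \near x & i \near (0 : R)^'+, Q i x'.
  move=> [rx _].
  have [de de0 H] : exists2 de, 0 < de & forall x' i, ball x de x' -> 0 < i < de -> Q i x'.
    have [x0|x0] := eqVneq (rho x) 0.
      have [v Dv] := rhoD _ x0.
      have [kap k0 H] := interior_ball srho x0 Dv.
      exists kap => // x' i bx /andP[i0 ik] Ox' t /andP[t0 ti].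
      have rx' : rho x' < 0 by move: Ox'; rewrite OE.
      have tk : 0 < t < kap by rewrite t0 (lt_trans ti).
      have [z sub] := H x' t bx rx' tk.
      apply: (@ballQ x' t z (kap * t)) => //; last by move: sub; rewrite -OE.
      by rewrite ler_pM2r// ltW.
    have : Om x by rewrite OE /= lt_neqAle x0.
    move=> /oO/nbhs_ballP[r /= r0 rO].
    exists (Num.min 1 (r / 2)); first by rewrite lt_min ltr01 divr_gt0.
    move=> x' i bx /andP[i0]; rewrite lt_min => /andP[i1 ir] Ox' t /andP[t0 ti].
    apply: (@ballQ x' t x' t) => //; first by rewrite ler_piMl ?(ltW t0)// ltW.
    move=> y x'y; split => //; apply: rO; have := ball_triangle bx x'y; apply: le_ball.
    rewrite [leRHS]splitr lerD//; first by rewrite ge_min lexx orbT.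
    by rewrite (le_trans (ltW ti))// ltW.
  exists (ball x de, [set i | 0 < i < de]) => /=.
    split; first exact: nbhsx_ballx.
    near=> i; apply/andP; split; near: i; first exact: nbhs_right_gt.
    exact: nbhs_right_lt.
  by move=> [x' i] [/= bx id]; exact: H.
move=> /(_ QK) nK.
have : \forall kap \near (0 : R)^'+, 0 < kap /\ K `<=` Q kap.
  near=> kap; split; near: kap; last exact: nK.
  exact: nbhs_right_gt.
move=> /filter_ex[kap [k0 KQ]]; exists kap => // x t Ox.
exact: (KQ x (OK x Ox) Ox).
Unshelve. all: by end_near.
Qed.

Lemma enorm_le_norm (x : 'rV[R]_d) : enorm x <= d%:R * `|x|.
Proof.
rewrite -(@ler_pXn2r _ 2)// ?nnegrE ?sqrtr_ge0 ?mulr_ge0// sqr_sqrtr ?sqn_ge0//.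
apply: (@le_trans _ _ (\sum_(i < d) `|x| ^+ 2)).
  apply: ler_sum => i _; rewrite -[leLHS]real_normK ?num_real// lerXn2r ?nnegrE//.
  have -> : `|x| = mx_norm x by [].
  by rewrite mx_normrE; apply/bigmax_geP; right => /=; exists (ord0, i).
rewrite sumr_const card_ord exprMn -[leLHS]mulr_natl ler_wpM2r ?sqr_ge0//.
by rewrite -natrX ler_nat; case: (d) => // n; rewrite expnS leq_pmulr.
Qed.

End Nash.

(** * The Nash type inequality *)

Section NashInequality.
Variable R : realType.
Variable d : nat.
Notation L := (leb R d).
Notation V := (rVb R d).
Notation P := (leb R d \x leb R d)%E.
Variable s : R.
Hypotheses (s01 : 0 < s < 1) (sd : 2 * s < d%:R).
Variable Om : set 'rV[R]_d.
Hypothesis sbO : smooth_bounded_domain Om.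
Let s0 : 0 < s. Proof. by case/andP: s01. Qed.
Let oO : open Om. Proof. by case: sbO. Qed.
Let d0 : 0 < d%:R :> R. Proof. by rewrite (lt_trans _ sd)// mulr_gt0. Qed.

Definition close_ind (t : R) (x y : 'rV[R]_d) : R := (`|x - y| < t)%R%:R.

Lemma measurable_close_ind t : measurable_fun [set: V * V] (fun z => close_ind t z.1 z.2).
Proof.
have mn : measurable_fun [set: V] (fun x : 'rV[R]_d => `|x|).
  by apply: continuous_measurable_rVb => x; exact: norm_continuous.
have ml : measurable_fun setT (fun r : R => (r < t)%R%:R : R).
  rewrite (_ : (fun r => _) = (fun r => if r < t then 1 else 0)); last first.
    by apply/funext => r; case: ifP.
  by apply: measurable_fun_ifT => //; exact: measurable_fun_ltr.
exact: (measurableT_comp ml (measurableT_comp mn (@measurable_rVb_sub R d))).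
Qed.

(** Restricted to distinct points because [kern] is [0] on the diagonal, by the convention for
    powers of zero. *)
Lemma kern_ge t (x y : 'rV[R]_d) : x != y -> `|x - y| < t ->
  1 <= (d%:R * t) `^ (d%:R + 2 * s) * kern s x y.
Proof.
move=> xy xyt; have e0 : 0 < enorm (x - y) by rewrite enorm_gt0// subr_eq0.
rewrite /kern powRN ler_pdivlMr ?powR_gt0// mul1r.
have t0 : 0 <= t by rewrite (le_trans _ (ltW xyt)).
apply: ge0_ler_powR; rewrite ?nnegrE ?(ltW e0)//.
- by rewrite addr_ge0 ?mulr_ge0 ?(ltW s0).
- by rewrite mulr_ge0.
- by apply: (le_trans (enorm_le_norm _)); rewrite ler_wpM2l// ltW.
Qed.

Definition inner_energy (phi : V -> R) : \bar R :=
  (\int[P]_z (\1_Om z.1 * \1_Om z.2 * (phi z.1 - phi z.2) ^+ 2 * kern s z.1 z.2)%:E)%E.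

(* Integrate [a^2 <= (a - b)^2 + 2 |a| |b|], with [a = phi x] and [b = phi y], over the pairs
   at distance less than [t]: each [x] sees a mass of order [t^d], while
   [1 <= (d t)^(d + 2s) kern s x y]. *)
Lemma nash (eps : R) : 0 < eps -> exists2 C, 0 <= C & forall phi : V -> R, measurable_fun setT phi ->
  (\int[L]_x (\1_Om x * phi x ^+ 2)%:E <=
   eps%:E * inner_energy phi + C%:E * (\int[L]_x (\1_Om x * `|phi x|)%:E * \int[L]_x (\1_Om x * `|phi x|)%:E))%E.
Proof.
move=> e0; have [kap k0 Hk] := density sbO.
pose a : R := d%:R `^ (d%:R + 2 * s) / kap ^+ d.
have a0 : 0 < a by rewrite divr_gt0 ?powR_gt0 ?exprn_gt0.
(* The first bound makes [density] applicable; the second makes the energy coefficient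
   [T / m = a * t^(2s)] at most [eps]. *)
pose t := Num.min (kap / 2) ((eps / a) `^ (2 * s)^-1).
have t0 : 0 < t by rewrite lt_min !divr_gt0// powR_gt0// divr_gt0.
have tk : 0 < t < kap.
  by rewrite t0/= gt_min ltr_pdivrMr// ltr_pMr// ltr1n.
have ta : a * t `^ (2 * s) <= eps.
  rewrite mulrC -ler_pdivlMr//.
  apply: (@le_trans _ _ (((eps / a) `^ (2 * s)^-1) `^ (2 * s))).
    apply: ge0_ler_powR; rewrite ?nnegrE ?mulr_ge0 ?powR_ge0 ?(ltW s0) ?(ltW t0)//.
    by rewrite ge_min lexx orbT.
  by rewrite -powRrM mulVf ?powRr1 ?mulf_neq0 ?gt_eqF// ltW// divr_gt0.
pose m := (kap * t) ^+ d; have m0 : 0 < m by rewrite exprn_gt0// mulr_gt0.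
pose T := (d%:R * t) `^ (d%:R + 2 * s).
have T0 : 0 <= T by exact: powR_ge0.
have TE : T / m = a * t `^ (2 * s).
  rewrite /T /m powRM ?(ltW d0) ?(ltW t0)// [t `^ _]powRD ?(gt_eqF t0) ?implybT//.
  rewrite powR_mulrn ?(ltW t0)// exprMn /a.
  have td : 0 < t ^+ d by rewrite exprn_gt0.
  have kd : 0 < kap ^+ d by rewrite exprn_gt0.
  by field; rewrite !gt_eqF.
exists (2 / m); first by rewrite divr_ge0// ltW.
move=> phi mphi; set A := (\int[L]_x (\1_Om x * `|phi x|)%:E)%E.
have mi := measurable_indic_open oO.
have i0 x : 0 <= \1_Om x :> R by have /andP[] := indic01 Om x.
have m1 (g : V -> R) : measurable_fun setT g -> measurable_fun [set: V * V] (fun z => g z.1).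
  by move=> mg; exact: (measurableT_comp mg measurable_fst).
have m2 (g : V -> R) : measurable_fun setT g -> measurable_fun [set: V * V] (fun z => g z.2).
  by move=> mg; exact: (measurableT_comp mg measurable_snd).
pose g (x : V) := \1_Om x * phi x ^+ 2.
have mg : measurable_fun setT g by apply: measurable_funM => //; exact: measurable_funX.
have g0 x : 0 <= g x by rewrite mulr_ge0 ?sqr_ge0.
pose K (x y : V) := (\1_Om y * close_ind t x y)%:E.
have c0 (x y : 'rV[R]_d) : 0 <= close_ind t x y by rewrite /close_ind.
have K0 x y : (0 <= K x y)%E by rewrite lee_fin mulr_ge0.
have mc := measurable_close_ind t.
have mK : measurable_fun [set: V * V] (fun z => K z.1 z.2).
  by apply/measurable_EFinP; apply: measurable_funM => //; exact: m2.
have IK x : Om x -> (m%:E <= \int[L]_y K x y)%E.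
  move=> Ox; apply: (le_trans (Hk x t Ox tk)).
  rewrite -[Om `&` ball x t]setIT -integral_indic//; last first.
    by apply: measurable_rVb; apply: openI => //; exact: ball_open.
  rewrite le_eqVlt; apply/orP; left; apply/eqP; apply: eq_integral => y _.
  rewrite /K !indicE in_setI /close_ind; case: (_ \in Om); rewrite /= ?mul0r// mul1r.
  congr (_%:R%:E); congr (nat_of_bool _); apply/idP/idP => [/set_mem|xy].
    by rewrite mx_norm_ball.
  by apply/mem_set; rewrite mx_norm_ball.
have mIK : measurable_fun [set: V] (fun x => \int[L]_y K x y)%E.
  by apply: (measurable_fun_fubini_tonelli_F (m2 := L) _ mK) => z; exact: K0.
have mgE : measurable_fun [set: V] (fun x => (g x)%:E) by exact/measurable_EFinP.
have step1 : (m%:E * \int[L]_x (g x)%:E <= \int[P]_z ((g z.1)%:E * K z.1 z.2))%E.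
  rewrite (integral_fstK K0 mK mg g0) -ge0_integralZl//; first last.
  - by rewrite lee_fin ltW.
  - by move=> x _; rewrite lee_fin.
  apply: ge0_le_integral => //.
  - by move=> x _; rewrite -EFinM lee_fin mulr_ge0// ltW.
  - exact: measurable_funeM.
  - exact: emeasurable_funM.
  move=> x _; have [Ox|nOx] := pselect (Om x).
    by rewrite muleC; apply: lee_wpmul2l; rewrite ?lee_fin// IK.
  by rewrite /g indicE memNset// mul0r mule0 mul0e.
pose h (x : V) := \1_Om x * `|phi x|.
have mh : measurable_fun setT h by apply: measurable_funM => //; exact: measurableT_comp.
have h0 x : 0 <= h x by rewrite mulr_ge0.
pose H (x y : V) := (h y)%:E.
have mH : measurable_fun [set: V * V] (fun z => H z.1 z.2).
  by apply/measurable_EFinP; exact: m2.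
have H0 x y : (0 <= H x y)%E by rewrite lee_fin.
have AA : (\int[P]_z ((h z.1)%:E * H z.1 z.2) = A * A)%E.
  rewrite (integral_fstK H0 mH mh h0) /H ge0_integralZr//; last first.
  - by apply: integral_ge0 => x _; rewrite lee_fin.
  - by move=> x _; rewrite lee_fin.
  - exact/measurable_EFinP.
pose E (z : V * V) := (\1_Om z.1 * \1_Om z.2 * (phi z.1 - phi z.2) ^+ 2 * kern s z.1 z.2)%:E.
have E0 z : (0 <= E z)%E.
  by rewrite lee_fin; apply: mulr_ge0; rewrite ?kern_ge0//; apply: mulr_ge0; rewrite ?sqr_ge0// mulr_ge0.
have mE : measurable_fun setT E.
  apply/measurable_EFinP; apply: measurable_funM; last exact: (@measurable_kern R d s).
  apply: measurable_funM; first by apply: measurable_funM; [exact: m1|exact: m2].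
  by apply: measurable_funX; apply: measurable_funB; [exact: m1|exact: m2].
have mHH : measurable_fun setT (fun z : V * V => (h z.1)%:E * H z.1 z.2)%E.
  by apply: emeasurable_funM => //; apply/measurable_EFinP; exact: m1.
have HH0 z : (0 <= (h z.1)%:E * H z.1 z.2)%E by apply: mule_ge0; rewrite lee_fin.
have step2 : (\int[P]_z ((g z.1)%:E * K z.1 z.2) <= T%:E * \int[P]_z E z + 2%:E * (A * A))%E.
  rewrite -AA -!ge0_integralZl//.
  have mTE : measurable_fun setT (fun z => T%:E * E z)%E by exact: measurable_funeM.
  have m2H : measurable_fun setT (fun z : V * V => 2%:E * ((h z.1)%:E * H z.1 z.2))%E.
    exact: measurable_funeM.
  rewrite -ge0_integralD//; first last.
  - by move=> z _; rewrite mule_ge0.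
  - by move=> z _; rewrite mule_ge0.
  apply: ge0_le_integral => //.
  - by move=> z _; apply: mule_ge0; rewrite ?K0// lee_fin.
  - by apply: emeasurable_funM => //; apply/measurable_EFinP; exact: m1.
  - exact: emeasurable_funD.
  case=> x y _ /=; rewrite /K /E /H /h /g -!EFinM -EFinD lee_fin /=.
  rewrite !indicE; case: (x \in Om); case: (y \in Om); rewrite ?mulr0 ?mul0r ?mulr0 ?addr0 ?mul0r//.
  rewrite !mul1r /close_ind; have [xyt|_] := ltP; last first.
    rewrite mulr0; apply: addr_ge0; apply: mulr_ge0 => //; apply: mulr_ge0 => //.
      exact: sqr_ge0.
    exact: kern_ge0.
  rewrite mulr1; apply: (@le_trans _ _ ((phi x - phi y) ^+ 2 + 2 * (`|phi x| * `|phi y|))).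
    have := ler_norm (phi x * phi y); rewrite normrM => le1; rewrite -subr_ge0.
    rewrite [X in 0 <= X](_ : _ = phi y ^+ 2 + 2 * (`|phi x| * `|phi y| - phi x * phi y)); last by ring.
    by rewrite addr_ge0 ?sqr_ge0// mulr_ge0// subr_ge0.
  rewrite lerD2r; have [->|xy] := eqVneq x y; first by rewrite subrr expr0n mul0r mulr0.
  by rewrite mulrCA ler_peMr ?sqr_ge0// kern_ge.
have IE0 : (0 <= \int[P]_z E z)%E by apply: integral_ge0.
have A0 : (0 <= A)%E by apply: integral_ge0 => x _; rewrite lee_fin h0.
have m10 : (0 <= (m^-1)%:E)%E by rewrite lee_fin invr_ge0 ltW.
have := lee_wpmul2l m10 (le_trans step1 step2).
rewrite muleA -EFinM mulVf ?gt_eqF// mul1e => /le_trans; apply.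
rewrite ge0_muleDr ?mule_ge0// !muleA -!EFinM [m^-1 * T]mulrC [m^-1 * 2]mulrC TE.
by apply: leeD2r; apply: lee_wpmul2r.
Qed.

End NashInequality.

(** * Forms on the energy space *)

Section IteratedIntegrals.
Variable R : realType.
Variable d : nat.
Notation L := (leb R d).
Notation V := (rVb R d).
Notation P := (leb R d \x leb R d)%E.

Lemma borel_funP (f : 'rV[R]_d -> R) : borel_fun f <-> measurable_fun [set: V] f.
Proof.
split=> [bf _ B mB|mf B mB]; first by rewrite setTI; exact: bf.
by have := mf measurableT B mB; rewrite setTI.
Qed.

Lemma iint2E (F : V -> V -> \bar R) : measurable_fun [set: V * V] (fun z => F z.1 z.2) ->
  (forall x y, 0 <= F x y)%E -> iint2 F = (\int[P]_z F z.1 z.2)%E.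
Proof.
move=> mF F0; rewrite fubini_tonelli1//.
rewrite /iint2 iintE.
- apply: eq_integral => x _; rewrite iintE//.
  exact: (measurable_fun_pair2 x mF).
- rewrite (_ : (fun x => _) = (fun x => \int[L]_y F x y)%E).
    by apply: (measurable_fun_fubini_tonelli_F (m2 := L) _ mF) => z; exact: F0.
  by apply/funext => x; rewrite iintE//; exact: (measurable_fun_pair2 x mF).
- move=> x; rewrite iintE//; last exact: (measurable_fun_pair2 x mF).
  exact: integral_ge0.
Qed.

Lemma Rintegral_pos_neg d' (T : measurableType d') (mu : {measure set T -> \bar R}) (f : T -> R) :
  mu.-integrable setT (EFin \o f) ->
  fine (\int[mu]_x (Num.max (f x) 0)%:E) - fine (\int[mu]_x (Num.max (- f x) 0)%:E) =
  (\int[mu]_x f x)%R.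
Proof.
move=> fi; pose F := EFin \o f.
transitivity (fine (\int[mu]_x F^\+ x - \int[mu]_x F^\- x)%E); last by rewrite -integralE.
rewrite [in RHS]fineB ?integrable_pos_fin_num ?integrable_neg_fin_num//.
by congr (_ - _); congr fine; apply: eq_integral => x _; rewrite ?funeposE ?funenegE /= -?EFinN EFin_max.
Qed.

(** [sint] subtracts two [fine] values, which is meaningful as an integral only for integrable
    functions; from here on linearity comes from the Lebesgue integral. *)
Lemma sintE (f : V -> R) : L.-integrable setT (EFin \o f) -> sint f = (\int[L]_x f x)%R.
Proof.
move=> fi; have mf : measurable_fun setT f by apply/measurable_EFinP; exact: measurable_int fi.
rewrite -Rintegral_pos_neg// /sint !iintE//.
- by apply/measurable_EFinP; apply: measurable_maxr => //; exact: measurableT_comp.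
- by move=> x; rewrite lee_fin le_max lexx orbT.
- by apply/measurable_EFinP; exact: measurable_maxr.
- by move=> x; rewrite lee_fin le_max lexx orbT.
Qed.

Lemma sint2E (F : V -> V -> R) : P.-integrable setT (fun z => (F z.1 z.2)%:E) ->
  sint2 F = (\int[P]_z F z.1 z.2)%R.
Proof.
move=> fi; have mf : measurable_fun [set: V * V] (fun z => F z.1 z.2).
  by apply/measurable_EFinP; exact: measurable_int fi.
rewrite -(Rintegral_pos_neg (f := fun z : V * V => F z.1 z.2))// /sint2 !iint2E//.
- by apply/measurable_EFinP; apply: measurable_maxr => //; exact: measurableT_comp.
- by move=> x y; rewrite lee_fin le_max lexx orbT.
- by apply/measurable_EFinP; exact: measurable_maxr.
- by move=> x y; rewrite lee_fin le_max lexx orbT.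
Qed.

(** Whether a nonnegative function has zero integral depends only on where it vanishes. This passes
    between integrands and indicators of null sets. *)
Lemma null_support d' (T : measurableType d') (mu : {measure set T -> \bar R}) (f g : T -> \bar R) :
  measurable_fun setT f -> measurable_fun setT g -> (forall x, 0 <= f x)%E ->
  (forall x, 0 <= g x)%E -> (forall x, f x = 0 -> g x = 0)%E ->
  (\int[mu]_x f x = 0)%E -> (\int[mu]_x g x = 0)%E.
Proof.
move=> mf mg f0 g0 fg If.
have : (\int[mu]_x `|f x| = 0)%E by under eq_integral do rewrite gee0_abs//.
move=> /ae_eq_integral_abs - /(_ measurableT mf) aef.
rewrite (ge0_ae_eq_integral (g := cst 0%E))//; first by rewrite integral0.
by apply: filterS aef => x /(_ I) fx _; exact: fg.
Qed.

Lemma measurable_neq0 (A : set V) (f : V -> R) : measurable A -> measurable_fun setT f ->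
  measurable [set y | A y /\ f y <> 0].
Proof.
move=> mA mf; rewrite (_ : mkset _ = A `&` f @^-1` (~` [set 0])).
  apply: measurableI => //; rewrite -[X in measurable X]setTI; apply: mf => //.
  exact: measurableC.
by [].
Qed.

Lemma ae_zero_onE (A : set V) (f : V -> R) : measurable A -> measurable_fun setT f ->
  ae_zero_on A f <-> (\int[L]_x (\1_[set y | A y /\ f y <> 0] x)%:E = 0)%E.
Proof.
move=> mA mf; rewrite /ae_zero_on iintE//.
by apply/measurable_EFinP/measurable_indic; exact: measurable_neq0.
Qed.

Lemma ae_zero_on_sub (A : set V) (f g h : V -> R) : measurable A ->
  measurable_fun setT f -> measurable_fun setT g -> measurable_fun setT h ->
  (forall x, f x = 0 -> g x = 0 -> h x = 0) ->
  ae_zero_on A f -> ae_zero_on A g -> ae_zero_on A h.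
Proof.
move=> mA mf mg mh fgh /ae_zero_onE-/(_ mA mf) f0 /ae_zero_onE-/(_ mA mg) g0.
apply/ae_zero_onE => //.
have mi (k : V -> R) : measurable_fun setT k ->
    measurable_fun setT (fun x : V => (\1_[set y | A y /\ k y <> 0] x)%:E : \bar R).
  by move=> mk; apply/measurable_EFinP/measurable_indic; exact: measurable_neq0.
have i0 (B : set V) x : (0 <= (\1_B x : R)%:E)%E by rewrite lee_fin indicE.
apply: (null_support (f := fun x => (\1_[set y | A y /\ f y <> 0] x)%:E +
    (\1_[set y | A y /\ g y <> 0] x)%:E)%E) => //.
- by apply: emeasurable_funD; exact: mi.
- exact: mi.
- by move=> x; rewrite adde_ge0.
- move=> x; rewrite !indicE -EFinD => /eqP; rewrite eqe.
  have [|nf] := boolP (x \in [set y | A y /\ f y <> 0]).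
    by rewrite paddr_eq0// oner_eq0.
  rewrite add0r; have [|ng] := boolP (x \in [set y | A y /\ g y <> 0]); first by rewrite oner_eq0.
  move=> _; rewrite memNset// => -[Ax hx]; apply: hx; apply: fgh.
    by apply: contrapT => fx; move/negP : nf; apply; exact/mem_set.
  by apply: contrapT => gx; move/negP : ng; apply; exact/mem_set.
- by rewrite ge0_integralD ?f0 ?g0 ?adde0//; exact: mi.
Qed.

End IteratedIntegrals.

(** * From a gap to a simple isolated eigenvalue *)

Section SpectralGap.
Variables (R : realType) (T : Type) (E : (T -> R) -> Prop).
Variables (a b : (T -> R) -> (T -> R) -> R) (l : (T -> R) -> R) (Z : (T -> R) -> Prop).
Variables (mu c : R) (ubar : T -> R).
Notation lin u v t := (fun x => u x - t * v x).
Hypotheses (Elin : forall u v t, E u -> E v -> E (lin u v t))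
  (aC : forall u v, a u v = a v u) (bC : forall u v, b u v = b v u)
  (alin : forall u v w t, E u -> E v -> E w -> a (lin u v t) w = a u w - t * a v w)
  (blin : forall u v w t, E u -> E v -> E w -> b (lin u v t) w = b u w - t * b v w)
  (llin : forall u v t, E u -> E v -> l (lin u v t) = l u - t * l v)
  (bge0 : forall u, E u -> 0 <= b u u)
  (qge0 : forall u, E u -> mu * b u u <= a u u)
  (c0 : 0 < c)
  (gap : forall u, E u -> l u = 0 -> c * b u u <= a u u - mu * b u u)
  (zero : forall u, E u -> a u u = 0 -> b u u = 0 -> Z u)
  (Eu : E ubar) (bu : 0 < b ubar ubar) (au : a ubar ubar = mu * b ubar ubar).

Let quad_lin (f : (T -> R) -> (T -> R) -> R) :
  (forall u v, f u v = f v u) ->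
  (forall u v w t, E u -> E v -> E w -> f (lin u v t) w = f u w - t * f v w) ->
  forall u v t, E u -> E v ->
    f (lin u v t) (lin u v t) = f u u - 2 * t * f u v + t ^+ 2 * f v v.
Proof.
move=> fC flin u v t Hu Hv; have Hw := Elin t Hu Hv.
rewrite flin// [f u (lin _ _ _)]fC [f v (lin _ _ _)]fC !flin// [f v u]fC.
by ring.
Qed.

(* [q (ubar - t phi) >= 0] is a quadratic polynomial in [t] without constant term. *)
Lemma minimizer_EL phi : E phi -> a ubar phi = mu * b ubar phi.
Proof.
move=> Ephi; pose r := a ubar phi - mu * b ubar phi.
pose Q := a phi phi - mu * b phi phi.
have Q0 : 0 <= Q by rewrite subr_ge0 qge0.
have q1 : 0 < Q + 1 by rewrite ltr_wpDl.
have H t : 0 <= t ^+ 2 * Q - 2 * t * r.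
  have := qge0 (Elin t Eu Ephi).
  rewrite (quad_lin aC alin)// (quad_lin bC blin)// au -subr_ge0.
  by move=> /le_trans; apply; rewrite /Q /r le_eqVlt; apply/orP; left; apply/eqP; ring.
(* The optimal [t] would be [r / Q]; adding one covers [Q = 0] and still gives a negative multiple
   of [r^2]. *)
have := H (r / (Q + 1)).
rewrite [X in 0 <= X](_ : _ = - (r ^+ 2 * (Q + 2) / (Q + 1) ^+ 2)); last first.
  by field; rewrite gt_eqF.
rewrite oppr_ge0 ler_pdivrMr ?exprn_gt0// mul0r => le0.
have : r ^+ 2 <= 0.
  have Q2 : 0 < Q + 2 by rewrite ltr_wpDl.
  by move: le0; rewrite -[leRHS](mul0r (Q + 2)) ler_pM2r.
move=> r20; have : r ^+ 2 == 0 by rewrite eq_le r20 sqr_ge0.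
by rewrite sqrf_eq0 => /eqP/eqP; rewrite subr_eq0 => /eqP.
Qed.

Lemma minimizer_mean_neq0 : l ubar != 0.
Proof.
apply/eqP => l0; have := gap Eu l0; rewrite au subrr.
by apply/negP; rewrite -ltNge mulr_gt0.
Qed.

Lemma eigenvalue_simple v : E v -> (forall phi, E phi -> a v phi = mu * b v phi) ->
  exists C, Z (lin v ubar C).
Proof.
move=> Ev Hv; pose C := l v / l ubar; exists C.
have Ew := Elin C Ev Eu; set w := lin _ _ _ in Ew *.
have lw : l w = 0 by rewrite llin// divfK ?minimizer_mean_neq0// subrr.
have aw : a w w = mu * b w w.
  by rewrite {1}/w alin// Hv// (minimizer_EL Ew) [in RHS]/w blin//; ring.
have bw : b w w = 0.
  apply/eqP; rewrite eq_le bge0// andbT; have := gap Ew lw.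
  by rewrite aw subrr pmulr_rle0.
by apply: zero; rewrite ?aw ?bw ?mulr0.
Qed.

Lemma eigenvalue_isolated lam v : mu < lam < mu + c -> E v ->
  (forall phi, E phi -> a v phi = lam * b v phi) -> Z v.
Proof.
move=> /andP[ml lc] Ev Hv.
have bvu : b v ubar = 0.
  have : lam * b v ubar = mu * b v ubar by rewrite -Hv// aC minimizer_EL// bC.
  move/eqP; rewrite -subr_eq0 -mulrBl mulf_eq0 subr_eq0 gt_eqF//= => /eqP.
  by [].
have avu : a v ubar = 0 by rewrite Hv// bvu mulr0.
pose C := l v / l ubar; have Ew := Elin C Ev Eu.
have lw : l (lin v ubar C) = 0 by rewrite llin// divfK ?minimizer_mean_neq0// subrr.
have := gap Ew lw; rewrite (quad_lin aC alin)// (quad_lin bC blin)// avu bvu au Hv//.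
move=> H; have bv : b v v = 0.
  apply/eqP; rewrite eq_le bge0// andbT leNgt; apply/negP => bv0.
  have : c * b v v <= (lam - mu) * b v v.
    apply: le_trans (le_trans _ H) _.
      rewrite ler_wpM2l ?(ltW c0)// mulr0 subr0 lerDl mulr_ge0 ?sqr_ge0 ?ltW//.
    by rewrite le_eqVlt; apply/orP; left; apply/eqP; ring.
  by rewrite ler_pM2r// leNgt ltrBlDl lc.
by apply: zero; rewrite ?Hv ?bv ?mulr0.
Qed.

End SpectralGap.

(** * Integrability and linearity of the energy, the Hardy form and the mean *)

Section Forms.
Variable R : realType.
Variable d : nat.
Notation L := (leb R d).
Notation V := (rVb R d).
Notation P := (leb R d \x leb R d)%E.

Lemma integrable_dom2 d' (T : measurableType d') (mu : {measure set T -> \bar R})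
    (f g h : T -> R) (c1 c2 : R) :
  measurable_fun setT f -> measurable_fun setT g -> measurable_fun setT h ->
  (forall x, 0 <= g x) -> (forall x, 0 <= h x) -> 0 <= c1 -> 0 <= c2 ->
  (forall x, `|f x| <= c1 * g x + c2 * h x) ->
  (\int[mu]_x (g x)%:E < +oo)%E -> (\int[mu]_x (h x)%:E < +oo)%E ->
  mu.-integrable setT (EFin \o f).
Proof.
move=> mf mg mh g0 h0 c10 c20 fgh ig ih; apply/integrableP; split; first exact/measurable_EFinP.
have mgE : measurable_fun setT (fun x => (g x)%:E) by exact/measurable_EFinP.
have mhE : measurable_fun setT (fun x => (h x)%:E) by exact/measurable_EFinP.
have mcg : measurable_fun setT (fun x => c1%:E * (g x)%:E)%E by exact: measurable_funeM.
have mch : measurable_fun setT (fun x => c2%:E * (h x)%:E)%E by exact: measurable_funeM.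
apply: (@le_lt_trans _ _ (\int[mu]_x (c1%:E * (g x)%:E + c2%:E * (h x)%:E))%E).
  apply: ge0_le_integral => //.
  - by apply: measurableT_comp => //; exact/measurable_EFinP.
  - exact: emeasurable_funD.
  - by move=> x _; rewrite /= -!EFinM -EFinD lee_fin.
rewrite ge0_integralD//; first last.
- by move=> x _; rewrite -EFinM lee_fin mulr_ge0.
- by move=> x _; rewrite -EFinM lee_fin mulr_ge0.
rewrite !ge0_integralZl//; first last.
- by move=> x _; rewrite lee_fin.
- by move=> x _; rewrite lee_fin.
by apply: lte_add_pinfty; apply: lte_mul_pinfty.
Qed.

Lemma integrableZ_EFin d' (T : measurableType d') (mu : {measure set T -> \bar R}) (f : T -> R) t :
  mu.-integrable setT (EFin \o f) -> mu.-integrable setT (EFin \o (fun x => t * f x)).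
Proof.
move=> fi; rewrite (_ : EFin \o _ = (fun x => t%:E * (EFin \o f) x)%E)//.
exact: integrableZl.
Qed.

Lemma ge0_integrable_lty d' (T : measurableType d') (mu : {measure set T -> \bar R}) (f : T -> R) :
  (forall x, 0 <= f x) -> mu.-integrable setT (EFin \o f) -> (\int[mu]_x (f x)%:E < +oo)%E.
Proof.
move=> f0 /integrableP[_]; congr (_ < _)%E; apply: eq_integral => x _ /=.
by rewrite ger0_norm.
Qed.

Variable s : R.
Hypotheses (s01 : 0 < s < 1) (sd : 2 * s < d%:R).
Variables (Om D : set 'rV[R]_d).
Hypotheses (sbO : smooth_bounded_domain Om) (O0 : Om 0) (oD : open D).
Let s0 : 0 < s. Proof. by case/andP: s01. Qed.
Let oO : open Om. Proof. by case: sbO. Qed.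
Implicit Types u v w phi : 'rV[R]_d -> R.
Notation Es := (Es s D).
Notation En := (energy s Om).
Notation Hf := (hardy_form s Om).

Definition seminorm_int u (z : V * V) : R := (u z.1 - u z.2) ^+ 2 * kern s z.1 z.2.

(** As a maximum of functions of one coordinate, the indicator is visibly measurable for the product
    sigma-algebra. *)
Lemma DOmE x y : DOm Om x y = Num.max (\1_Om x) (\1_Om y).
Proof.
rewrite /DOm !indicE; case: (boolP (x \in Om)) => [/set_mem Ox|/negP nx].
  by rewrite mem_set/=; [rewrite max_l//; case: (_ \in _); rewrite ?ler01|left].
case: (boolP (y \in Om)) => [/set_mem Oy|/negP ny].
  by rewrite mem_set/=; [rewrite max_r|right].
by rewrite memNset/=; [rewrite maxxx|move=> [Ox|Oy]; [apply: nx|apply: ny]; exact: mem_set].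
Qed.

Lemma DOm_ge0 x y : 0 <= DOm Om x y.
Proof. by rewrite /DOm indicE. Qed.

Lemma DOm_le1 x y : DOm Om x y <= 1.
Proof. by rewrite /DOm indicE; case: (_ \in _); rewrite ?ler01. Qed.

Lemma measurable_fun1 (g : V -> R) : measurable_fun setT g ->
  measurable_fun [set: V * V] (fun z => g z.1).
Proof. by move=> mg; exact: (measurableT_comp mg measurable_fst). Qed.

Lemma measurable_fun2 (g : V -> R) : measurable_fun setT g ->
  measurable_fun [set: V * V] (fun z => g z.2).
Proof. by move=> mg; exact: (measurableT_comp mg measurable_snd). Qed.

Lemma measurable_DOm : measurable_fun [set: V * V] (fun z => DOm Om z.1 z.2).
Proof.
under eq_fun do rewrite DOmE; apply: measurable_maxr.
  exact: measurable_fun1 (measurable_indic_open oO).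
exact: measurable_fun2 (measurable_indic_open oO).
Qed.

Lemma measurable_diff (u : V -> R) : measurable_fun setT u ->
  measurable_fun [set: V * V] (fun z => u z.1 - u z.2).
Proof. by move=> mu; apply: measurable_funB; [exact: measurable_fun1|exact: measurable_fun2]. Qed.

Lemma measurable_seminorm_int (u : V -> R) : measurable_fun setT u ->
  measurable_fun setT (seminorm_int u).
Proof.
move=> mu; apply: measurable_funM; last exact: (@measurable_kern R d s).
by apply: measurable_funX; exact: measurable_diff.
Qed.

Lemma seminorm_int_ge0 u z : 0 <= seminorm_int u z.
Proof. by rewrite mulr_ge0 ?sqr_ge0 ?kern_ge0. Qed.

Lemma EsP u : Es u <-> [/\ measurable_fun [set: V] u, (\int[L]_x (u x ^+ 2)%:E < +oo)%E,
  (\int[P]_z (seminorm_int u z)%:E < +oo)%E & ae_zero_on D u].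
Proof.
have E1 : measurable_fun [set: V] u ->
    iint (fun x => (u x ^+ 2)%:E) = (\int[L]_x (u x ^+ 2)%:E)%E.
  move=> mu; rewrite iintE//; last by move=> x; rewrite lee_fin sqr_ge0.
  by apply/measurable_EFinP; exact: measurable_funX.
have E2 : measurable_fun [set: V] u ->
    iint2 (fun x y => ((u x - u y) ^+ 2 * kern s x y)%:E) = (\int[P]_z (seminorm_int u z)%:E)%E.
  move=> mu; rewrite iint2E//; last by move=> x y; rewrite lee_fin (seminorm_int_ge0 u (x, y)).
  by apply/measurable_EFinP; exact: measurable_seminorm_int.
split=> [[[/borel_funP mu]]|[mu]].
  by rewrite E1// E2// => i1 i2 z; split.
by rewrite -E1// -E2// => i1 i2 z; split => //; split => //; exact/borel_funP.
Qed.

Let mD : measurable (D : set V). Proof. exact: measurable_rVb. Qed.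

Lemma Es_lin u v t : Es u -> Es v -> Es (fun x => u x - t * v x).
Proof.
move=> /EsP[mu u2 us uz] /EsP[mv v2 vs vz].
have mw : measurable_fun [set: V] (fun x => u x - t * v x).
  by apply: measurable_funB => //; exact: measurable_funM.
have ineq (a b : R) : (a - t * b) ^+ 2 <= 2 * a ^+ 2 + 2 * t ^+ 2 * b ^+ 2.
  rewrite -subr_ge0 [X in 0 <= X](_ : _ = (a + t * b) ^+ 2); last by ring.
  exact: sqr_ge0.
have t20 : 0 <= 2 * t ^+ 2 by apply: mulr_ge0; rewrite ?sqr_ge0.
apply/EsP; split => //.
- apply: ge0_integrable_lty; first by move=> x; exact: sqr_ge0.
  apply: (@integrable_dom2 _ V L _ (fun x => u x ^+ 2) (fun x => v x ^+ 2) 2 (2 * t ^+ 2)) => //.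
  + exact: measurable_funX.
  + exact: measurable_funX.
  + exact: measurable_funX.
  + by move=> x; exact: sqr_ge0.
  + by move=> x; exact: sqr_ge0.
  + by move=> x; rewrite ger0_norm ?sqr_ge0.
- apply: ge0_integrable_lty; first by move=> z; exact: seminorm_int_ge0.
  apply: (@integrable_dom2 _ _ P _ (seminorm_int u) (seminorm_int v) 2 (2 * t ^+ 2)) => //.
  + exact: measurable_seminorm_int.
  + exact: measurable_seminorm_int.
  + exact: measurable_seminorm_int.
  + exact: seminorm_int_ge0.
  + exact: seminorm_int_ge0.
  + move=> z; rewrite ger0_norm ?seminorm_int_ge0// /seminorm_int.
    rewrite [leRHS](_ : _ = (2 * (u z.1 - u z.2) ^+ 2 + 2 * t ^+ 2 * (v z.1 - v z.2) ^+ 2) *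
      kern s z.1 z.2); last by ring.
    rewrite ler_wpM2r ?kern_ge0// (_ : _ - _ = (u z.1 - u z.2) - t * (v z.1 - v z.2)); last by ring.
    exact: ineq.
- by apply: (ae_zero_on_sub mD mu mv mw _ uz vz) => x -> ->; rewrite mulr0 subr0.
Qed.

(** Makes [|u|] a competitor for [LambdaN]; the seminorm does not increase because
    [||a| - |b|| <= |a - b|]. *)
Lemma Es_abs u : Es u -> Es (fun x => `|u x|).
Proof.
move=> /EsP[mu u2 us uz].
have ma : measurable_fun [set: V] (fun x => `|u x|) by exact: measurableT_comp.
apply/EsP; split => //.
- rewrite (eq_integral (fun x : V => (u x ^+ 2)%:E))// => x _.
  by rewrite -normrX ger0_norm ?sqr_ge0.
- apply: le_lt_trans us; apply: ge0_le_integral => //.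
  + by move=> z _; rewrite lee_fin seminorm_int_ge0.
  + by apply/measurable_EFinP; exact: measurable_seminorm_int.
  + by apply/measurable_EFinP; exact: measurable_seminorm_int.
  move=> z _; rewrite lee_fin ler_wpM2r ?kern_ge0//.
  by rewrite -[leRHS]real_normK ?num_real// -[leLHS]real_normK ?num_real// lerXn2r ?nnegrE// ler_dist_dist.
- by apply: (ae_zero_on_sub mD mu mu ma _ uz uz) => x -> _; rewrite normr0.
Qed.

Definition energy_int u v (z : V * V) : R :=
  DOm Om z.1 z.2 * ((u z.1 - u z.2) * (v z.1 - v z.2)) * kern s z.1 z.2.

Lemma measurable_energy_int (u v : V -> R) : measurable_fun setT u -> measurable_fun setT v ->
  measurable_fun setT (energy_int u v).
Proof.
move=> mu mv; apply: measurable_funM; last exact: (@measurable_kern R d s).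
apply: measurable_funM; first exact: measurable_DOm.
by apply: measurable_funM; exact: measurable_diff.
Qed.

Lemma amgm (a b : R) : `|a * b| <= 1 * a ^+ 2 + 1 * b ^+ 2.
Proof.
rewrite !mul1r ler_norml; have := sqr_ge0 (a + b); have := sqr_ge0 (a - b).
have := sqr_ge0 a; have := sqr_ge0 b.
have -> : (a + b) ^+ 2 = a ^+ 2 + b ^+ 2 + 2 * (a * b) by ring.
have -> : (a - b) ^+ 2 = a ^+ 2 + b ^+ 2 - 2 * (a * b) by ring.
by move: (a ^+ 2) (b ^+ 2) (a * b) => p q r; lra.
Qed.

Lemma integrable_energy u v : Es u -> Es v -> P.-integrable setT (EFin \o energy_int u v).
Proof.
move=> /EsP[mu _ us _] /EsP[mv _ vs _].
apply: (@integrable_dom2 _ _ P _ (seminorm_int u) (seminorm_int v) 1 1) => //.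
- exact: measurable_energy_int.
- exact: measurable_seminorm_int.
- exact: measurable_seminorm_int.
- exact: seminorm_int_ge0.
- exact: seminorm_int_ge0.
move=> z; rewrite /energy_int normrM [`|kern _ _ _|]ger0_norm ?kern_ge0//.
rewrite [leRHS](_ : _ = (1 * (u z.1 - u z.2) ^+ 2 + 1 * (v z.1 - v z.2) ^+ 2) *
  kern s z.1 z.2); last by rewrite /seminorm_int; ring.
rewrite ler_wpM2r ?kern_ge0//; apply: le_trans (amgm _ _).
by rewrite normrM ger0_norm ?DOm_ge0// ler_piMl ?DOm_le1.
Qed.

Lemma energyE u v : Es u -> Es v -> En u v = ads d s / 2 * (\int[P]_z energy_int u v z)%R.
Proof. by move=> Eu Ev; rewrite /energy sint2E//; exact: integrable_energy. Qed.

Lemma energyC u v : En u v = En v u.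
Proof.
congr (_ * sint2 _); apply/funext => x; apply/funext => y.
by rewrite [(u x - u y) * _]mulrC.
Qed.

Lemma energy_lin u v w t : Es u -> Es v -> Es w ->
  En (fun x => u x - t * v x) w = En u w - t * En v w.
Proof.
move=> Eu Ev Ew; rewrite !energyE//; last exact: Es_lin.
have iu := integrable_energy Eu Ew; have iv := integrable_energy Ev Ew.
rewrite mulrCA -mulrBr; congr (_ * _).
rewrite -RintegralZl// -RintegralB//; last exact: integrableZ_EFin.
by apply: eq_Rintegral => z _; rewrite /energy_int; ring.
Qed.

Definition hardy_int u v (x : V) : R :=
  \1_Om x * (u x * v x) * enorm (x : 'rV[R]_d) `^ (- (2 * s)).

Lemma measurable_hardy_int (u v : V -> R) : measurable_fun setT u -> measurable_fun setT v ->
  measurable_fun setT (hardy_int u v).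
Proof.
move=> mu mv; apply: measurable_funM; last exact: measurable_enorm_powR.
by apply: measurable_funM; [exact: measurable_indic_open|exact: measurable_funM].
Qed.

Lemma LambdaH_gt0 : 0 < LambdaH d s.
Proof.
rewrite /LambdaH; apply: divr_gt0; last first.
  by apply: exprn_gt0; apply: Gamma_gt0; rewrite divr_gt0// subr_gt0.
apply: mulr_gt0; first exact: powR_gt0.
apply: exprn_gt0; apply: Gamma_gt0; rewrite divr_gt0//.
by rewrite addr_gt0// ?mulr_gt0// (lt_trans _ sd)// mulr_gt0.
Qed.

Lemma mass_lty u : Es u -> (\int[L]_x (\1_Om x * u x ^+ 2)%:E < +oo)%E.
Proof.
move=> /EsP[mu u2 _ _]; apply: le_lt_trans u2; apply: ge0_le_integral => //.
- by move=> x _; rewrite lee_fin mulr_ge0 ?sqr_ge0//; have /andP[] := indic01 Om x.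
- apply/measurable_EFinP; apply: measurable_funM; last exact: measurable_funX.
  exact: measurable_indic_open.
- by apply/measurable_EFinP; exact: measurable_funX.
by move=> x _; rewrite lee_fin ler_piMl ?sqr_ge0//; have /andP[] := indic01 Om x.
Qed.

Lemma inner_le_energy u : Es u ->
  (inner_energy s Om u <= \int[P]_z (energy_int u u z)%:E)%E.
Proof.
move=> /EsP[mu _ _ _]; apply: ge0_le_integral => //.
- move=> z _; rewrite lee_fin; apply: mulr_ge0; last exact: kern_ge0.
  apply: mulr_ge0; last exact: sqr_ge0.
  by apply: mulr_ge0; rewrite indicE.
- apply/measurable_EFinP; apply: measurable_funM; last exact: (@measurable_kern R d s).
  apply: measurable_funM; last by apply: measurable_funX; exact: measurable_diff.
  apply: measurable_funM; first exact: measurable_fun1 (measurable_indic_open oO).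
  exact: measurable_fun2 (measurable_indic_open oO).
- by apply/measurable_EFinP; exact: measurable_energy_int.
move=> z _; rewrite lee_fin ler_wpM2r ?kern_ge0// -expr2 ler_wpM2r ?sqr_ge0//.
rewrite DOmE !indicE; case: (_ \in _); rewrite ?mul1r ?mul0r.
  by rewrite le_max lexx orbT.
by rewrite le_max lexx.
Qed.

Lemma energy_int_ge0 u z : 0 <= energy_int u u z.
Proof.
by apply: mulr_ge0; rewrite ?kern_ge0//; apply: mulr_ge0; rewrite ?DOm_ge0// -expr2 sqr_ge0.
Qed.

Lemma energy_lty u : Es u -> (\int[P]_z (energy_int u u z)%:E < +oo)%E.
Proof.
by move=> Eu; apply: ge0_integrable_lty (integrable_energy Eu Eu) => z; exact: energy_int_ge0.
Qed.

Lemma hardy_int_ge0 u x : 0 <= hardy_int u u x.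
Proof.
by apply: mulr_ge0; rewrite ?powR_ge0//; apply: mulr_ge0; rewrite -?expr2 ?sqr_ge0// indicE.
Qed.

(** Membership in [Es] does not mention the Hardy weight; [hardy_domain] at half of [LambdaH] bounds
    the Hardy integral by finite quantities. Without it the [fine] in [hardy_form] could be a
    default value. *)
Lemma hardy_lty u : Es u -> (\int[L]_x (hardy_int u u x)%:E < +oo)%E.
Proof.
move=> Eu; have L0 := LambdaH_gt0.
have n0 : 0 < LambdaH d s / 2 := divr_gt0 L0 (ltr0Sn R 1).
have nL : LambdaH d s / 2 < LambdaH d s.
  by rewrite ltr_pdivrMr// ltr_pMr// ltr1n.
have [C C0 H] := hardy_domain s01 sd oO O0 (ltW n0) nL.
have [mu _ _ _] := (EsP u).1 Eu.
have := H u mu (mass_lty Eu); set I := integral _ _ _; set J := (X in (_ <= X)%E) => IJ.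
have Joo : (J < +oo)%E.
  have a20 : (0 <= (ads d s / 2)%:E)%E.
    by rewrite lee_fin; exact: divr_ge0 (ltW (ads_gt0 s01 sd)) (ler0n R 2).
  apply: lte_add_pinfty; apply: lte_mul_pinfty.
  - exact: a20.
  - by [].
  - exact: le_lt_trans (inner_le_energy Eu) (energy_lty Eu).
  - by rewrite lee_fin.
  - by [].
  - exact: mass_lty.
have := le_lt_trans IJ Joo; clear - n0.
have I0 : (0 <= I)%E.
  apply: integral_ge0 => x _; rewrite lee_fin; apply: mulr_ge0; rewrite ?powR_ge0//.
  by apply: mulr_ge0; rewrite ?sqr_ge0// indicE.
case: I I0 => [r| |]//= _; rewrite ?ltry//.
by rewrite mulry gtr0_sg// mul1e ltxx.
Qed.

Lemma integrable_hardy u v : Es u -> Es v -> L.-integrable setT (EFin \o hardy_int u v).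
Proof.
move=> Eu Ev; have [mu _ _ _] := (EsP u).1 Eu; have [mv _ _ _] := (EsP v).1 Ev.
apply: (@integrable_dom2 _ _ L _ (hardy_int u u) (hardy_int v v) 1 1) => //.
- exact: measurable_hardy_int.
- exact: measurable_hardy_int.
- exact: measurable_hardy_int.
- exact: hardy_int_ge0.
- exact: hardy_int_ge0.
- move=> x; rewrite /hardy_int normrM [`|_ `^ _|]ger0_norm ?powR_ge0//.
  rewrite [leRHS](_ : _ = \1_Om x * (1 * u x ^+ 2 + 1 * v x ^+ 2) *
    enorm (x : 'rV[R]_d) `^ (- (2 * s))); last by ring.
  rewrite ler_wpM2r ?powR_ge0// normrM ger0_norm ?indicE// ler_wpM2l//.
  exact: amgm.
- exact: hardy_lty.
- exact: hardy_lty.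
Qed.

Lemma hardyE u v : Es u -> Es v -> Hf u v = (\int[L]_x hardy_int u v x)%R.
Proof. by move=> Eu Ev; rewrite /hardy_form sintE//; exact: integrable_hardy. Qed.

Lemma hardyC u v : Hf u v = Hf v u.
Proof. by congr sint; apply/funext => x; rewrite [u x * _]mulrC. Qed.

Lemma hardy_lin u v w t : Es u -> Es v -> Es w ->
  Hf (fun x => u x - t * v x) w = Hf u w - t * Hf v w.
Proof.
move=> Eu Ev Ew; rewrite !hardyE//; last exact: Es_lin.
have iu := integrable_hardy Eu Ew; have iv := integrable_hardy Ev Ew.
rewrite -RintegralZl// -RintegralB//; last exact: integrableZ_EFin.
by apply: eq_Rintegral => z _; rewrite /hardy_int; ring.
Qed.

Definition mean u : R := sint (fun x => \1_Om x * u x).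

Lemma indic_lty : (\int[L]_x (\1_Om x)%:E < +oo)%E.
Proof.
have [_ _ _ [M OM] _] := sbO.
pose r := Num.max M 0 + 1; have r0 : 0 < r by rewrite ltr_wpDl// le_max lexx orbT.
rewrite integral_indic//; last exact: measurable_rVb.
rewrite setIT; apply: (@le_lt_trans _ _ (L (ball (0 : 'rV[R]_d) r))).
  apply: le_measure; rewrite ?inE; [exact: measurable_rVb| |].
    by apply: measurable_rVb; exact: ball_open.
  move=> x Ox; rewrite mx_norm_ball /ball_/= sub0r normrN.
  apply: (le_lt_trans (norm_le_enorm x)); apply: (le_lt_trans (OM x Ox)).
  by rewrite (@le_lt_trans _ _ (Num.max M 0)) ?ltrDl// le_max lexx.
by rewrite leb_ball// ltry.
Qed.

Lemma integrable_mean u : Es u -> L.-integrable setT (EFin \o (fun x : V => \1_Om x * u x)).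
Proof.
move=> /EsP[mu u2 _ _].
have mi := measurable_indic_open oO.
apply: (@integrable_dom2 _ _ L _ (fun x : V => \1_Om x) (fun x : V => u x ^+ 2) 1 1) => //.
- exact: measurable_funM.
- exact: measurable_funX.
- by move=> x; exact: sqr_ge0.
- by move=> x; have := amgm (\1_Om x) (u x); rewrite indic_sqr.
- exact: indic_lty.
Qed.

Lemma mean_lin u v t : Es u -> Es v -> mean (fun x => u x - t * v x) = mean u - t * mean v.
Proof.
move=> Eu Ev; have iu := integrable_mean Eu; have iv := integrable_mean Ev.
have Ew := Es_lin t Eu Ev; rewrite /mean !sintE//; last exact: integrable_mean.
rewrite -RintegralZl// -RintegralB//; last exact: integrableZ_EFin.
by apply: eq_Rintegral => z _; ring.
Qed.

End Forms.

(** * The gap inequality *)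

Section Gap.
Variable R : realType.
Variable d : nat.
Notation L := (leb R d).
Notation V := (rVb R d).
Notation P := (leb R d \x leb R d)%E.
Variable s : R.
Hypotheses (s01 : 0 < s < 1) (sd : 2 * s < d%:R).
Variables (Om D : set 'rV[R]_d).
Hypotheses (sbO : smooth_bounded_domain Om) (O0 : Om 0) (oD : open D).
Let s0 : 0 < s. Proof. by case/andP: s01. Qed.
Let oO : open Om. Proof. by case: sbO. Qed.
Let d0 : 0 < d%:R :> R. Proof. by rewrite (lt_trans _ sd)// mulr_gt0. Qed.
Let a20 : 0 < ads d s / 2. Proof. exact: divr_gt0 (ads_gt0 s01 sd) (ltr0Sn R 1). Qed.
Implicit Types u v w phi : 'rV[R]_d -> R.
Notation Es := (Es s D).
Notation En := (energy s Om).
Notation Hf := (hardy_form s Om).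

Lemma ge0_fineE (x : \bar R) : (0 <= x)%E -> (x < +oo)%E -> x = (fine x)%:E.
Proof. by move=> x0 xoo; rewrite fineK// ge0_fin_numE. Qed.

Lemma energy_fine u : Es u ->
  En u u = ads d s / 2 * fine (\int[P]_z (energy_int s Om u u z)%:E)%E.
Proof. by move=> Eu; rewrite (energyE sbO Eu Eu). Qed.

Lemma energy_EFin u : Es u ->
  ((ads d s / 2)%:E * \int[P]_z (energy_int s Om u u z)%:E = (En u u)%:E)%E.
Proof.
move=> Eu; rewrite energy_fine// [RHS]EFinM -ge0_fineE//.
  by apply: integral_ge0 => z _; rewrite lee_fin energy_int_ge0.
exact: (energy_lty sbO Eu).
Qed.

Lemma hardy_EFin u : Es u -> (\int[L]_x (hardy_int s Om u u x)%:E = (Hf u u)%:E)%E.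
Proof.
move=> Eu; rewrite (hardyE s01 sd sbO O0 Eu Eu); apply: ge0_fineE.
  by apply: integral_ge0 => z _; rewrite lee_fin hardy_int_ge0.
exact: (hardy_lty s01 sd sbO O0 Eu).
Qed.

Lemma energy_ge0 u : Es u -> 0 <= En u u.
Proof.
move=> Eu; rewrite energy_fine//; apply: (mulr_ge0 (ltW a20)).
by apply/fine_ge0/integral_ge0 => z _; rewrite lee_fin energy_int_ge0.
Qed.

Lemma hardy_ge0 u : Es u -> 0 <= Hf u u.
Proof.
move=> Eu; rewrite -lee_fin -hardy_EFin//.
by apply: integral_ge0 => z _; rewrite lee_fin hardy_int_ge0.
Qed.

Lemma QdenE u : Es u -> Qden s Om u = (Hf u u)%:E.
Proof.
move=> Eu; have [mu _ _ _] := (EsP s D u).1 Eu.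
have E x : \1_Om x * u x ^+ 2 * enorm x `^ (- (2 * s)) = hardy_int s Om u u x.
  by rewrite /hardy_int expr2.
rewrite -hardy_EFin// /Qden; under eq_fun do rewrite E.
rewrite iintE//; last by move=> x; rewrite lee_fin hardy_int_ge0.
by apply/measurable_EFinP; exact: measurable_hardy_int.
Qed.

Lemma QnumE u : Es u -> Qnum s Om u = (En u u)%:E.
Proof.
move=> Eu; have [mu _ _ _] := (EsP s D u).1 Eu.
rewrite -energy_EFin// /Qnum; congr (_ * _)%E.
have E x y : DOm Om x y * (u x - u y) ^+ 2 * kern s x y = energy_int s Om u u (x, y).
  by rewrite /energy_int expr2.
under [X in iint2 X]eq_fun do under eq_fun do rewrite E.
rewrite iint2E//; last by move=> x y; rewrite lee_fin energy_int_ge0.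
rewrite (_ : (fun z => _) = EFin \o energy_int s Om u u); last by apply/funext => -[].
by apply/measurable_EFinP; exact: measurable_energy_int.
Qed.

Lemma rayleighE u : Es u -> rayleigh s Om u = En u u / Hf u u.
Proof. by move=> Eu; rewrite /rayleigh QnumE// QdenE. Qed.

Lemma hardy_gt0_nonzero u : Es u -> 0 < Hf u u -> ~ ae_zero_on setT u.
Proof.
move=> Eu Hu; have [mu _ _ _] := (EsP s D u).1 Eu.
move/ae_zero_onE => /(_ measurableT mu) u0.
have : (\int[L]_x (hardy_int s Om u u x)%:E = 0)%E.
  apply: (null_support _ _ _ _ _ u0).
  - by apply/measurable_EFinP/measurable_indic; exact: measurable_neq0.
  - by apply/measurable_EFinP; exact: measurable_hardy_int.
  - by move=> x; rewrite lee_fin indicE.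
  - by move=> x; rewrite lee_fin hardy_int_ge0.
  move=> x; rewrite indicE => /eqP; rewrite eqe.
  have [|nu _] := boolP (x \in [set y | [set: V] y /\ u y <> 0]); first by rewrite oner_eq0.
  rewrite /hardy_int (_ : u x = 0) ?mul0r ?mulr0 ?mul0r//.
  by apply: contrapT => ux; move/negP : nu; apply; exact/mem_set.
by rewrite hardy_EFin// => -[H0]; rewrite H0 ltxx in Hu.
Qed.

(** A function with positive Hardy form is admissible, so the infimum applies, the quotients being
    bounded below by zero. If the Hardy form vanishes, nonnegativity of the energy is enough. *)
Lemma LambdaN_le u : Es u -> LambdaN s Om D * Hf u u <= En u u.
Proof.
move=> Eu; have := hardy_ge0 Eu; rewrite le_eqVlt => /predU1P[<-|H0].
  by rewrite mulr0 energy_ge0.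
rewrite -ler_pdivlMr// -rayleighE//; apply: ge_inf.
  exists 0 => _ [v [Ev _ _] <-]; rewrite rayleighE//.
  by apply: divr_ge0; [exact: energy_ge0|exact: hardy_ge0].
exists u => //; split => //; first exact: hardy_gt0_nonzero.
by rewrite QdenE// lte_fin H0 ltry.
Qed.

Lemma kern_lower : exists2 km, 0 < km & forall x y : 'rV[R]_d,
  Om x -> Om y -> x != y -> km <= kern s x y.
Proof.
have [_ _ _ [M OM] _] := sbO.
pose B := d%:R * ((`|M| + 1) + (`|M| + 1)) : R.
have B0 : 0 < B by rewrite mulr_gt0// addr_gt0// ltr_wpDl.
exists (B `^ (- (d%:R + 2 * s))); first exact: powR_gt0.
move=> x y Ox Oy xy; have e0 : 0 < enorm (x - y) by rewrite enorm_gt0// subr_eq0.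
rewrite /kern !powRN lef_pV2 ?posrE ?powR_gt0//.
apply: ge0_ler_powR; rewrite ?nnegrE ?(ltW e0) ?(ltW B0)//.
  by rewrite addr_ge0 ?mulr_ge0 ?(ltW s0).
apply: (le_trans (enorm_le_norm _)); rewrite ler_wpM2l//.
apply: (le_trans (ler_normB _ _)).
have bnd z : Om z -> `|z| <= `|M| + 1.
  move=> Oz; apply: (le_trans (norm_le_enorm z)); apply: (le_trans (OM z Oz)).
  by rewrite (le_trans (ler_norm M))// lerDl.
by rewrite lerD// bnd.
Qed.

Definition pos_part u (x : V) : R := Num.max (\1_Om x * u x) 0.
Definition neg_part u (x : V) : R := Num.max (- (\1_Om x * u x)) 0.

(** For equal signs the mixed products vanish; for opposite signs
    [(a - b)^2 - (|a| - |b|)^2 = 4 |a| |b|]. *)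
Lemma abs_diff_parts (a b : R) :
  (`|a| - `|b|) ^+ 2 + 4 * (Num.max a 0 * Num.max (- b) 0 + Num.max (- a) 0 * Num.max b 0) =
  (a - b) ^+ 2.
Proof.
have pos (c : R) : 0 <= c -> [/\ `|c| = c, Num.max c 0 = c & Num.max (- c) 0 = 0].
  by move=> c0; rewrite ger0_norm// max_l// max_r ?oppr_le0.
have neg (c : R) : c <= 0 -> [/\ `|c| = - c, Num.max c 0 = 0 & Num.max (- c) 0 = - c].
  by move=> c0; rewrite ler0_norm// max_r// max_l ?oppr_ge0.
case/orP: (le_total 0 a) => [/pos|/neg] [-> -> ->];
  case/orP: (le_total 0 b) => [/pos|/neg] [-> -> ->]; ring.
Qed.

(* [p] and [n] are the integrals of the positive and negative parts of [u] over [Om]. *)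
Lemma energy_abs_le : exists2 km, 0 < km & forall u, Es u -> exists p n,
  [/\ 0 <= p, 0 <= n, mean Om u = p - n &
   (\int[L]_x (\1_Om x * `|u x|)%:E = (p + n)%:E)%E /\
   En (fun x => `|u x|) (fun x => `|u x|) + ads d s / 2 * (8 * km * (p * n)) <= En u u].
Proof.
have [km km0 Hkm] := kern_lower; exists km => // u Eu.
have [mu _ _ _] := (EsP s D u).1 Eu; have Ea := Es_abs oD Eu.
have mi := measurable_indic_open oO.
have miu : measurable_fun [set: V] (fun x : V => \1_Om x * u x) by exact: measurable_funM.
have mp : measurable_fun [set: V] (pos_part u) by exact: measurable_maxr.
have mn : measurable_fun [set: V] (neg_part u).
  by apply: measurable_maxr => //; exact: measurableT_comp.
have p0 x : 0 <= pos_part u x by rewrite le_max lexx orbT.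
have n0 x : 0 <= neg_part u x by rewrite le_max lexx orbT.
have mpE : measurable_fun [set: V] (fun x => (pos_part u x)%:E) by exact/measurable_EFinP.
have mnE : measurable_fun [set: V] (fun x => (neg_part u x)%:E) by exact/measurable_EFinP.
have pn x : pos_part u x + neg_part u x = \1_Om x * `|u x|.
  rewrite -[\1_Om x]ger0_norm ?indicE// -normrM -indicE /pos_part /neg_part.
  move: (_ * _) => c; case/orP: (le_total 0 c) => c0.
    by rewrite ger0_norm// max_l// max_r ?oppr_le0// addr0.
  by rewrite ler0_norm// max_r// max_l ?oppr_ge0// add0r.
have Ioo : (\int[L]_x (\1_Om x * `|u x|)%:E < +oo)%E.
  have := integrable_mean sbO Eu => /integrableP[_]; congr (_ < _)%E.
  apply: eq_integral => x _ /=; rewrite normrM ger0_norm ?indicE//.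
have IE : (\int[L]_x (\1_Om x * `|u x|)%:E =
    \int[L]_x (pos_part u x)%:E + \int[L]_x (neg_part u x)%:E)%E.
  rewrite -ge0_integralD//.
  - by apply: eq_integral => x _; rewrite -pn.
  - by move=> x _; rewrite lee_fin.
  - by move=> x _; rewrite lee_fin.
have Ip0 : (0 <= \int[L]_x (pos_part u x)%:E)%E by apply: integral_ge0 => x _; rewrite lee_fin.
have In0 : (0 <= \int[L]_x (neg_part u x)%:E)%E by apply: integral_ge0 => x _; rewrite lee_fin.
have Ipoo : (\int[L]_x (pos_part u x)%:E < +oo)%E.
  by apply: le_lt_trans Ioo; rewrite IE leeDl.
have Inoo : (\int[L]_x (neg_part u x)%:E < +oo)%E.
  by apply: le_lt_trans Ioo; rewrite IE leeDr.
exists (fine (\int[L]_x (pos_part u x)%:E)%E), (fine (\int[L]_x (neg_part u x)%:E)%E).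
split; [exact: fine_ge0|exact: fine_ge0| |].
  by rewrite /mean /sint !iintE// => x; rewrite lee_fin ?p0 ?n0.
rewrite EFinD -!ge0_fineE//; split => //.
move: Ip0 In0 Ipoo Inoo (ge0_fineE Ip0 Ipoo) (ge0_fineE In0 Inoo).
set p := fine _; set n := fine _ => _ _ _ _ Ep Enn.
(* The [4] is that of [abs_diff_parts] and [km] bounds the kernel below on [Om * Om]. Each of the
   two mixed products integrates to [p * n], whence [8 * km * (p * n)]. *)
pose k4 : R := 4 * km.
have k40 : 0 <= k4 by rewrite mulr_ge0// ltW.
pose X (z : V * V) := energy_int s Om (fun x => `|u x|) (fun x => `|u x|) z.
pose K1 (x y : V) := (neg_part u y)%:E.
pose K2 (x y : V) := (pos_part u y)%:E.
have mK1 : measurable_fun [set: V * V] (fun z => K1 z.1 z.2) by exact: (measurableT_comp mnE measurable_snd).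
have mK2 : measurable_fun [set: V * V] (fun z => K2 z.1 z.2) by exact: (measurableT_comp mpE measurable_snd).
have K10 x y : (0 <= K1 x y)%E by rewrite lee_fin.
have K20 x y : (0 <= K2 x y)%E by rewrite lee_fin.
have I1 : (\int[P]_z ((pos_part u z.1)%:E * K1 z.1 z.2) = (p * n)%:E)%E.
  rewrite (integral_fstK K10 mK1 mp p0) /K1 Enn ge0_integralZr//.
  - by rewrite Ep -EFinM.
  - by move=> x _; rewrite lee_fin.
  - by rewrite -Enn; apply: integral_ge0 => x _; rewrite lee_fin.
have I2 : (\int[P]_z ((neg_part u z.1)%:E * K2 z.1 z.2) = (p * n)%:E)%E.
  rewrite (integral_fstK K20 mK2 mn n0) /K2 Ep ge0_integralZr//.
  - by rewrite Enn -EFinM mulrC.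
  - by move=> x _; rewrite lee_fin.
  - by rewrite -Ep; apply: integral_ge0 => x _; rewrite lee_fin.
have m1 : measurable_fun setT (fun z : V * V => (pos_part u z.1)%:E * K1 z.1 z.2)%E.
  by apply: emeasurable_funM => //; exact: (measurableT_comp mpE measurable_fst).
have m2 : measurable_fun setT (fun z : V * V => (neg_part u z.1)%:E * K2 z.1 z.2)%E.
  by apply: emeasurable_funM => //; exact: (measurableT_comp mnE measurable_fst).
have g1 z : (0 <= (pos_part u z.1)%:E * K1 z.1 z.2)%E by apply: mule_ge0; rewrite lee_fin.
have g2 z : (0 <= (neg_part u z.1)%:E * K2 z.1 z.2)%E by apply: mule_ge0; rewrite lee_fin.
have ma : measurable_fun [set: V] (fun x => `|u x|) by exact: measurableT_comp.
have mX : measurable_fun setT (fun z => (X z)%:E).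
  by apply/measurable_EFinP; exact: measurable_energy_int.
have key : (\int[P]_z (X z)%:E + (k4 * (2 * (p * n)))%:E <= \int[P]_z (energy_int s Om u u z)%:E)%E.
  have -> : ((k4 * (2 * (p * n)))%:E = \int[P]_z (k4%:E *
      ((pos_part u z.1)%:E * K1 z.1 z.2 + (neg_part u z.1)%:E * K2 z.1 z.2)))%E.
    rewrite ge0_integralZl//; first last.
    - by move=> z _; rewrite adde_ge0.
    - exact: emeasurable_funD.
    by rewrite ge0_integralD// I1 I2 -EFinD -EFinM; congr (_%:E); ring.
  have mk4 : measurable_fun setT (fun z : V * V => k4%:E *
      ((pos_part u z.1)%:E * K1 z.1 z.2 + (neg_part u z.1)%:E * K2 z.1 z.2))%E.
    by apply: measurable_funeM; exact: emeasurable_funD.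
  rewrite -ge0_integralD//; first last.
  - by move=> z _; rewrite mule_ge0 ?adde_ge0.
  - by move=> z _; rewrite lee_fin energy_int_ge0.
  apply: ge0_le_integral => //.
  - by move=> z _; rewrite adde_ge0 ?mule_ge0 ?adde_ge0// lee_fin energy_int_ge0.
  - exact: emeasurable_funD.
  - by apply/measurable_EFinP; exact: measurable_energy_int.
  case=> x y _; rewrite /K1 /K2 /X /= -?EFinM -?EFinD -?EFinM -?EFinD lee_fin /energy_int /=.
  have abs_le : (`|u x| - `|u y|) * (`|u x| - `|u y|) <= (u x - u y) * (u x - u y).
    rewrite -!expr2 -[leRHS]real_normK ?num_real// -[leLHS]real_normK ?num_real//.
    by rewrite lerXn2r ?nnegrE// ler_dist_dist.
  have [Oxy|nOxy] := pselect (Om x /\ Om y); last first.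
    rewrite (_ : pos_part u x * neg_part u y + neg_part u x * pos_part u y = 0).
      by rewrite mulr0 addr0 ler_wpM2r ?kern_ge0// ler_wpM2l ?DOm_ge0.
    rewrite /pos_part /neg_part !indicE; have [Ox|nOx] := pselect (Om x).
      have nOy : ~ Om y by move=> Oy; apply: nOxy.
      by rewrite (memNset nOy)/= !mul0r oppr0 maxxx !mulr0 addr0.
    by rewrite (memNset nOx)/= !mul0r oppr0 maxxx !mul0r addr0.
  have [Ox Oy] := Oxy.
  rewrite DOmE !indicE (mem_set Ox) (mem_set Oy) maxxx !mul1r.
  rewrite /pos_part /neg_part !indicE (mem_set Ox) (mem_set Oy) !mul1r.
  have := abs_diff_parts (u x) (u y); rewrite -!expr2 => <-.
  rewrite mulrDl lerD2l.
  (* The lower bound on the kernel fails on the diagonal, but there one of the two opposite parts is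
     zero. *)
  have [->|xy] := eqVneq x y.
    case/orP: (le_total 0 (u y)) => uy.
      by rewrite (max_r (_ : - u y <= 0)) ?oppr_le0// !mulr0 !mul0r addr0 !mulr0 mul0r.
    by rewrite (max_r uy) !mulr0 !mul0r addr0 !mulr0 mul0r.
  rewrite /k4 mulrAC ler_wpM2l//; last exact: Hkm.
  by rewrite mulr_ge0// addr_ge0// mulr_ge0// le_max lexx orbT.
rewrite -lee_fin EFinD -!energy_EFin// [X in (_ + X <= _)%E]EFinM.
rewrite -ge0_muleDr.
- have a2E : (0 <= (ads d s / 2)%:E)%E by rewrite lee_fin ltW.
  apply: (lee_wpmul2l a2E); apply: le_trans key; apply: leeD2l.
  by rewrite lee_fin /k4 le_eqVlt; apply/orP; left; apply/eqP; ring.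
- by apply: integral_ge0 => z _; rewrite lee_fin energy_int_ge0.
- rewrite lee_fin; apply: mulr_ge0; first by rewrite mulr_ge0// ltW.
  by apply: mulr_ge0; apply: fine_ge0; apply: integral_ge0 => x _; rewrite lee_fin.
Qed.

Lemma hardy_abs u : Hf (fun x => `|u x|) (fun x => `|u x|) = Hf u u.
Proof.
by congr sint; apply/funext => x; rewrite -!expr2 -normrX ger0_norm ?sqr_ge0.
Qed.

(** Chaining the bounds gives [nu b <= (1 + del) a + (C1 C2 / K) (a - mu b)]. Subtracting
    [(1 + del) mu b], which is at most [(mu + nu) / 2 * b], leaves [(nu - mu) / 2 * b] on the left
    and only multiples of [a - mu b] on the right. *)
Lemma gap_arith (mu nu b a E N A a2 C1 C2 eps del K : R) :
  0 <= mu < nu -> 0 <= b -> 0 <= del -> 0 < K -> 0 <= C1 -> 0 <= C2 -> 0 <= E ->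
  nu * b <= a2 * E + C1 * N -> N <= eps * E + C2 * (A * A) -> K * (A * A) <= a - mu * b ->
  a2 * E <= a -> C1 * eps <= del * a2 -> (1 + del) * mu <= (mu + nu) / 2 ->
  (nu - mu) / 2 / (1 + del + C1 * C2 / K) * b <= a - mu * b.
Proof.
move=> /andP[mu0 munu] b0 del0 K0 C10 C20 E0 h1 h2 h3 h4 h5 h6.
have S0 : 0 < 1 + del + C1 * C2 / K.
  by rewrite ltr_pwDl ?ltr_pwDl// ?divr_ge0 ?mulr_ge0// ltW.
rewrite mulrAC ler_pdivrMr//.
have l1 : C1 * N <= del * a2 * E + C1 * C2 * (A * A).
  apply: (le_trans (ler_wpM2l C10 h2)); rewrite mulrDr !mulrA lerD2r -[leLHS]mulrA.
  by rewrite [leLHS]mulrA ler_wpM2r.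
have l2 : C1 * C2 * (A * A) <= C1 * C2 / K * (a - mu * b).
  rewrite -[leRHS]mulrA ler_wpM2l ?mulr_ge0// [leRHS]mulrC ler_pdivlMr// mulrC; exact: h3.
have l3 : (1 + del) * (a2 * E) <= (1 + del) * a by rewrite ler_wpM2l// addr_ge0.
have l4 : (1 + del) * mu * b <= (mu + nu) / 2 * b by rewrite ler_wpM2r.
rewrite -subr_ge0 [X in 0 <= X](_ : _ = (1 + del) * a + C1 * C2 / K * (a - mu * b) -
  (1 + del) * mu * b + (mu + nu) / 2 * b - nu * b); last by field; rewrite gt_eqF.
rewrite subr_ge0 (le_trans h1)//; move: l1 l2 l3 l4.
move: (C1 * C2 / K * (a - mu * b)) (C1 * C2 * (A * A)) ((1 + del) * mu * b) ((mu + nu) / 2 * b).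
move=> x1 x2 x3 x4; rewrite !mulrDl !mul1r -!mulrA.
by move: (a2 * E) (del * (a2 * E)) (del * a) (C1 * N) => y1 y2 y3 y4; lra.
Qed.

Lemma gap mu : 0 <= mu < LambdaH d s -> (forall u, Es u -> mu * Hf u u <= En u u) ->
  exists2 c, 0 < c & forall u, Es u -> mean Om u = 0 -> c * Hf u u <= En u u - mu * Hf u u.
Proof.
move=> /andP[mu0 muL] qge0.
pose nu := (mu + LambdaH d s) / 2.
have munu : mu < nu by rewrite midf_lt.
have nuL : nu < LambdaH d s by rewrite midf_lt.
have [C1 C10 H1] := hardy_domain s01 sd oO O0 (le_trans mu0 (ltW munu)) nuL.
pose a2 := ads d s / 2; have a2p : 0 < a2 := a20.
(* Chosen so that [del * mu <= (nu - mu) / 2], and [eps] so that [C1 * eps <= del * a2]; the added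
   ones cover [mu = 0] and [C1 = 0]. *)
pose del := (nu - mu) / (2 * (mu + 1)).
have mu1 : 0 < mu + 1 by rewrite ltr_wpDl.
have del0 : 0 < del by rewrite divr_gt0 ?subr_gt0// mulr_gt0.
pose eps := del * a2 / (C1 + 1).
have C11 : 0 < C1 + 1 by rewrite ltr_wpDl.
have eps0 : 0 < eps by rewrite divr_gt0// mulr_gt0.
have [C2 C20 H2] := nash s01 sd sbO eps0.
have [km km0 Habs] := energy_abs_le.
(* With zero mean [p = n] and the integral of [|u|] over [Om] is [2 p], so [8 km p n] is [2 km]
   times its square. *)
pose K := a2 * (2 * km); have K0 : 0 < K by rewrite mulr_gt0// mulr_gt0.
have S0 : 0 < 1 + del + C1 * C2 / K.
  apply: ltr_pwDl; first exact: addr_gt0.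
  by apply: divr_ge0; [exact: mulr_ge0|exact: ltW].
exists ((nu - mu) / 2 / (1 + del + C1 * C2 / K)).
  by rewrite divr_gt0// divr_gt0// subr_gt0.
move=> u Eu mean0; have [p [n [p0 n0 meanE [AE Habs']]]] := Habs u Eu.
have pn : p = n by apply/eqP; rewrite -subr_eq0 -meanE mean0.
have [mu_ _ _ _] := (EsP s D u).1 Eu.
have in0 : (0 <= inner_energy s Om u)%E.
  apply: integral_ge0 => z _; rewrite lee_fin; apply: mulr_ge0; last exact: kern_ge0.
  by apply: mulr_ge0; last exact: sqr_ge0; apply: mulr_ge0; rewrite indicE.
have inoo : (inner_energy s Om u < +oo)%E.
  exact: le_lt_trans (inner_le_energy sbO Eu) (energy_lty sbO Eu).
have ms0 : (0 <= \int[L]_x (\1_Om x * u x ^+ 2)%:E)%E.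
  by apply: integral_ge0 => x _; rewrite lee_fin mulr_ge0 ?sqr_ge0// indicE.
have Eo := ge0_fineE in0 inoo; have Mo := ge0_fineE ms0 (mass_lty sbO Eu).
have h1 := H1 u mu_ (mass_lty sbO Eu); have h2 := H2 u mu_.
have h4 := lee_wpmul2l (_ : (0 <= a2%:E)%E) (inner_le_energy sbO Eu).
have a2E : (0 <= a2%:E)%E by rewrite lee_fin ltW.
move: (h4 a2E) => {h4}; rewrite energy_EFin// Eo -EFinM lee_fin => h4.
move: h2; rewrite AE Eo Mo -!EFinM -EFinD lee_fin => h2.
have HE : (\int[L]_x (\1_Om x * u x ^+ 2 * enorm (x : 'rV[R]_d) `^ (- (2 * s)))%:E = (Hf u u)%:E)%E.
  by rewrite -hardy_EFin//; apply: eq_integral => x _; rewrite /hardy_int expr2.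
move: h1; rewrite HE -/(inner_energy s Om u) Eo Mo -!EFinM -EFinD lee_fin => h1.
apply: (gap_arith _ _ _ _ _ _ _ h1 h2 _ h4).
- by rewrite mu0.
- exact: hardy_ge0.
- exact: ltW.
- exact: K0.
- exact: C10.
- exact: C20.
- exact: fine_ge0.
- have := qge0 _ (Es_abs oD Eu); rewrite hardy_abs => q0.
  rewrite lerBrDr; apply: le_trans Habs'; rewrite addrC lerD// pn /K.
  by rewrite le_eqVlt; apply/orP; left; apply/eqP; rewrite /a2; field.
- rewrite -/a2 /eps [leLHS]mulrA ler_pdivrMr// [leLHS]mulrC ler_wpM2l ?(ltW (mulr_gt0 del0 a2p))//.
  by rewrite lerDl.
- rewrite mulrDl mul1r -lerBrDl (_ : _ - mu = (nu - mu) / 2); last by field.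
  rewrite /del invfM mulrA mulrAC ler_pdivrMr// ler_wpM2l ?divr_ge0 ?subr_ge0 ?(ltW munu)//.
  by rewrite lerDl.
Qed.

End Gap.

(** * Functions on which both forms vanish *)

Section Vanishing.
Variable R : realType.
Variable d : nat.
Notation L := (leb R d).
Notation V := (rVb R d).
Notation P := (leb R d \x leb R d)%E.
Variable s : R.
Hypotheses (s01 : 0 < s < 1) (sd : 2 * s < d%:R).
Variables (Om D : set 'rV[R]_d).
Hypotheses (sbO : smooth_bounded_domain Om) (O0 : Om 0).
Let s0 : 0 < s. Proof. by case/andP: s01. Qed.
Let oO : open Om. Proof. by case: sbO. Qed.
Let d0 : 0 < d%:R :> R. Proof. by rewrite (lt_trans _ sd)// mulr_gt0. Qed.

Lemma measurable_set1_rVb (x : 'rV[R]_d) : measurable ([set x] : set V).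
Proof.
rewrite -[[set x]]setCK; apply: measurableC; apply: measurable_rVb.
apply: closed_openC; apply: accessible_closed_set1; apply: hausdorff_accessible.
exact: norm_hausdorff.
Qed.

(** The point lies in cubes of side [m <= 1], of volume [m^d <= m]; this uses [0 < d], a consequence
    of [2 s < d]. *)
Lemma leb_set1 (x : 'rV[R]_d) : L [set x] = 0.
Proof.
apply/eqP; rewrite eq_le measure_ge0 andbT; apply/lee_addgt0Pr => e e0.
pose m := Num.min 1 e; have m0 : 0 < m by rewrite lt_min ltr01.
apply: (@le_trans _ _ (L (ball x (m / 2)))).
  apply: le_measure; rewrite ?inE; [exact: measurable_set1_rVb| |].
    by apply: measurable_rVb; exact: ball_open.
  by move=> _ ->; apply: ballxx; rewrite divr_gt0.
rewrite leb_ball ?divr_gt0// add0e lee_fin mulrC divfK// (@le_trans _ _ m)//.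
  have : (0 < d)%N by rewrite -(ltr0n R).
  case: (d) => // n _; rewrite exprS ler_piMr ?(ltW m0)// exprn_ile1 ?(ltW m0)//.
  by rewrite ge_min lexx.
by rewrite ge_min lexx orbT.
Qed.

(** A zero Hardy form only controls [u] inside [Om]. The energy does the rest: its integrand is
    positive on pairs with [u = 0] at a point of [Om] and [u <> 0] elsewhere, so one of the sets
    [S1] and [S2] is null, and it cannot be [S1]. *)
Lemma energy_hardy_zero u : Es s D u -> energy s Om u u = 0 -> hardy_form s Om u u = 0 ->
  ae_zero_on setT u.
Proof.
move=> Eu En0 H0; have [mu _ _ _] := (EsP s D u).1 Eu.
have a20 : 0 < ads d s / 2 by exact: divr_gt0 (ads_gt0 s01 sd) (ltr0Sn R 1).
have IE0 : (\int[P]_z (energy_int s Om u u z)%:E = 0)%E.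
  have /eqP := energy_EFin sbO Eu.
  by rewrite En0 mule_eq0 eqe gt_eqF//= => /eqP.
have IH0 : (\int[L]_x (hardy_int s Om u u x)%:E = 0)%E.
  by rewrite (hardy_EFin s01 sd sbO O0 Eu) H0.
pose S1 : set V := [set x | Om x /\ u x = 0].
pose S2 : set V := [set y | [set: V] y /\ u y <> 0].
(* The origin is removed because the Hardy weight takes the value [0] there, so the Hardy form does
   not see it. *)
pose S3 : set V := [set x | (Om `\` [set 0]) x /\ u x <> 0].
have mOm : measurable (Om : set V) by exact: measurable_rVb.
have mS2 : measurable S2 by exact: measurable_neq0.
have mS3 : measurable S3.
  by apply: measurable_neq0 => //; apply: measurableD => //; exact: measurable_set1_rVb.
have mS1 : measurable S1.
  rewrite (_ : S1 = Om `&` ~` S2); first by apply: measurableI => //; exact: measurableC.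
  apply/seteqP; split => x /=; first by move=> [Ox ux]; split => // -[].
  by move=> [Ox nS]; split => //; apply: contrapT => ux; exact: nS.
have mi (A : set V) : measurable A -> measurable_fun setT (fun x : V => (\1_A x : R)%:E).
  by move=> mA; apply/measurable_EFinP; exact: measurable_indic.
have i0 (A : set V) x : (0 <= (\1_A x : R)%:E)%E by rewrite lee_fin indicE.
pose K (x y : V) := (\1_S2 y : R)%:E.
have mK : measurable_fun [set: V * V] (fun z => K z.1 z.2).
  exact: (measurableT_comp (mi _ mS2) measurable_snd).
have K0 x y : (0 <= K x y)%E by exact: i0.
have prod0 : (\int[L]_x (\1_S1 x)%:E * \int[L]_y (\1_S2 y)%:E = 0)%E.
  have <- : (\int[P]_z ((\1_S1 z.1)%:E * K z.1 z.2) =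
      \int[L]_x (\1_S1 x)%:E * \int[L]_y (\1_S2 y)%:E)%E.
    rewrite (integral_fstK K0 mK (measurable_indic mS1)); last by move=> x; rewrite indicE.
    rewrite /K ge0_integralZr//; first exact: mi.
    exact: integral_ge0.
  apply: (null_support _ _ _ _ _ IE0).
  - by apply/measurable_EFinP; exact: measurable_energy_int.
  - apply: emeasurable_funM => //.
    exact: (measurableT_comp (mi _ mS1) measurable_fst).
  - by move=> z; rewrite lee_fin energy_int_ge0.
  - by move=> z; apply: mule_ge0.
  case=> x y /eqP; rewrite eqe /energy_int/= => /eqP e0; rewrite /K !indicE/=.
  have [[Ox ux]|nS1] := pselect (S1 x); last by rewrite (memNset nS1) mul0e.
  have [[_ uy]|nS2] := pselect (S2 y); last by rewrite (memNset nS2) mule0.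
  have xy : x != y by apply: contra_notN uy => /eqP <-.
  have : kern s x y > 0 by rewrite powR_gt0// enorm_gt0// subr_eq0.
  move/eqP : e0; rewrite DOmE indicE mem_set// max_l; last by rewrite indicE; case: (_ \in _).
  rewrite mul1r ux sub0r mulrNN -expr2 mulf_eq0 sqrf_eq0 => /orP[/eqP //|/eqP ->].
  by rewrite ltxx.
move/eqP : prod0; rewrite mule_eq0 => /orP[|] /eqP I0; last first.
  exact/ae_zero_onE.
(* If [S1] were null, then [Om], covered by [S1], [S3] and the origin, would be null, although it
   contains a ball. *)
exfalso.
have S30 : (\int[L]_x (\1_S3 x)%:E = 0)%E.
  apply: (null_support _ _ _ _ _ IH0) => //.
  - by apply/measurable_EFinP; exact: measurable_hardy_int.
  - exact: mi.
  - by move=> x; rewrite lee_fin hardy_int_ge0.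
  move=> x /eqP; rewrite eqe /hardy_int indicE => /eqP e0; rewrite indicE.
  have [[[Ox x0] ux]|nS] := pselect (S3 x); last by rewrite (memNset nS).
  move/eqP : e0; rewrite mem_set// mul1r -expr2 mulf_eq0 sqrf_eq0 => /orP[/eqP //|].
  by rewrite gt_eqF// powR_gt0// enorm_gt0//; apply/eqP.
have Z0 : (\int[L]_x (\1_[set (0 : 'rV[R]_d)] x)%:E = 0)%E.
  rewrite integral_indic//; last exact: measurable_set1_rVb.
  by rewrite setIT; exact: leb_set1.
have : (\int[L]_x (\1_Om x)%:E = 0)%E.
  have m13 : measurable_fun setT (fun x : V => (\1_S1 x : R)%:E + (\1_S3 x : R)%:E)%E.
    by apply: emeasurable_funD; exact: mi.
  have mz := mi _ (measurable_set1_rVb 0).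
  apply: (null_support (f := fun x : V => ((\1_S1 x : R)%:E + (\1_S3 x : R)%:E +
    (\1_[set (0 : 'rV[R]_d)] x : R)%:E)%E)).
  - exact: emeasurable_funD.
  - exact: mi.
  - by move=> x; rewrite !adde_ge0.
  - by move=> x.
  - move=> x; rewrite !indicE => e0; have [Ox|nOx] := pselect (Om x); last by rewrite memNset.
    exfalso; move: e0; have [x0|x0] := pselect (x = 0).
      rewrite [x \in [set _]]mem_set// -!EFinD => /eqP; rewrite eqe.
      by rewrite paddr_eq0 ?addr_ge0// oner_eq0 andbF.
    have [ux|ux] := pselect (u x = 0).
      rewrite [x \in S1]mem_set// -!EFinD => /eqP; rewrite eqe.
      by rewrite -addrA paddr_eq0 ?addr_ge0// oner_eq0.
    rewrite [x \in S3]mem_set// -!EFinD => /eqP; rewrite eqe.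
    by rewrite addrAC paddr_eq0 ?addr_ge0// oner_eq0 andbF.
  - rewrite ge0_integralD//; last by move=> x _; rewrite adde_ge0.
    by rewrite ge0_integralD//; [rewrite I0 S30 Z0 !adde0|exact: mi|exact: mi].
rewrite integral_indic// setIT.
have [r /= r0 rO] : nbhs_ball (0 : 'rV[R]_d) Om by apply/nbhs_ballP/oO.
pose B : set 'rV[R]_d := ball 0 r.
move=> LO; have : (L B <= L Om)%E.
  by apply: le_measure; rewrite ?inE//; apply: measurable_rVb; exact: ball_open.
by rewrite LO leb_ball// lee_fin leNgt exprn_gt0// mulr_gt0.
Qed.

End Vanishing.

Theorem theorem3p6 (R : realType) (d : nat) (s : R)
  (Om D N : set 'rV[R]_d) (ubar : 'rV[R]_d -> R) :
  0 < s < 1 -> 2 * s < d%:R ->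
  smooth_bounded_domain Om -> Om 0 ->
  DN_config Om D N ->
  LambdaN s Om D < LambdaH d s ->
  admissible s Om D ubar -> rayleigh s Om ubar = LambdaN s Om D ->
  (forall v, weak_eig_sol s Om D (LambdaN s Om D) v ->
     exists C : R, ae_zero_on setT (fun x => v x - C * ubar x)) /\
  (exists2 eps : R, 0 < eps &
     forall lam, LambdaN s Om D < lam < LambdaN s Om D + eps ->
       forall v, weak_eig_sol s Om D lam v -> ae_zero_on setT v).
Proof.
move=> s01 sd sbO O0 [[oD _] _ _ _ _] muL [Eu _ Qu] ray.
set mu := LambdaN s Om D in muL ray *.
have bu : 0 < hardy_form s Om ubar ubar.
  by move: Qu; rewrite (QdenE s01 sd sbO O0 Eu) lte_fin => /andP[].
rewrite (rayleighE s01 sd sbO O0 Eu) in ray.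
have au : energy s Om ubar ubar = mu * hardy_form s Om ubar ubar.
  by rewrite -ray divfK// gt_eqF.
have mu0 : 0 <= mu.
  by rewrite -ray; apply: divr_ge0 (ltW bu); exact: (energy_ge0 s01 sd sbO Eu).
have qge0 u : Es s D u -> mu * hardy_form s Om u u <= energy s Om u u.
  exact: (LambdaN_le s01 sd sbO O0).
have mu0L : 0 <= mu < LambdaH d s by rewrite mu0.
have [c c0 Hgap] := gap s01 sd sbO O0 oD mu0L qge0.
have Elin u v t := @Es_lin R d s D oD u v t.
have alin u v w t := @energy_lin R d s Om D sbO oD u v w t.
have blin u v w t := @hardy_lin R d s s01 sd Om D sbO O0 oD u v w t.
have llin u v t := @mean_lin R d s Om D sbO oD u v t.
have bge0 u := @hardy_ge0 R d s s01 sd Om D sbO O0 u.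
have zero u := @energy_hardy_zero R d s s01 sd Om D sbO O0 u.
have aC := energyC s Om; have bC := hardyC s Om.
split.
  move=> v [Ev Hv].
  exact: (eigenvalue_simple Elin aC bC alin blin llin bge0 qge0 c0 Hgap zero Eu bu au Ev Hv).
(* The isolation radius is the gap constant itself. *)
exists c => // lam lamc v [Ev Hv].
exact: (eigenvalue_isolated Elin aC bC alin blin llin bge0 qge0 c0 Hgap zero Eu bu au lamc Ev Hv).
Qed.
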